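(* Let $\mathscr{M}$ be a bounded set of triples, let $\mathcal{T}$ be a class of measurable switching laws with values in $\mathscr{M}$, and let $\mathcal{G}=\cup_{t\ge 0}\mathcal{G}_t$ be a family with $\mathcal{G}_\infty\subset\mathcal{T}$. Consider the switched linear control system $$\dot x(t)=A(t)x(t)+B(t)u(t),\qquad y(t)=C(t)x(t),\qquad (A,B,C)\in\mathcal{T},$$ and assume that it admits a minimal realization on $\mathbb{R}^{n'}$, $n'\le n$, associated with the class $\mathcal{T}^{\rm min}=\Pi(\mathcal{T})$ of switching signals taking values in $\mathscr{M}^{\rm min}=\Pi(\mathscr{M})$ and with the family $\mathcal{G}^{\rm min}=\Pi(\mathcal{G})$, such that: (a) $(\mathcal{T}^{\rm min},\mathcal{G}^{\rm min})$ satisfies Assumptions T1 and T2; (b) for every subspace $V$ of $\mathbb{R}^{n'}$ and every linear projection $P_V:\mathbb{R}^{n'}\to V$, the pair of classes of $\mathrm{End}(V)$-valued signals $(P_V\mathcal{T}_A^{\rm min}P_V^{\#},\,P_V\mathcal{G}_A^{\rm min}P_V^{\#})$ satisfies Assumption A3 (on the vector space $V$), where $P_V^{\#}:V\to\mathbb{R}^{n'}$ is the dual map defined by $x^TP_Vy=y^TP_V^{\#}x$ for all $x\in V$, $y\in\mathbb{R}^{n'}$. Then $\gamma_2(\mathcal{T})$ is finite if $\rho(\mathcal{T}_A^{\rm min})<1$, and $\gamma_2(\mathcal{T})=+\infty$ if either $\rho(\mathcal{T}_A^{\rm min})>1$, or $\rho(\mathcal{T}_A^{\rm min})=1$ and $\mathcal{T}^{\rm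 min}$ is uniformly observable.
   Context: Signals. For a subset $\mathscr{N}$ of a finite-dimensional space, $L_\infty(I,\mathscr{N})$ denotes the bounded measurable functions $I\to\mathscr{N}$. $\Phi_A(t,s)$ is the flow (fundamental matrix) of $\dot x=A(\cdot)x$ from time $s$ to time $t$. The concatenation $A_1\ast A_2$ of signals on $[0,t_1]$, $[0,t_2]$ is the signal on $[0,t_1+t_2]$ equal to $A_1$ on $[0,t_1]$ and to $A_2(\cdot-t_1)$ on $(t_1,t_1+t_2]$ (similarly for infinite concatenations and for sets of signals). $\mathcal{F}^{\rm pc}_t(\mathscr{N})$ is the set of piecewise constant signals $[0,t]\to\mathscr{N}$ (finitely many discontinuities and values), $\mathcal{F}^{\rm arb}_t(\mathscr{N})=L_\infty([0,t],\mathscr{N})$. For a family $\mathcal{F}=\cup_{t\ge0}\mathcal{F}_t$ with $\mathcal{F}_t\subset L_\infty([0,t],\mathscr{N})$, set $\mathcal{F}_\infty=\{A_1\ast A_2\ast\cdots\mid A_k\in\mathcal{F}_{t_k},\ \sum_k t_k=\infty\}$; for matrix-valued families, $\Phi(\mathcal{F}_t)=\{\Phi_A(t,0)\mid A\in\mathcal{F}_t\}$. For a class $\mathcal{S}$ of matrix-valued signals on $[0,\infty)$ with values in a bounded set, the generalized spectral radius is $\rho(\mathcal{S})=\limsup_{t\to+\infty}\sup_{A\in\mathcal{S}}\|\Phi_A(t,0)\|^{1/t}$. Assumptions on a pair $(\mathcal{S},\mathcal{F})$ of square-matrix-valued signals (size $d$) with values in a bounded set $\mathscr{N}$: - A0: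 $A(t+\cdot)\in\mathcal{S}$ for all $A\in\mathcal{S}$, $t\ge0$. - A1: $\mathcal{F}_s\ast\mathcal{F}_t\subset\mathcal{F}_{s+t}$ for all $s,t\ge0$. - A3: $\mathcal{F}_\infty\subset\mathcal{S}$ and there exist constants $C,\Delta\ge0$ and a compact $\mathscr{K}\subset\mathrm{GL}(d)$ such that for every $t\ge0$ and $A\in\mathcal{S}$ there exist $K\in\mathscr{K}$, $\hat t\in[t,t+\Delta]$, $R\in\Phi(\mathcal{F}_{\hat t})$ with $\|\Phi_A(t,0)KR^{-1}\|\le C$; moreover, if $A\in\mathcal{F}_\infty$, one can take $K=\mathrm{Id}_d$. - A4: for every $t,\varepsilon>0$ and $A\in\mathcal{F}^{\rm pc}_t(\mathscr{N})$ there is a path $(0,1]\ni\lambda\mapsto(t_\lambda,A_\lambda)$, $t_\lambda>0$, $A_\lambda\in\mathcal{F}^{\rm arb}_{t_\lambda}(\mathscr{N})$, such that $\lambda\mapsto\Phi_{A_\lambda}(t_\lambda,0)$ is analytic, $\|\Phi_{A_1}(t_1,0)-\Phi_A(t,0)\|\le\varepsilon$, and $\{\lambda\mid A_\lambda\in\mathcal{F}\}$ has nonempty interior. Control systems. Let $\mathscr{M}\subset M_n(\mathbb{R})\times M_{n,m}(\mathbb{R})\times M_{p,n}(\mathbb{R})$ be bounded ($n,m,p$ positive integers). $\mathscr{M}_A,\mathcal{T}_A,\mathcal{G}_A$, etc. denote projections onto the first component $A$. The controllability and observability Gramians in time $t$ of $(A,B,C)$ are $W^c(t)=\int_0^t\Phi_A(0,s)B(s)B(s)^T\Phi_A(0,s)^Tds$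 and $W^o(t)=\int_0^t\Phi_A(s,0)^TC(s)^TC(s)\Phi_A(s,0)ds$. The $L_2$-gain is $\gamma_2(\mathcal{T})=\sup\{\|y_{u,\sigma}\|_2/\|u\|_2\mid u\in L_2([0,\infty),\mathbb{R}^m)\setminus\{0\},\ \sigma\in\mathcal{T}\}\in[0,\infty]$, where $y_{u,\sigma}$ is the output for $x(0)=0$. Assumptions on $(\mathcal{T},\mathcal{G})$ (with values in $\mathscr{M}$): - T1: $(\mathcal{T}_A,\mathcal{G}_A)$ satisfies A0 and A1. - T2: $(\mathcal{T}_A,\mathcal{G}_A)$ satisfies A4 (with $\mathscr{N}=\mathscr{M}_A$); moreover for every $t^*,\varepsilon>0$ and $(A,B,C)\in\mathcal{F}^{\rm pc}_{t^*}(\mathscr{M})$, with Gramians $W^c(t^* ),W^o(t^* )$, there is a path $[0,1]\ni\lambda\mapsto(t_\lambda,A_\lambda,B_\lambda,C_\lambda)\in(0,\infty)\times\mathcal{F}^{\rm arb}_{t_\lambda}(\mathscr{M})$ such that, denoting by $W^c_\lambda(t_\lambda),W^o_\lambda(t_\lambda)$ its Gramians in time $t_\lambda$: $\lambda\mapsto(W^c_\lambda(t_\lambda),W^o_\lambda(t_\lambda))$ is analytic; $\|W^c_1(t_1)-W^c(t^* )\|\le\varepsilon$ and $\|W^o_1(t_1)-W^o(t^* )\|\le\varepsilon$; and $\{\lambda\mid(A_\lambda,B_\lambda,C_\lambda)\in\mathcal{G}\}$ has nonempty interior. Minimal realization. Let $\mathcal{V}(\mathscr{M})$ be the smallest subspace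 of $\mathbb{R}^n$ containing the ranges of all $B$, $(A,B,C)\in\mathscr{M}$, and invariant under all $A\in\mathscr{M}_A$; let $r$ be its dimension. Choose an invertible $P$ whose first $r$ columns span $\mathcal{V}(\mathscr{M})$ and put $\Pi^c(A,B,C)=(UP^{-1}APU^T,UP^{-1}B,CPU^T)$, $U=(\mathrm{Id}_r\ 0)$. For $\mathscr{M}^c=\Pi^c(\mathscr{M})$ (a set of triples on $\mathbb{R}^r$) let $N\subset\mathbb{R}^r$ be the largest subspace contained in $\ker C$ for all $(A,B,C)\in\mathscr{M}^c$ and invariant under all $A\in\mathscr{M}^c_A$; let $n'=r-\dim N$. Choose an invertible $Q\in M_r(\mathbb{R})$ whose last $r-n'$ columns span $N$ and put $\Pi^o(A,B,C)=(VQ^{-1}AQV^T,VQ^{-1}B,CQV^T)$, $V=(\mathrm{Id}_{n'}\ 0)$. With $\Pi=\Pi^o\circ\Pi^c$ applied pointwise in time, the system on $\mathbb{R}^{n'}$ associated with $\Pi(\mathcal{T})$ is called a minimal realization of the system associated with $\mathcal{T}$. Uniform observability. A class of switching laws on $\mathbb{R}^{n'}$ is uniformly observable if there exist $T,\gamma>0$ such that for every $(A,B,C)$ in the class and every $t\ge0$, the observability Gramian in time $T$ of $(A(t+\cdot),B(t+\cdot),C(t+\cdot))$ is $\ge\gamma\,\mathrm{Id}_{n'}$. *)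

(* Defs.v *)
From HB Require Import structures.
From mathcomp Require Import all_boot all_order all_algebra.
From mathcomp Require Import all_classical all_reals all_analysis.

Set Implicit Arguments.
Unset Strict Implicit.
Unset Printing Implicit Defensive.

Import Order.TTheory GRing.Theory Num.Theory.
Import numFieldNormedType.Exports.

Local Open Scope classical_set_scope.
Local Open Scope ring_scope.

(** A signal with domain [D] and values in [X] is a total function [R -> X] of
    which only the restriction to [D] is meaningful: every predicate and set of
    signals below is insensitive to the values taken off its domain.  A class
    of signals on [[0, +oo[] is a [set (R -> X)]; a family [(F_t)_(t >= 0)]
    with [F_t] made of signals on [[0, t]] is an [R -> set (R -> X)], whose
    members at negative [t] are irrelevant.

    Measurable means Borel: every class of a.e. equal measurable functions with
    values in a set N has a Borel representative with values in N.

    Norms of matrices are those of the library (largest absolute value of an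
    entry); the notions below do not depend on this choice. *)

Definition halfline (R : realType) : set R := `[0, +oo[.
Definition segment0 (R : realType) (t : R) : set R := `[0, t].

Definition class_ext (R : realType) (X : Type) (D : set R)
    (S : set (R -> X)) : Prop :=
  forall a b : R -> X, {in D, a =1 b} -> S a -> S b.

(* All the signals which agree on [D] with the composite of [f] and a member of
   [S], so that the image is again insensitive to values off [D]. *)
Definition class_image (R : realType) (X Y : Type) (D : set R) (f : X -> Y)
    (S : set (R -> X)) : set (R -> Y) :=
  [set b | exists2 a, S a & {in D, forall s, b s = f (a s)}].

Definition shift (R : realType) (X : Type) (t : R) (a : R -> X) : R -> X :=
  fun s => a (t + s).

Definition concat (R : realType) (X : Type) (t1 : R) (a1 a2 : R -> X) : R -> X :=
  fun s => if s <= t1 then a1 s else a2 (s - t1).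

(* [F_oo]: infinite concatenations a_0 * a_1 * ... of signals a_k in F_(d_k),
   with sum_k d_k = +oo; [series d k] is the k-th switching instant. *)
Definition concat_infty (R : realType) (X : Type) (F : R -> set (R -> X)) :
    set (R -> X) :=
  [set a | exists (d : nat -> R) (b : nat -> R -> X),
     [/\ forall k, 0 <= d k,
         forall k, F (d k) (b k),
         series d @ \oo --> +oo,
         a 0 = b 0%N 0 &
         forall k s, series d k < s <= series d k.+1 ->
           a s = b k (s - series d k)]].

(* Piecewise constant signals [0, t] -> N: constant on each subinterval of
   [0, t] which avoids some finite set of instants. *)
Definition sig_pc (R : realType) (X : Type) (N : set X) (t : R) :
    set (R -> X) :=
  [set a | {in segment0 t, forall s, N (a s)} /\
     exists2 E : set R, finite_set E &
       forall s1 s2 : R, 0 <= s1 -> s1 <= s2 -> s2 <= t ->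
         (forall s : R, s1 <= s <= s2 -> ~ E s) -> a s1 = a s2].

Definition mx_measurable (R : realType) (k l : nat) (D : set R)
    (A : R -> 'M[R]_(k, l)) : Prop :=
  forall i j, measurable_fun D (fun s => A s i j).

(* L_oo(D, N) for a set N of matrices. *)
Definition Linfty_mx (R : realType) (k l : nat) (D : set R)
    (N : set 'M[R]_(k, l)) : set (R -> 'M[R]_(k, l)) :=
  [set A | [/\ {in D, forall s, N (A s)}, mx_measurable D A &
               [bounded A s | s in D]]].

Definition triple (R : realType) (n m p : nat) : Type :=
  ('M[R]_n * 'M[R]_(n, m) * 'M[R]_(p, n))%type.

Definition mxA (R : realType) (n m p : nat) (s : triple R n m p) : 'M[R]_n :=
  s.1.1.
Definition mxB (R : realType) (n m p : nat) (s : triple R n m p) :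
  'M[R]_(n, m) := s.1.2.
Definition mxC (R : realType) (n m p : nat) (s : triple R n m p) :
  'M[R]_(p, n) := s.2.

Definition bounded_triples (R : realType) (n m p : nat)
    (M : set (triple R n m p)) : Prop :=
  exists c : R, forall s, M s ->
    [/\ `|mxA s| <= c, `|mxB s| <= c & `|mxC s| <= c].

(* L_oo(D, M) for a set M of triples. *)
Definition Linfty_triple (R : realType) (n m p : nat) (D : set R)
    (M : set (triple R n m p)) : set (R -> triple R n m p) :=
  [set a | [/\ {in D, forall s, M (a s)},
               [/\ mx_measurable D (fun s => mxA (a s)),
                   mx_measurable D (fun s => mxB (a s)) &
                   mx_measurable D (fun s => mxC (a s))] &
               bounded_triples (a @` D)]].

Definition classA (R : realType) (n m p : nat)
    (T : set (R -> triple R n m p)) : set (R -> 'M[R]_n) :=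
  class_image (@halfline R) (@mxA R n m p) T.

Definition familyA (R : realType) (n m p : nat)
    (G : R -> set (R -> triple R n m p)) : R -> set (R -> 'M[R]_n) :=
  fun t => class_image (segment0 t) (@mxA R n m p) (G t).

Definition oint (R : realType) (a b : R) (f : R -> R) : R :=
  if a <= b then \int[lebesgue_measure]_(x in `[a, b]) f x
  else - \int[lebesgue_measure]_(x in `[b, a]) f x.

Definition mx_oint (R : realType) (k l : nat) (a b : R)
    (F : R -> 'M[R]_(k, l)) : 'M[R]_(k, l) :=
  \matrix_(i, j) oint a b (fun x => F x i j).

(* [X] is, on the segment with endpoints s and t, the (Caratheodory) solution
   of X' = A X with X(s) = Id. *)
Definition fundamental_solution (R : realType) (d : nat) (A : R -> 'M[R]_d)
    (s t : R) (X : R -> 'M[R]_d) : Prop :=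
  let J : set R := `[Num.min s t, Num.max s t]%classic in
  {within J, continuous X} /\
  {in J, forall r, X r = 1%:M + mx_oint s r (fun q => A q *m X q)}.

(* Phi_A(t, s); the default value 0 is never used when A is bounded and
   measurable on the segment with endpoints s and t. *)
Definition flow (R : realType) (d : nat) (A : R -> 'M[R]_d) (t s : R) :
    'M[R]_d :=
  xget 0 [set X t | X in [set X | fundamental_solution A s t X]].

Definition gen_spectral_radius (R : realType) (d : nat)
    (S : set (R -> 'M[R]_d)) : \bar R :=
  limf_esup
    (fun t : R => ereal_sup [set (`|flow A t 0| `^ t^-1)%:E | A in S])
    (pinfty_nbhs R).

(* Real analyticity on a subset D of the line (an interval in use), one-sided
   at the endpoints belonging to D. *)
Definition analytic_on (R : realType) (D : set R) (f : R -> R) : Prop :=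
  forall x, D x -> exists c : nat -> R, exists2 e : R, 0 < e &
    forall y, D y -> `|y - x| < e ->
      series (fun k => c k * (y - x) ^+ k) @ \oo --> f y.

Definition mx_analytic_on (R : realType) (k l : nat) (D : set R)
    (F : R -> 'M[R]_(k, l)) : Prop :=
  forall i j, analytic_on D (fun x => F x i j).

Definition assumption_A0 (R : realType) (d : nat)
    (S : set (R -> 'M[R]_d)) : Prop :=
  forall A (t : R), S A -> 0 <= t -> S (shift t A).

Definition assumption_A1 (R : realType) (d : nat)
    (F : R -> set (R -> 'M[R]_d)) : Prop :=
  forall (s t : R) A1 A2, 0 <= s -> 0 <= t -> F s A1 -> F t A2 ->
    F (s + t) (concat s A1 A2).

Definition assumption_A3 (R : realType) (d : nat)
    (S : set (R -> 'M[R]_d)) (F : R -> set (R -> 'M[R]_d)) : Prop :=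
  concat_infty F `<=` S /\
  exists (C Delta : R) (K : set 'M[R]_d),
    [/\ 0 <= C, 0 <= Delta, compact K, K `<=` [set k | k \in unitmx] &
     forall (t : R) A, 0 <= t -> S A ->
       exists k (th : R) A',
         [/\ K k, t <= th <= t + Delta, F th A',
             `|flow A t 0 *m k *m invmx (flow A' th 0)| <= C &
             concat_infty F A -> k = 1%:M]].

Definition assumption_A4 (R : realType) (d : nat) (N : set 'M[R]_d)
    (F : R -> set (R -> 'M[R]_d)) : Prop :=
  forall (t eps : R) A, 0 < t -> 0 < eps -> sig_pc N t A ->
    let I01 : set R := `]0, 1]%classic in
    exists (tl : R -> R) (Al : R -> R -> 'M[R]_d),
      [/\ {in I01, forall l, 0 < tl l},
          {in I01, forall l, Linfty_mx (segment0 (tl l)) N (Al l)},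
          mx_analytic_on I01 (fun l => flow (Al l) (tl l) 0),
          `|flow (Al 1) (tl 1) 0 - flow A t 0| <= eps &
          interior [set l | I01 l /\ F (tl l) (Al l)] !=set0].

Definition ctrl_gramian (R : realType) (n m p : nat)
    (a : R -> triple R n m p) (t : R) : 'M[R]_n :=
  let Phi := flow (fun s => mxA (a s)) in
  mx_oint 0 t (fun s =>
    Phi 0 s *m mxB (a s) *m (mxB (a s))^T *m (Phi 0 s)^T).

Definition obs_gramian (R : realType) (n m p : nat)
    (a : R -> triple R n m p) (t : R) : 'M[R]_n :=
  let Phi := flow (fun s => mxA (a s)) in
  mx_oint 0 t (fun s =>
    (Phi s 0)^T *m (mxC (a s))^T *m mxC (a s) *m Phi s 0).

Definition assumption_T1 (R : realType) (n m p : nat)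
    (T : set (R -> triple R n m p)) (G : R -> set (R -> triple R n m p)) :
    Prop :=
  assumption_A0 (classA T) /\ assumption_A1 (familyA G).

Definition assumption_T2 (R : realType) (n m p : nat)
    (M : set (triple R n m p)) (G : R -> set (R -> triple R n m p)) : Prop :=
  assumption_A4 (@mxA R n m p @` M) (familyA G) /\
  forall (t eps : R) a, 0 < t -> 0 < eps -> sig_pc M t a ->
    let I01 : set R := `[0, 1]%classic in
    exists (tl : R -> R) (al : R -> R -> triple R n m p),
      [/\ {in I01, forall l, 0 < tl l},
          {in I01, forall l, Linfty_triple (segment0 (tl l)) M (al l)},
          mx_analytic_on I01 (fun l => ctrl_gramian (al l) (tl l)) /\
          mx_analytic_on I01 (fun l => obs_gramian (al l) (tl l)),
          `|ctrl_gramian (al 1) (tl 1) - ctrl_gramian a t| <= eps /\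
          `|obs_gramian (al 1) (tl 1) - obs_gramian a t| <= eps &
          interior [set l | I01 l /\ G (tl l) (al l)] !=set0].

Definition uniformly_observable (R : realType) (n m p : nat)
    (T : set (R -> triple R n m p)) : Prop :=
  exists T0 gamma : R, [/\ 0 < T0, 0 < gamma &
    forall a (t : R), T a -> 0 <= t -> forall x : 'cV[R]_n,
      gamma * (x^T *m x) 0 0 <= (x^T *m obs_gramian (shift t a) T0 *m x) 0 0].

(* The L_2 norm on [0, +oo) with the Euclidean norm on R^k, possibly +oo. *)
Definition L2norm (R : realType) (k : nat) (u : R -> 'cV[R]_k) : \bar R :=
  ((\int[lebesgue_measure]_(t in @halfline R)
      (\sum_(i < k) (u t i 0) ^+ 2)%:E) `^ 2^-1)%E.

Definition L2 (R : realType) (k : nat) : set (R -> 'cV[R]_k) :=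
  [set u | mx_measurable (@halfline R) u /\ (L2norm u < +oo)%E].

Definition ae_zero (R : realType) (k : nat) (u : R -> 'cV[R]_k) : Prop :=
  {ae (@lebesgue_measure R), forall t, @halfline R t -> u t = 0}.

(* [x] is the trajectory of x' = A x + B u issued from x(0) = 0. *)
Definition trajectory (R : realType) (n m p : nat)
    (a : R -> triple R n m p) (u : R -> 'cV[R]_m) (x : R -> 'cV[R]_n) : Prop :=
  {within @halfline R, continuous x} /\
  forall t : R, 0 <= t ->
    x t = mx_oint 0 t (fun s => mxA (a s) *m x s + mxB (a s) *m u s).

(* The supremum is taken in [0, +oo], hence is 0 when T is empty. *)
Definition L2gain (R : realType) (n m p : nat)
    (T : set (R -> triple R n m p)) : \bar R :=
  maxe 0%E (ereal_sup [set g : \bar R | exists a u x,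
    [/\ T a, L2 u, ~ ae_zero u, trajectory a u x &
        g = (L2norm (fun t => (mxC (a t) *m x t : 'cV[R]_p)) / L2norm u)%E]]).

Definition contains_reachable (R : realType) (n m p : nat)
    (M : set (triple R n m p)) (V : {vspace 'cV[R]_n}) : Prop :=
  forall s, M s -> (forall v : 'cV[R]_m, mxB s *m v \in V) /\
                   (forall x, x \in V -> mxA s *m x \in V).

Definition reachable_space (R : realType) (n m p : nat)
    (M : set (triple R n m p)) (V : {vspace 'cV[R]_n}) : Prop :=
  contains_reachable M V /\
  forall W : {vspace 'cV[R]_n}, contains_reachable M W -> (V <= W)%VS.

Definition within_unobservable (R : realType) (n m p : nat)
    (M : set (triple R n m p)) (V : {vspace 'cV[R]_n}) : Prop :=
  forall s, M s -> (forall x, x \in V -> mxC s *m x = 0) /\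
                   (forall x, x \in V -> mxA s *m x \in V).

Definition unobservable_space (R : realType) (n m p : nat)
    (M : set (triple R n m p)) (V : {vspace 'cV[R]_n}) : Prop :=
  within_unobservable M V /\
  forall W : {vspace 'cV[R]_n}, within_unobservable M W -> (W <= V)%VS.

(* (A, B, C) |-> (U P^-1 A P U^T, U P^-1 B, C P U^T) with U = (Id_k 0). *)
Definition reduce (R : realType) (n m p k : nat) (P : 'M[R]_n)
    (s : triple R n m p) : triple R k m p :=
  let U : 'M[R]_(k, n) := pid_mx k in
  (U *m invmx P *m mxA s *m P *m U^T,
   U *m invmx P *m mxB s,
   mxC s *m P *m U^T).

Definition col_span (R : realType) (n : nat) (P : 'M[R]_n) (c : pred 'I_n) :
    {vspace 'cV[R]_n} :=
  <<[seq col j P | j <- enum 'I_n & c j]>>%VS.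

(* P and Q are admissible choices in the construction of a minimal realization
   on R^n', r being the dimension of the reachable space. *)
Definition minimal_realization (R : realType) (n m p r n' : nat)
    (M : set (triple R n m p)) (P : 'M[R]_n) (Q : 'M[R]_r) : Prop :=
  (exists V : {vspace 'cV[R]_n},
     [/\ reachable_space M V, r = \dim V, P \in unitmx &
         col_span P (fun j => (j < r)%N) = V]) /\
  (exists N : {vspace 'cV[R]_r},
     [/\ unobservable_space (@reduce R n m p r P @` M) N,
         n' = (r - \dim N)%N, Q \in unitmx &
         col_span Q (fun j => (n' <= j)%N) = N]).

Definition min_map (R : realType) (n m p r n' : nat) (P : 'M[R]_n)
    (Q : 'M[R]_r) (s : triple R n m p) : triple R n' m p :=
  reduce n' Q (reduce r P s).

(* The matrix, acting on columns, of an endomorphism of W in the basis of W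
   fixed by the library. *)
Definition mx_of_end (R : realType) (W : vectType R) (f : W -> W) :
    'M[R]_(\dim {:W}) :=
  \matrix_(i, j) coord (vbasis {:W}) i (f (vbasis {:W})`_j).

Definition is_projection (R : realType) (n : nat) (V : {vspace 'cV[R]_n})
    (PV : 'Hom('cV[R]_n, subvs_of V)) : Prop :=
  forall x : subvs_of V, PV (vsval x) = x.

Definition is_dual (R : realType) (n : nat) (V : {vspace 'cV[R]_n})
    (PV : 'Hom('cV[R]_n, subvs_of V)) (PS : 'Hom(subvs_of V, 'cV[R]_n)) :
    Prop :=
  forall (x : subvs_of V) (y : 'cV[R]_n),
    (vsval x)^T *m vsval (PV y) = y^T *m PS x.

(* P_V A P_V^#, as a matrix. *)
Definition compress (R : realType) (n : nat) (V : {vspace 'cV[R]_n})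
    (PV : 'Hom('cV[R]_n, subvs_of V)) (PS : 'Hom(subvs_of V, 'cV[R]_n))
    (A : 'M[R]_n) : 'M[R]_(\dim {:subvs_of V}) :=
  mx_of_end (fun x : subvs_of V => PV (A *m PS x)).

Definition compressions_A3 (R : realType) (n : nat) (S : set (R -> 'M[R]_n))
    (F : R -> set (R -> 'M[R]_n)) : Prop :=
  forall (V : {vspace 'cV[R]_n}) (PV : 'Hom('cV[R]_n, subvs_of V))
    (PS : 'Hom(subvs_of V, 'cV[R]_n)),
    is_projection PV -> is_dual PV PS ->
    assumption_A3 (class_image (@halfline R) (compress PV PS) S)
      (fun t => class_image (segment0 t) (compress PV PS) (F t)).

(* Main.v *)
Require Import Defs.
From HB Require Import structures.
From mathcomp Require Import all_boot all_order all_algebra.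
From mathcomp Require Import all_classical all_reals all_analysis.
From mathcomp Require Import measurable_realfun ring lra zify.
Set Implicit Arguments.
Unset Strict Implicit.
Unset Printing Implicit Defensive.
Import Order.TTheory GRing.Theory Num.Theory.
Import numFieldNormedType.Exports.
Local Open Scope classical_set_scope.
Local Open Scope ring_scope.

(** Issued from the origin, a system and its minimal realization have the same
    outputs.  If the spectral radius is below 1, the flows decay like
    [K exp(- l t)], and an L_2 convolution estimate bounds the output energy by
    the energy of the input.

    Conversely, assume that the gain is finite.  A piecewise constant signal
    whose Gramian has the largest rank has an invertible Gramian, and along the
    analytic paths of T2 the determinant does not vanish identically, so that
    some [gc] in G has an invertible controllability Gramian and some [go] in G
    an invertible observability Gramian.  Follow [gc], steering the origin to
    an arbitrary state [xi] with energy [O(|xi|^2)], then any [g] in G, then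
    [go], with zero input: finiteness of the gain bounds the flow of [g]
    uniformly.  By A3 on the whole space all the flows are bounded, hence the
    spectral radius is at most 1.  If it equals 1, then by submultiplicativity
    the flows of the class are not all small at any time, so that by A3 some
    signals [gc * g], with [g] arbitrarily long, carry a unit state which stays
    away from 0; under uniform observability the energy of the free output is
    then unbounded, a contradiction. *)

(** T2 does not put the piecewise constant signal itself in G: it gives a path that ends near it and
    of which only some parameter interval lies in G. Invertibility has to travel from the end of the
    path to that interval; this is analytic continuation of the determinant, started by the openness
    of the set of invertible matrices. The frame [gc], [g], [go] is forced by the gain, which only
    sees inputs applied at the state 0 and outputs: [gc] converts inputs into arbitrary states, [go]
    converts states into output energy, and the constants are fixed before [g] and its length are
    chosen. Other signals of T need not be concatenations; A3 dominates each of their flows by a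
    flow of G at a time which is not earlier. This gives an upper bound for the former and, when the
    radius is 1, a lower bound for the latter. The chosen state then stays away from 0 because
    uniformly bounded flows cannot bring a small state back to a fixed size. *)

(** * Primitives of locally integrable functions on the half-line *)

Section Primitive.
Variable R : realType.
Implicit Types (f g h : R -> R) (s t : R).
Notation mu := (@lebesgue_measure R).

(** The interval is empty for negative [t], so [prim f] is 0 there; integral equations can then be
    written for every real time. *)
Definition prim f t : R := \int[mu]_(x in `[0, t]) f x.

Definition loc_int f : Prop := forall t, mu.-integrable `[0, t] (EFin \o f).

(** The class of coefficients: multiplication by such a function preserves [loc_int], the class of
    inputs. *)
Definition lbm f : Prop :=
  measurable_fun setT f /\
  forall t, exists c, forall s, 0 <= s <= t -> `|f s| <= c.

Lemma mseg (a b : R) : measurable (`[a, b] : set R).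
Proof. exact: measurable_itv. Qed.

Lemma lbm_bounded f t : lbm f -> [bounded f x | x in (`[0, t] : set R)].
Proof.
move=> [_ /(_ t)[c cP]]; exists c; split; first exact: num_real.
by move=> M cM x /=; rewrite in_itv/= => /cP /le_trans; apply; exact: ltW.
Qed.

Lemma lbm_loc_int f : lbm f -> loc_int f.
Proof.
move=> bf t; apply: measurable_bounded_integrable => //.
- by rewrite /= lebesgue_measure_itv; case: ifP => //= _; rewrite -EFinD ltry.
- by apply: measurable_funS bf.1.
- exact: lbm_bounded.
Qed.

Lemma lbm_cst c : lbm (fun=> c).
Proof. by split=> [|t]; [exact: measurable_cst | exists `|c|]. Qed.

Lemma lbmD f g : lbm f -> lbm g -> lbm (fun s => f s + g s).
Proof.
move=> [mf bf] [mg bg]; split; first exact: measurable_funD.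
move=> t; have [c cP] := bf t; have [e eP] := bg t; exists (c + e) => s st.
by rewrite (le_trans (ler_normD _ _))// lerD ?cP ?eP.
Qed.

Lemma lbmM f g : lbm f -> lbm g -> lbm (fun s => f s * g s).
Proof.
move=> [mf bf] [mg bg]; split; first exact: measurable_funM.
move=> t; have [c cP] := bf t; have [e eP] := bg t; exists (c * e) => s st.
by rewrite normrM ler_pM ?cP ?eP.
Qed.

Lemma lbm_sum (I : Type) (r : seq I) (F : I -> R -> R) :
  (forall i, lbm (F i)) -> lbm (fun s => \sum_(i <- r) F i s).
Proof.
move=> bF; elim: r => [|i r IH].
  by under eq_fun do rewrite big_nil; exact: lbm_cst.
by under eq_fun do rewrite big_cons; exact: lbmD.
Qed.

Lemma continuous_lbm f : continuous f -> lbm f.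
Proof.
move=> cf; split; first exact: continuous_measurable_fun.
move=> t; have /compact_bounded : compact (f @` `[0, t]).
  by apply: continuous_compact; [exact: continuous_subspaceT|exact: segment_compact].
move=> [M [_ /(_ (M + 1))]]; rewrite ltrDl ltr01 => /(_ isT) MP.
by exists (M + 1) => s st; apply: MP; exists s => //=; rewrite in_itv.
Qed.

Lemma loc_intM f g : lbm f -> loc_int g -> loc_int (fun s => f s * g s).
Proof.
move=> bf ig t; apply: (integrableMr _ _ _ (ig t)) => //.
  by apply: measurable_funS bf.1.
exact: lbm_bounded.
Qed.

Lemma loc_intD f g : loc_int f -> loc_int g -> loc_int (fun s => f s + g s).
Proof. by move=> jf jg t; exact: (integrableD _ (jf t) (jg t)). Qed.

Lemma loc_intZ c f : loc_int f -> loc_int (fun s => c * f s).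
Proof. by apply: loc_intM; exact: lbm_cst. Qed.

Lemma loc_intN f : loc_int f -> loc_int (fun s => - f s).
Proof. by move=> /(loc_intZ (-1)) jf; under eq_fun do rewrite -mulN1r. Qed.

Lemma loc_int_sum (I : Type) (r : seq I) (F : I -> R -> R) :
  (forall i, loc_int (F i)) -> loc_int (fun s => \sum_(i <- r) F i s).
Proof.
move=> bF; elim: r => [|i r IH].
  by under eq_fun do rewrite big_nil; exact/lbm_loc_int/lbm_cst.
by under eq_fun do rewrite big_cons; exact: loc_intD.
Qed.

Lemma loc_int_norm f : loc_int f -> loc_int (fun s => `|f s|).
Proof. by move=> jf t; exact: integrable_norm. Qed.

Lemma prim_neg f t : t < 0 -> prim f t = 0.
Proof. by move=> t0; rewrite /prim set_itv_ge ?Rintegral_set0// bnd_simp -ltNge. Qed.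

Lemma prim0 f : prim f 0 = 0.
Proof. by rewrite /prim set_itv1 Rintegral_set1. Qed.

Lemma primD f g t : loc_int f -> loc_int g ->
  prim (fun s => f s + g s) t = prim f t + prim g t.
Proof. by move=> jf jg; rewrite /prim RintegralD. Qed.

Lemma primZ c f t : loc_int f -> prim (fun s => c * f s) t = c * prim f t.
Proof. by move=> jf; rewrite /prim RintegralZl. Qed.

Lemma primN f t : loc_int f -> prim (fun s => - f s) t = - prim f t.
Proof.
by move=> jf; under eq_fun do rewrite -mulN1r; rewrite primZ// mulN1r.
Qed.

Lemma primB f g t : loc_int f -> loc_int g ->
  prim (fun s => f s - g s) t = prim f t - prim g t.
Proof. by move=> jf jg; rewrite primD ?primN//; exact: loc_intN. Qed.

Lemma prim_cst0 t : prim (fun=> 0) t = 0.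
Proof. by rewrite /prim Rintegral_cst// mul0r. Qed.

Lemma prim_sum (I : Type) (r : seq I) (F : I -> R -> R) t :
  (forall i, loc_int (F i)) ->
  prim (fun s => \sum_(i <- r) F i s) t = \sum_(i <- r) prim (F i) t.
Proof.
move=> bF; elim: r => [|i r IH].
  by under eq_fun do rewrite big_nil; rewrite prim_cst0 big_nil.
under eq_fun do rewrite big_cons.
by rewrite big_cons primD ?IH//; exact: loc_int_sum.
Qed.

Lemma prim_le f g t : loc_int f -> loc_int g ->
  (forall s, 0 <= s <= t -> f s <= g s) -> prim f t <= prim g t.
Proof.
by move=> jf jg fg; apply: le_Rintegral.
Qed.

Lemma prim_ge0 f t : (forall s, 0 <= s <= t -> 0 <= f s) -> 0 <= prim f t.
Proof. by move=> f0; apply: Rintegral_ge0 => s /=; rewrite in_itv/=; exact: f0. Qed.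

Lemma prim_norm f t : loc_int f -> `|prim f t| <= prim (fun s => `|f s|) t.
Proof. by move=> jf; apply: le_normr_Rintegral. Qed.

Lemma eq_prim f g t : (forall s, 0 <= s <= t -> f s = g s) -> prim f t = prim g t.
Proof.
move=> fg; apply: eq_Rintegral => s; rewrite inE/= in_itv/=.
by move=> st; rewrite fg.
Qed.

Lemma prim_cst c t : 0 <= t -> prim (fun=> c) t = c * t.
Proof.
move=> t0; rewrite /prim Rintegral_cst//= lebesgue_measure_itv/= lte_fin.
by case: ltgtP t0 => // [t0|<-] _; rewrite ?mulr0//= oppr0 addr0.
Qed.

Lemma prim_cat f s t : 0 <= s -> s <= t -> loc_int f ->
  prim f t - prim f s = \int[mu]_(x in `]s, t]) f x.
Proof. by move=> s0 st jf; rewrite /prim Rintegral_itvB ?bnd_simp. Qed.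

(** Cutting [f] off at 0 turns [prim f] near [x] into an integral with fixed lower endpoint [- N],
    so that time 0 and negative times need no separate treatment. *)
Lemma prim_continuous f : loc_int f -> continuous (prim f).
Proof.
move=> jf x; pose N := `|x| + 1.
have N0 : 0 < N by rewrite /N; have := normr_ge0 x; lra.
have Nx : - N < x < N.
  by have := ler_norm x; have := ler_norm (- x); rewrite normrN /N; lra.
pose D : set R := [set` `[- N, N]].
have jf0 : mu.-integrable D (EFin \o (f \_ `[0, +oo[)).
  rewrite [X in integrable _ _ X](_ : _ = (EFin \o f) \_ `[0, +oo[); last first.
    by apply/funext => y; rewrite /= restrict_EFin.
  apply/integrable_restrict => //.
    exact: mseg.
  apply: integrableS (jf N) => //.
    by apply: measurableI; [exact: mseg|exact: measurable_itv].
  by move=> y []; rewrite /D /= !in_itv/= andbT => /andP[_ ->] ->.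
have NN : - N < N by lra.
have := parameterized_integral_continuous (ltW NN) jf0.
move=> /(continuous_within_itvP _ NN)[+ _ _] => /(_ x).
rewrite in_itv/= Nx => /(_ isT) H.
have E y : - N <= y ->
    prim f y = parameterized_integral mu (- N) y (f \_ `[0, +oo[).
  move=> Ny; rewrite /prim /parameterized_integral -Rintegral_mkcondr.
  congr Rintegral; apply/seteqP; split => z /=; rewrite !in_itv/= ?andbT.
    by move=> /andP[z0 zy]; split => //; rewrite zy andbT; lra.
  by move=> [/andP[_ ->] ->].
rewrite /continuous_at E; last by case/andP: Nx => /ltW.
apply: cvg_trans H; apply: near_eq_cvg; near=> y; rewrite E//.
by apply/ltW; near: y; apply: lt_nbhsr; case/andP: Nx.
Unshelve. all: by end_near. Qed.

Lemma eq_prim_oc f g t : loc_int f -> loc_int g ->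
  (forall s, 0 < s <= t -> f s = g s) -> prim f t = prim g t.
Proof.
move=> jf jg fg; rewrite /prim -!Rintegral_itv_obnd_cbnd.
- by apply: eq_Rintegral => s; rewrite inE/= in_itv/= => /fg.
- by apply: integrableS (jg t) => //; exact: subset_itv_oc_cc.
- by apply: integrableS (jf t) => //; exact: subset_itv_oc_cc.
Qed.

Lemma prim_exp (l t : R) : l != 0 -> 0 <= t ->
  prim (fun s => expR (l * s)) t = (expR (l * t) - 1) / l.
Proof.
move=> l0; rewrite le_eqVlt => /predU1P[<-|t0].
  by rewrite prim0 mulr0 expR0 subrr mul0r.
have dF (x : R) : is_derive x 1 (fun s => expR (l * s) / l) (expR (l * x)).
  have H : is_derive x 1 (fun s : R => l * s) l.
    have := is_deriveZ l (@is_derive_id _ _ x 1).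
    by rewrite /GRing.scale/= mulr1.
  have := is_derive1_comp (is_derive_expR (l * x)) H.
  move=> /(is_deriveZ l^-1).
  by rewrite /GRing.scale/= [X in is_derive _ _ _ X](_ : _ = expR (l * x)) 1?mulrC ?mulfK//;
    under eq_fun do rewrite mulrC.
have cE : continuous (fun s => expR (l * s)).
  move=> x; apply: continuous_comp; last exact: continuous_expR.
  by apply: cvgM => //; exact: cvg_cst.
rewrite /prim /Rintegral (@continuous_FTC2 _ _ (fun s => expR (l * s) / l))//.
- by rewrite -EFinB/= mulr0 expR0 mulrBl.
- exact: continuous_subspaceT.
- have cF : continuous (fun s => expR (l * s) / l).
    by move=> x; apply: cvgM; [exact: cE|exact: cvg_cst].
  split.
  + by move=> x _; apply: ex_derive.
  + by apply: cvg_at_right_filter; exact: cF.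
  + by apply: cvg_at_left_filter; exact: cF.
- by move=> x _; rewrite derive1E; apply: derive_val.
Qed.
(** Uniqueness of Lebesgue measure reduces translation invariance to half-open intervals. *)
Lemma lebesgue_shift s (A : set R) : measurable A ->
  pushforward mu (+%R s : _ -> measurableTypeR R) A = mu A.
Proof.
have mphi : measurable_fun setT (+%R s : R -> measurableTypeR R).
  exact: measurable_funD.
move=> mA; apply/esym/lebesgue_measure_unique => [_ [[a b] _ <-]|//] /=.
rewrite /pushforward [X in _ = mu X](_ : _ = [set` `]a - s, b - s]]).
  by rewrite !lebesgue_measure_itv/= !lte_fin ltrD2r -!EFinD; case: ifP => // _; congr EFin; ring.
by apply/seteqP; split => x /=; rewrite !in_itv/= ltrBlDl lerBrDl.
Qed.

Lemma preimage_shift s t :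
  (+%R s : _ -> measurableTypeR R) @^-1` [set` `[s, s + t]] = [set` `[0, t]].
Proof.
by apply/seteqP; split => x /=; rewrite !in_itv/= lerDl lerD2l.
Qed.

(** As [f] is controlled on the half-line only, it is first cut to [[0, s + t]]; the change of
    variables is then an integral against the image measure under translation. *)
Lemma shift_integral f s t : 0 <= s -> 0 <= t -> loc_int f ->
  mu.-integrable `[0, t] (EFin \o (fun x => f (s + x))) /\
  (\int[mu]_(x in `[s, s + t]) f x = \int[mu]_(x in `[0, t]) f (s + x))%R.
Proof.
move=> s0 t0 jf; pose F := f \_ (`[0, s + t] : set R).
have jF : mu.-integrable setT (EFin \o F).
  by have /integrable_mkcond := jf (s + t); rewrite restrict_EFin; exact.
have mF : measurable_fun setT (EFin \o F) by exact: measurable_int jF.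
have mphi : measurable_fun setT (+%R s : R -> measurableTypeR R).
  exact: measurable_funD.
have FE x : s <= x <= s + t -> F x = f x.
  by move=> xst; rewrite /F patchE mem_set//= in_itv/=; lra.
have FE0 x : 0 <= x <= t -> F (s + x) = f (s + x) by move=> xt; apply: FE; lra.
have jFphi : mu.-integrable `[0, t] ((EFin \o F) \o +%R s).
  apply/integrableP; split.
    by apply: measurable_funTS; exact: measurableT_comp.
  have -> : (\int[mu]_(x in `[0%R, t]) `|((EFin \o F) \o +%R s) x| =
      \int[pushforward mu (+%R s : R -> measurableTypeR R)]_(y in `[s, (s + t)%R]) `|(F y)%:E|)%E.
    rewrite -(preimage_shift s); apply/esym; apply: ge0_integral_pushforward => //.
    by apply: measurable_funTS; exact: measurableT_comp.
  rewrite (eq_measure_integral mu); last by move=> A mA _; exact: lebesgue_shift.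
  have : mu.-integrable `[s, s + t] (EFin \o F) by exact: integrableS jF.
  by case/integrableP.
split.
  apply: eq_integrable jFphi => //.
  by move=> x; rewrite inE/= in_itv/= => xt; rewrite /= FE0.
transitivity (\int[mu]_(x in `[s, s + t]) F x).
  by apply: eq_Rintegral => x; rewrite inE/= in_itv/= => /FE.
transitivity (\int[mu]_(x in `[0, t]) F (s + x)); last first.
  by apply: eq_Rintegral => x; rewrite inE/= in_itv/= => /FE0.
rewrite /Rintegral; congr fine.
rewrite -[RHS]/(\int[mu]_(x in `[0%R, t]) ((EFin \o F) \o +%R s) x)%E -(preimage_shift s).
transitivity (\int[pushforward mu (+%R s : R -> measurableTypeR R)]_(x in `[s, (s + t)%R]) (EFin \o F) x)%E.
  by apply: eq_measure_integral => A mA _; exact/esym/lebesgue_shift.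
by apply: integral_pushforward => //; rewrite preimage_shift.
Qed.

Lemma loc_int_shift f s : 0 <= s -> loc_int f -> loc_int (fun x => f (s + x)).
Proof.
move=> s0 jf t; have [t0|t0] := ltP t 0; last by have [] := shift_integral s0 t0 jf.
by rewrite set_itv_ge ?bnd_simp -?ltNge//; exact: integrable_set0.
Qed.

Lemma prim_shift f s t : 0 <= s -> 0 <= t -> loc_int f ->
  prim (fun x => f (s + x)) t = prim f (s + t) - prim f s.
Proof.
move=> s0 t0 jf; have [_ E] := shift_integral s0 t0 jf.
rewrite prim_cat ?lerDl// /prim -E Rintegral_itv_obnd_cbnd//.
apply: integrableS (jf (s + t)) => //.
by move=> x /=; rewrite !in_itv/=; lra.
Qed.

Lemma loc_int_restrict f t : loc_int f ->
  mu.-integrable setT (EFin \o (f \_ (`[0, t] : set R))).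
Proof. by move=> /(_ t)/integrable_mkcond; rewrite restrict_EFin; exact. Qed.

Lemma EFin_Rintegral (D : set R) f : measurable D -> mu.-integrable D (EFin \o f) ->
  (\int[mu]_(x in D) (f x)%:E)%E = (\int[mu]_(x in D) f x)%:E.
Proof. by move=> mD jf; rewrite /Rintegral fineK//; exact: integrable_fin_num jf. Qed.

(** Integration by parts without derivatives: integrate f(x) g(y) over the triangle x <= y of the
    square on [[0, t]] in both orders (Fubini). Integrating in y first gives [h1], in x first
    [h2]. *)
Lemma prim_prod f g t : loc_int f -> loc_int g ->
  prim f t * prim g t = prim (fun s => f s * prim g s + prim f s * g s) t.
Proof.
move=> jf jg; have [t0|t0] := ltP t 0; first by rewrite !prim_neg// mulr0.
pose f0 := f \_ (`[0, t] : set R); pose g0 := g \_ (`[0, t] : set R).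
have jf0 : mu.-integrable setT (EFin \o f0) := loc_int_restrict t jf.
have jg0 : mu.-integrable setT (EFin \o g0) := loc_int_restrict t jg.
have mf0 : measurable_fun setT f0 by apply/measurable_EFinP; exact: measurable_int jf0.
have mg0 : measurable_fun setT g0 by apply/measurable_EFinP; exact: measurable_int jg0.
pose h (z : R * R) : R := if z.1 <= z.2 then f0 z.1 * g0 z.2 else 0.
have mh : measurable_fun setT h.
  apply: measurable_fun_ifT => //.
  + by apply: measurable_fun_ler; [exact: measurable_fst|exact: measurable_snd].
  + by apply: measurable_funM; exact: measurableT_comp.
have jh : (mu \x mu)%E.-integrable setT (EFin \o h).
  apply/integrable12ltyP; first exact/measurable_EFinP.
  have /integrableP[_ ig0] := jg0.
  have ng0 : (0 <= \int[mu]_y `|(g0 y)%:E|)%E by exact: integral_ge0.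
  set K := (\int[mu]_y `|(g0 y)%:E|)%E in ig0 ng0.
  have KE : K = (fine K)%:E by rewrite fineK// ge0_fin_numE.
  apply: (@le_lt_trans _ _ (\int[mu]_x ((fine K)%:E * `|(f0 x)%:E|))%E); last first.
    rewrite ge0_integralZl//.
    - have /integrableP[_ if0] := jf0.
      by rewrite lte_mul_pinfty// lee_fin fine_ge0.
    - by apply/measurable_EFinP; exact: measurableT_comp.
    - by rewrite lee_fin fine_ge0.
  apply: ge0_le_integral => //.
  - by move=> x _; exact: integral_ge0.
  - apply: (measurable_fun_fubini_tonelli_F (m2 := mu) (fun z => `|(EFin \o h) z|%E)) => //=.
    by apply/measurable_EFinP; exact: measurableT_comp.
  - by apply/measurable_EFinP; apply: measurable_funM => //; exact: measurableT_comp.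
  - move=> x _; rewrite -KE muleC -ge0_integralZl//; last first.
      by apply/measurable_EFinP; exact: measurableT_comp.
    apply: ge0_le_integral => //.
    + apply/measurable_EFinP; apply: measurableT_comp => //.
      exact: measurableT_comp (pair1_measurable x).
    + by apply/measurable_EFinP; apply: measurable_funM => //; exact: measurableT_comp.
    + move=> y _; rewrite /h/= -EFinM lee_fin; case: ifP => _; first by rewrite normrM.
      by rewrite normr0.
have h1 x : (\int[mu]_y (EFin \o h) (x, y) = (f0 x * (prim g t - prim g x))%:E)%E.
  have [xt|xt] := boolP (0 <= x <= t); last first.
    rewrite {1}/f0 patchE memNset ?mul0r; last by rewrite /= in_itv/=; exact/negP.
    apply: integral0_eq => y _; rewrite /h/= {1}/f0 patchE memNset ?mul0r ?if_same//.
    by rewrite /= in_itv/=; exact/negP.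
  rewrite prim_cat//; [|by case/andP: xt..].
  have jgx : mu.-integrable `[x, t] (EFin \o g).
    by apply: integrableS (jg t) => // y /=; rewrite !in_itv/=; move: xt; lra.
  rewrite Rintegral_itv_obnd_cbnd; last first.
    by apply: integrableS jgx => // y /=; rewrite !in_itv/=; lra.
  rewrite EFinM -EFin_Rintegral// [X in (_ * X)%E]integral_mkcond -integralZl//; last first.
    by move: jgx => /integrable_mkcond; exact.
  apply: eq_integral => y _; rewrite /h/= restrict_EFin/= -EFinM; congr EFin.
  rewrite [g0 y]patchE [in RHS]patchE !mem_setE !in_itv/=.
  case/andP: xt => x0 xt; case: (leP x y) => xy /=; last by rewrite mulr0.
  by rewrite (le_trans x0 xy).
have h2 y : (\int[mu]_x (EFin \o h) (x, y) = (g0 y * prim f y)%:E)%E.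
  have [yt|yt] := boolP (0 <= y <= t); last first.
    rewrite {1}/g0 patchE memNset ?mul0r; last by rewrite /= in_itv/=; exact/negP.
    apply: integral0_eq => x _; rewrite /h/= {1}/g0 patchE memNset ?mulr0 ?if_same//.
    by rewrite /= in_itv/=; exact/negP.
  rewrite EFinM -EFin_Rintegral//.
  rewrite [X in (_ * X)%E]integral_mkcond -integralZl//; last by move: (jf y) => /integrable_mkcond; exact.
  apply: eq_integral => x _; rewrite /h/= restrict_EFin/= -EFinM; congr EFin.
  rewrite [f0 x]patchE [in RHS]patchE !mem_setE !in_itv/= mulrC.
  case/andP: yt => y0 yt; case: (leP x y) => xy /=; last by rewrite andbF mulr0.
  by rewrite (le_trans xy yt).
have mk (k l : R -> R) : loc_int (fun x => k x * l x) ->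
    (\int[mu]_x ((k \_ (`[0, t] : set R)) x * l x)%:E = (prim (fun x => k x * l x) t)%:E)%E.
  move=> jkl; rewrite -EFin_Rintegral//.
  rewrite [RHS]integral_mkcond; apply: eq_integral => x _.
  by rewrite restrict_EFin/= !patchE; case: ifP => //; rewrite mul0r.
have := Fubini jh.
under eq_integral do rewrite h1.
under [X in _ = X -> _]eq_integral do rewrite h2.
have cpg : lbm (prim g) by exact/continuous_lbm/prim_continuous.
have cpf : lbm (prim f) by exact/continuous_lbm/prim_continuous.
have jfg : loc_int (fun x => f x * prim g x).
  by under eq_fun do rewrite mulrC; exact: loc_intM.
have jgf : loc_int (fun x => g x * prim f x).
  by under eq_fun do rewrite mulrC; exact: loc_intM.
have E : (fun x => f x * (prim g t - prim g x)) =
    (fun x => prim g t * f x - f x * prim g x) by apply/funext => x; ring.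
have jE : loc_int (fun x => f x * (prim g t - prim g x)).
  by rewrite E; apply: loc_intD; [exact: loc_intZ|exact: loc_intN].
rewrite mk// mk// => -[]; rewrite E primB ?primZ//; last exact: loc_intZ.
rewrite primD//; last by under eq_fun do rewrite mulrC.
under [X in _ = _ + X]eq_prim do rewrite mulrC.
by move=> <-; ring.
Qed.

End Primitive.

(** * Primitives of matrix-valued functions, entry by entry *)

Section MatrixPrimitive.
Variable R : realType.
Notation mu := (@lebesgue_measure R).

Definition mlbm k l (A : R -> 'M[R]_(k, l)) : Prop :=
  forall i j, lbm (fun s => A s i j).

Definition mloc k l (F : R -> 'M[R]_(k, l)) : Prop :=
  forall i j, loc_int (fun s => F s i j).

Definition mprim k l (F : R -> 'M[R]_(k, l)) (t : R) : 'M[R]_(k, l) :=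
  \matrix_(i, j) prim (fun s => F s i j) t.

Definition mcont k l (F : R -> 'M[R]_(k, l)) : Prop :=
  forall i j, continuous (fun s => F s i j).

Lemma mx_norm_lb k l (A : 'M[R]_(k, l)) i j : `|A i j| <= `|A|.
Proof.
rewrite [leRHS]/Num.Def.normr /= mx_normrE; apply/bigmax_geP; right => /=.
by exists (i, j).
Qed.

Lemma mx_norm_le k l (A : 'M[R]_(k, l)) c : 0 <= c ->
  (forall i j, `|A i j| <= c) -> `|A| <= c.
Proof.
move=> c0 Ac; rewrite [leLHS]/Num.Def.normr /= mx_normrE.
by apply: bigmax_le => // -[i j] _; exact: Ac.
Qed.

Lemma mx_normM k l q (A : 'M[R]_(k, l)) (B : 'M[R]_(l, q)) :
  `|A *m B| <= l%:R * `|A| * `|B|.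
Proof.
apply: mx_norm_le => [|i j]; first by rewrite !mulr_ge0.
rewrite mxE (le_trans (ler_norm_sum _ _ _))//.
rewrite -mulrA mulr_natl -[l in _ *+ l]card_ord -sumr_const ler_sum// => h _.
by rewrite normrM ler_pM// mx_norm_lb.
Qed.

Lemma mx_norm1 d : `|1%:M : 'M[R]_d| <= 1.
Proof.
apply: mx_norm_le => // i j; rewrite mxE; case: (i == j) => /=; by rewrite ?normr1 ?normr0.
Qed.

Lemma mcont_mlbm k l (F : R -> 'M[R]_(k, l)) : mcont F -> mlbm F.
Proof. by move=> cF i j; exact/continuous_lbm/cF. Qed.

Lemma mlbm_mloc k l (F : R -> 'M[R]_(k, l)) : mlbm F -> mloc F.
Proof. by move=> bF i j; exact/lbm_loc_int/bF. Qed.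

Lemma mlbm_cst k l (M : 'M[R]_(k, l)) : mlbm (fun=> M).
Proof. by move=> i j; exact: lbm_cst. Qed.

Lemma mlbm_tr k l (F : R -> 'M[R]_(k, l)) : mlbm F -> mlbm (fun s => (F s)^T).
Proof. by move=> bF i j; under eq_fun do rewrite mxE; exact: bF. Qed.

Lemma mlbmM k l q (A : R -> 'M[R]_(k, l)) (B : R -> 'M[R]_(l, q)) :
  mlbm A -> mlbm B -> mlbm (fun s => A s *m B s).
Proof.
move=> bA bB i j; under eq_fun do rewrite mxE.
by apply: lbm_sum => h; exact: lbmM.
Qed.

Lemma mlbmD k l (A B : R -> 'M[R]_(k, l)) :
  mlbm A -> mlbm B -> mlbm (fun s => A s + B s).
Proof. by move=> bA bB i j; under eq_fun do rewrite mxE; exact: lbmD. Qed.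

Lemma mlbmN k l (A : R -> 'M[R]_(k, l)) : mlbm A -> mlbm (fun s => - A s).
Proof.
move=> bA i j; under eq_fun do rewrite mxE -mulN1r.
by apply: lbmM => //; exact: lbm_cst.
Qed.

Lemma mlocM k l q (A : R -> 'M[R]_(k, l)) (B : R -> 'M[R]_(l, q)) :
  mlbm A -> mloc B -> mloc (fun s => A s *m B s).
Proof.
move=> bA bB i j; under eq_fun do rewrite mxE.
by apply: loc_int_sum => h; exact: loc_intM.
Qed.

Lemma mlocMr k l q (A : R -> 'M[R]_(k, l)) (B : R -> 'M[R]_(l, q)) :
  mloc A -> mlbm B -> mloc (fun s => A s *m B s).
Proof.
move=> bA bB i j; under eq_fun do rewrite mxE.
by apply: loc_int_sum => h; under eq_fun do rewrite mulrC; exact: loc_intM.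
Qed.

Lemma mlocD k l (A B : R -> 'M[R]_(k, l)) :
  mloc A -> mloc B -> mloc (fun s => A s + B s).
Proof. by move=> bA bB i j; under eq_fun do rewrite mxE; exact: loc_intD. Qed.

Lemma mlocN k l (A : R -> 'M[R]_(k, l)) : mloc A -> mloc (fun s => - A s).
Proof. by move=> bA i j; under eq_fun do rewrite mxE; exact: loc_intN. Qed.

Lemma mloc_shift k l (A : R -> 'M[R]_(k, l)) s : 0 <= s ->
  mloc A -> mloc (fun x => A (s + x)).
Proof. by move=> s0 jA i j; exact: (loc_int_shift s0 (jA i j)). Qed.

Lemma mprim_neg k l (A : R -> 'M[R]_(k, l)) t : t < 0 -> mprim A t = 0.
Proof. by move=> t0; apply/matrixP => i j; rewrite !mxE prim_neg. Qed.

Lemma mprim0 k l (A : R -> 'M[R]_(k, l)) : mprim A 0 = 0.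
Proof. by apply/matrixP => i j; rewrite !mxE prim0. Qed.

Lemma mprim_cst0 k l t : mprim (fun=> 0 : 'M[R]_(k, l)) t = 0.
Proof.
apply/matrixP => i j; rewrite !mxE -[RHS](prim_cst0 t).
by congr prim; apply/funext => s; rewrite mxE.
Qed.

Lemma mprimD k l (A B : R -> 'M[R]_(k, l)) t : mloc A -> mloc B ->
  mprim (fun s => A s + B s) t = mprim A t + mprim B t.
Proof.
move=> jA jB; apply/matrixP => i j; rewrite !mxE -primD//.
by congr prim; apply/funext => s; rewrite mxE.
Qed.

Lemma mprimN k l (A : R -> 'M[R]_(k, l)) t : mloc A ->
  mprim (fun s => - A s) t = - mprim A t.
Proof.
move=> jA; apply/matrixP => i j; rewrite !mxE -primN//.
by congr prim; apply/funext => s; rewrite mxE.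
Qed.

Lemma mprimB k l (A B : R -> 'M[R]_(k, l)) t : mloc A -> mloc B ->
  mprim (fun s => A s - B s) t = mprim A t - mprim B t.
Proof. by move=> jA jB; rewrite mprimD ?mprimN//; exact: mlocN. Qed.

Lemma mprim_mull k l q (L : 'M[R]_(k, l)) (A : R -> 'M[R]_(l, q)) t : mloc A ->
  mprim (fun s => L *m A s) t = L *m mprim A t.
Proof.
move=> jA; apply/matrixP => i j; rewrite !mxE.
under [RHS]eq_bigr do rewrite mxE -primZ//.
rewrite -prim_sum => [|h]; last exact: loc_intZ.
by congr prim; apply/funext => s; rewrite mxE.
Qed.

Lemma mprim_mulr k l q (A : R -> 'M[R]_(k, l)) (L : 'M[R]_(l, q)) t : mloc A ->
  mprim (fun s => A s *m L) t = mprim A t *m L.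
Proof.
move=> jA; apply/matrixP => i j; rewrite !mxE.
under [RHS]eq_bigr do rewrite mxE mulrC -primZ//.
rewrite -prim_sum => [|h]; last exact: loc_intZ.
congr prim; apply/funext => s; rewrite mxE.
by apply: eq_bigr => h _; rewrite mulrC.
Qed.

Lemma mprim_tr k l (A : R -> 'M[R]_(k, l)) t :
  mprim (fun s => (A s)^T) t = (mprim A t)^T.
Proof.
apply/matrixP => i j; rewrite !mxE.
by congr prim; apply/funext => s; rewrite mxE.
Qed.

Lemma eq_mprim k l (A B : R -> 'M[R]_(k, l)) t :
  (forall s, 0 <= s <= t -> A s = B s) -> mprim A t = mprim B t.
Proof.
move=> AB; apply/matrixP => i j; rewrite !mxE; apply: eq_prim => s st.
by rewrite AB.
Qed.

Lemma eq_mprim_oc k l (A B : R -> 'M[R]_(k, l)) t : mloc A -> mloc B ->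
  (forall s, 0 < s <= t -> A s = B s) -> mprim A t = mprim B t.
Proof.
move=> jA jB AB; apply/matrixP => i j; rewrite !mxE; apply: eq_prim_oc => // s st.
by rewrite AB.
Qed.

Lemma mprim_shift k l (A : R -> 'M[R]_(k, l)) s t : 0 <= s -> 0 <= t -> mloc A ->
  mprim (fun x => A (s + x)) t = mprim A (s + t) - mprim A s.
Proof.
by move=> s0 t0 jA; apply/matrixP => i j; rewrite !mxE (prim_shift s0 t0 (jA i j)).
Qed.

Lemma mprim_cont k l (A : R -> 'M[R]_(k, l)) : mloc A -> mcont (mprim A).
Proof.
move=> jA i j; under eq_fun do rewrite mxE.
exact: prim_continuous.
Qed.

Lemma mcontD k l (A B : R -> 'M[R]_(k, l)) :
  mcont A -> mcont B -> mcont (fun s => A s + B s).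
Proof.
by move=> cA cB i j s; under eq_fun do rewrite mxE; apply: cvgD; [exact: cA|exact: cB].
Qed.

Lemma mcont_cst k l (M : 'M[R]_(k, l)) : mcont (fun=> M).
Proof. by move=> i j s; exact: cvg_cst. Qed.

Lemma mcontM k l q (A : R -> 'M[R]_(k, l)) (B : R -> 'M[R]_(l, q)) :
  mcont A -> mcont B -> mcont (fun s => A s *m B s).
Proof.
move=> cA cB i j s; under eq_fun do rewrite mxE.
by apply: cvg_big => [|h _]; [exact: add_continuous|apply: cvgM; [exact: cA|exact: cB]].
Qed.

Lemma mcont_tr k l (A : R -> 'M[R]_(k, l)) : mcont A -> mcont (fun s => (A s)^T).
Proof. by move=> cA i j; under eq_fun do rewrite mxE; exact: cA. Qed.

Lemma mcont_shift k l (A : R -> 'M[R]_(k, l)) s : mcont A -> mcont (fun x => A (s + x)).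
Proof.
move=> cA i j x; apply: (@continuous_comp _ _ _ (fun x => s + x) (fun x => A x i j)).
  by apply: cvgD; [exact: cvg_cst|exact: cvg_id].
exact: cA.
Qed.

Lemma mcont_continuous k l (A : R -> 'M[R]_(k, l)) : mcont A -> continuous A.
Proof.
move=> cA s; apply/cvgrPdist_le => e e0; near=> x.
apply: mx_norm_le => [|i j]; first exact: ltW.
move: i j; near: x; apply: filter_forall => i; apply: filter_forall => j.
have /cvgrPdist_le/(_ _ e0) := cA i j s.
by apply: filterS => x; rewrite !mxE.
Unshelve. all: by end_near. Qed.

(** The initial values [F0] and [G0] are kept so that the product rule applies directly to functions
    given by an integral equation. *)
Lemma mprim_prod k l q (F : R -> 'M[R]_(k, l)) (G : R -> 'M[R]_(l, q)) F0 G0 t :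
  mloc F -> mloc G ->
  (F0 + mprim F t) *m (G0 + mprim G t) =
  F0 *m G0 + mprim (fun s => F s *m (G0 + mprim G s) + (F0 + mprim F s) *m G s) t.
Proof.
move=> jF jG.
have bF : mlbm (mprim F) by exact/mcont_mlbm/mprim_cont.
have bG : mlbm (mprim G) by exact/mcont_mlbm/mprim_cont.
have -> : (fun s => F s *m (G0 + mprim G s) + (F0 + mprim F s) *m G s) =
    (fun s => (F s *m G0 + F0 *m G s) + (F s *m mprim G s + mprim F s *m G s)).
  by apply/funext => s; rewrite mulmxDr mulmxDl addrACA.
have c0 := @mlbm_cst.
rewrite mprimD; last 2 first.
- by apply: mlocD; [exact: mlocMr|exact: mlocM].
- by apply: mlocD; [exact: mlocMr|exact: mlocM].
rewrite mprimD; [|exact: mlocMr|exact: mlocM].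
rewrite mprim_mulr// mprim_mull// mulmxDl !mulmxDr -!addrA; congr (_ + _).
rewrite addrCA; congr (_ + (_ + _)).
apply/matrixP => i j; rewrite !mxE.
under eq_bigr do rewrite !mxE prim_prod//.
rewrite -prim_sum => [|h]; last first.
  apply: loc_intD; last by apply: loc_intM => //; exact/continuous_lbm/prim_continuous.
  by under eq_fun do rewrite mulrC; apply: loc_intM => //; exact/continuous_lbm/prim_continuous.
congr prim; apply/funext => s; rewrite !mxE -big_split; apply: eq_bigr => h _.
by rewrite !mxE.
Qed.

Lemma oint_prim (f : R -> R) s t : 0 <= s -> 0 <= t -> loc_int f ->
  oint s t f = prim f t - prim f s.
Proof.
move=> s0 t0 jf; rewrite /oint; have [st|ts] := leP s t.
  rewrite prim_cat// Rintegral_itv_obnd_cbnd//.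
  by apply: integrableS (jf t) => // x /=; rewrite !in_itv/=; lra.
rewrite -opprB prim_cat ?(ltW ts)// Rintegral_itv_obnd_cbnd//.
by apply: integrableS (jf s) => // x /=; rewrite !in_itv/=; lra.
Qed.

Lemma mx_oint_mprim k l (F : R -> 'M[R]_(k, l)) s t : 0 <= s -> 0 <= t -> mloc F ->
  mx_oint s t F = mprim F t - mprim F s.
Proof. by move=> s0 t0 jF; apply/matrixP => i j; rewrite !mxE oint_prim. Qed.

Lemma mx_oint0 k l (F : R -> 'M[R]_(k, l)) t : 0 <= t ->
  mx_oint 0 t F = mprim F t.
Proof. by move=> t0; apply/matrixP => i j; rewrite !mxE /oint t0. Qed.

End MatrixPrimitive.

(** * Flows *)

Section Flow.
Variable R : realType.
Notation mu := (@lebesgue_measure R).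

Definition bsig k l c (A : R -> 'M[R]_(k, l)) : Prop :=
  (forall i j, measurable_fun setT (fun s => A s i j)) /\ forall s, `|A s| <= c.

Lemma shift_shift X s t (a : R -> X) :
  Defs.shift t (Defs.shift s a) = Defs.shift (s + t) a.
Proof. by apply/funext => q; rewrite /Defs.shift addrA. Qed.

Lemma bsig_ge0 k l c (A : R -> 'M[R]_(k, l)) : bsig c A -> 0 <= c.
Proof. by move=> [_ /(_ 0)]; exact: le_trans. Qed.

Lemma bsig_mlbm k l c (A : R -> 'M[R]_(k, l)) : bsig c A -> mlbm A.
Proof.
move=> [mA bA] i j; split=> // t; exists c => s _.
by rewrite (le_trans (mx_norm_lb _ _ _)).
Qed.

Lemma bsig_tr k l c (A : R -> 'M[R]_(k, l)) : bsig c A -> bsig c (fun s => (A s)^T).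
Proof.
move=> bA; have c0 := bsig_ge0 bA; case: bA => mA bA; split.
  by move=> i j; under eq_fun do rewrite mxE; exact: mA.
move=> s; apply: mx_norm_le => // i j; rewrite mxE.
by rewrite (le_trans (mx_norm_lb _ _ _)).
Qed.

Lemma bsigN k l c (A : R -> 'M[R]_(k, l)) : bsig c A -> bsig c (fun s => - A s).
Proof.
move=> bA; have c0 := bsig_ge0 bA; case: bA => mA bA; split.
  move=> i j; under eq_fun do rewrite mxE.
  exact: measurableT_comp.
by move=> s; rewrite normrN.
Qed.

Lemma bsig_shift k l c (A : R -> 'M[R]_(k, l)) s : bsig c A -> bsig c (Defs.shift s A).
Proof.
move=> [mA bA]; split=> [i j|x]; last exact: bA.
apply: (@measurableT_comp _ _ _ _ _ _ (fun x => A x i j) _ (fun x => s + x)) => //.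
exact: measurable_funD.
Qed.

(* In the norm [sup_t exp(- rate d c * t) |Z t|] the Picard operator contracts
   by 1/2. *)
Definition rate d c : R := 2 * (d%:R * c) + 1.

Lemma rate_gt0 d c : 0 <= c -> 0 < rate d c.
Proof. by move=> c0; rewrite /rate ltr_wpDl// !mulr_ge0. Qed.

Lemma mprim_exp_bound d l c (A : R -> 'M[R]_d) (Z : R -> 'M[R]_(d, l)) m t :
  bsig c A -> mloc (fun s => A s *m Z s) -> 0 <= m -> 0 <= t ->
  (forall s, 0 <= s <= t -> `|Z s| <= m * expR (rate d c * s)) ->
  `|mprim (fun s => A s *m Z s) t| <= m / 2 * expR (rate d c * t).
Proof.
move=> bA jAZ m0 t0 bZ; have c0 := bsig_ge0 bA; have l0 := rate_gt0 d c0.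
have jE : loc_int (fun s => expR (rate d c * s)).
  apply/lbm_loc_int/continuous_lbm => x.
  apply: continuous_comp; last exact: continuous_expR.
  by apply: cvgM => //; exact: cvg_cst.
apply: mx_norm_le => [|i j]; first by rewrite !mulr_ge0 ?expR_ge0.
rewrite mxE (le_trans (prim_norm _ (jAZ i j)))//.
apply: (@le_trans _ _ (prim (fun s => (d%:R * c * m) * expR (rate d c * s)) t)).
  apply: prim_le; [exact/loc_int_norm/jAZ|exact: loc_intZ|] => s st.
  rewrite (le_trans (mx_norm_lb _ _ _))// (le_trans (mx_normM _ _))//.
  rewrite -(mulrA (d%:R * c)) -[leRHS]mulrA -[leLHS]mulrA ler_wpM2l//.
  by rewrite ler_pM// ?bZ//; exact: bA.2.
(* Integration divides by [rate d c], which exceeds twice [d c]: hence the factor 1/2. The extra 1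
   in the rate keeps it positive when [d c] is 0. *)
rewrite primZ// prim_exp ?gt_eqF//.
have dcm : 0 <= d%:R * c * m by rewrite !mulr_ge0.
rewrite mulrA ler_pdivrMr//.
have e1 : 0 < expR (rate d c * t) by exact: expR_gt0.
have : 0 <= m * expR (rate d c * t) by rewrite mulr_ge0// ltW.
rewrite /rate in e1 *; set E := expR _ in e1 *; set k := d%:R * c in dcm *.
have -> : m / 2 * E * (2 * k + 1) = k * m * E + m * E / 2 by field.
rewrite mulrBr mulr1 => mE; lra.
Qed.

(** Adding or subtracting [2 * C / 2 ^+ n] makes the sequence monotone, decreasing or increasing
    respectively; the limit is squeezed between the two, which also gives the error bound. *)
Lemma geometric_cvg (x : nat -> R) C :
  (forall n, `|x n.+1 - x n| <= C / 2 ^+ n) ->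
  exists l, x @ \oo --> l /\ forall n, `|l - x n| <= 2 * C / 2 ^+ n.
Proof.
move=> xC.
have p2 n : (2 ^+ n.+1 : R) = 2 * 2 ^+ n by rewrite exprS.
have p0 n : (0 : R) < 2 ^+ n by rewrite exprn_gt0.
have E n : 2 * C / 2 ^+ n.+1 = C / 2 ^+ n by rewrite p2; field; rewrite gt_eqF.
have E2 n : 2 * C / 2 ^+ n = C / 2 ^+ n + C / 2 ^+ n by rewrite -mulrA; lra.
pose y n := x n + 2 * C / 2 ^+ n; pose z n := x n - 2 * C / 2 ^+ n.
have dy : nonincreasing_seq y.
  apply/nonincreasing_seqP => n; rewrite /y E E2.
  by have := xC n; rewrite ler_norml; lra.
have iz : nondecreasing_seq z.
  apply/nondecreasing_seqP => n; rewrite /z E E2.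
  by have := xC n; rewrite ler_norml; lra.
have C0 : 0 <= C by have := xC 0%N; rewrite expr0 divr1; exact: le_trans.
have zy n : z n <= y n.
  have : 0 <= 2 * C / 2 ^+ n by rewrite !mulr_ge0// invr_ge0 ltW.
  rewrite /z /y; lra.
have z0 n : z 0%N <= z n by exact: iz.
have cy : cvgn y.
  apply: nonincreasing_is_cvgn => //; exists (z 0%N) => _ [n _ <-].
  exact: le_trans (z0 n) (zy n).
have l0 : (fun n => 2 * C / 2 ^+ n) @ \oo --> (0 : R).
  rewrite -(mulr0 (2 * C)); apply: cvgM; first exact: cvg_cst.
  under eq_fun do rewrite -exprVn.
  by apply: cvg_expr; rewrite ger0_norm ?invr_ge0// invf_lt1// ltr1n.
have cx : x @ \oo --> limn y.
  have -> : x = (fun n => y n - 2 * C / 2 ^+ n) by apply/funext => n; rewrite /y addrK.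
  by rewrite -[limn y]subr0; apply: cvgB.
have cz : z @ \oo --> limn y by rewrite -[limn y]subr0; apply: cvgB.
exists (limn y); split=> // n.
have ly : limn y <= y n by exact: nonincreasing_cvgn_ge.
have lz : z n <= limn y.
  have := nondecreasing_cvgn_le iz (cvgP _ cz) n.
  by rewrite (cvg_lim _ cz).
by rewrite ler_norml; move: ly lz; rewrite /y /z; lra.
Qed.

Lemma mcont_expR (a : R) : continuous (fun s => expR (a * s)).
Proof.
move=> x; apply: continuous_comp; last exact: continuous_expR.
by apply: cvgM => //; exact: cvg_cst.
Qed.

Definition is_sol d (A X : R -> 'M[R]_d) : Prop :=
  mcont X /\ forall t, X t = 1%:M + mprim (fun s => A s *m X s) t.

Lemma picard d c (A : R -> 'M[R]_d) : bsig c A ->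
  exists X, is_sol A X /\ forall t, 0 <= t -> `|X t| <= 2 * expR (rate d c * t).
Proof.
move=> bA; have c0 := bsig_ge0 bA; have r0 := rate_gt0 d c0.
have mA := bsig_mlbm bA.
pose fix X n : R -> 'M[R]_d := if n is n.+1 then
  fun t => 1%:M + mprim (fun s => A s *m X n s) t else fun=> 0.
have cX n : mcont (X n).
  elim: n => [|n IH]; first exact: mcont_cst.
  apply: mcontD; first exact: mcont_cst.
  by apply/mprim_cont/mlocM => //; exact/mlbm_mloc/mcont_mlbm.
have jX n : mloc (fun s => A s *m X n s).
  by apply: mlocM => //; exact/mlbm_mloc/mcont_mlbm.
have dX n t : 0 <= t -> `|X n.+1 t - X n t| <= 1 / 2 ^+ n * expR (rate d c * t).
  elim: n t => [|n IH] t t0.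
    rewrite expr0 divr1 mul1r /= subr0.
    have -> : mprim (fun s => A s *m 0) t = 0 :> 'M[R]_d.
      by rewrite -[RHS](mprim_cst0 _ _ t); congr mprim; apply/funext => s; rewrite mulmx0.
    rewrite addr0 (le_trans (mx_norm1 _ d))// -expR0 ler_expR.
    by rewrite mulr_ge0// ltW.
  rewrite [X n.+2]/= [X n.+1 in X in _ - X]/= opprD addrACA subrr add0r -mprimB; [|exact: (jX n.+1)|exact: jX].
  rewrite (_ : (fun s => _) = (fun s => A s *m (X n.+1 s - X n s))); last first.
    by apply/funext => s; rewrite mulmxBr.
  rewrite exprSr invfM mulrA; apply: mprim_exp_bound => //.
  - apply: mlocM => //; apply: mlocD; first exact/mlbm_mloc/mcont_mlbm.
    by apply/mlocN/mlbm_mloc/mcont_mlbm.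
  - by move=> s /andP[s0 _]; exact: IH.
have Xneg n t : t < 0 -> X n.+1 t = 1%:M by move=> t0; rewrite /= mprim_neg ?addr0.
have ex t i j : exists l, (fun n => X n t i j) @ \oo --> l /\
    forall n, 0 <= t -> `|l - X n t i j| <= 2 * expR (rate d c * t) / 2 ^+ n.
  have [t0|t0] := leP 0 t.
    have [|l [xl lP]] := @geometric_cvg (fun n => X n t i j) (expR (rate d c * t)).
      move=> n; have := dX n t t0; rewrite mul1r mulrC => H.
      by apply: le_trans H; rewrite (le_trans _ (mx_norm_lb _ i j))// !mxE.
    by exists l; split.
  exists ((1%:M : 'M[R]_d) i j); split => //.
  rewrite -(cvg_shiftn 1); under eq_fun do rewrite addn1 Xneg//.
  exact: cvg_cst.
have [Y YP] : exists Y : R -> 'M[R]_d, forall t i j,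
    (fun n => X n t i j) @ \oo --> Y t i j /\
    forall n, 0 <= t -> `|Y t i j - X n t i j| <= 2 * expR (rate d c * t) / 2 ^+ n.
  exists (fun t => \matrix_(i, j) projT1 (cid (ex t i j))) => t i j.
  by rewrite mxE; case: cid.
have YX n t : 0 <= t -> `|Y t - X n t| <= 2 / 2 ^+ n * expR (rate d c * t).
  move=> t0; apply: mx_norm_le => [|i j].
    by rewrite mulr_ge0 ?expR_ge0// divr_ge0// exprn_ge0.
  by rewrite !mxE mulrAC; exact: (YP t i j).2.
have Y2 t : 0 <= t -> `|Y t| <= 2 * expR (rate d c * t).
  by move=> t0; have := YX 0%N t t0; rewrite expr0 divr1 /= subr0.
have bY : mlbm Y.
  move=> i j; split.
    apply: (@measurable_fun_cvg _ _ _ _ (fun n t => X n t i j)).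
      by move=> n; exact: (continuous_measurable_fun (cX n i j)).
    by move=> t _; exact: (YP t i j).1.
  move=> t; exists (2 * expR (rate d c * t)) => s /andP[s0 st].
  rewrite (le_trans (mx_norm_lb _ _ _))// (le_trans (Y2 s s0))// ler_wpM2l//.
  by rewrite ler_expR ler_wpM2l// ltW.
have jY : mloc (fun s => A s *m Y s) by apply: mlocM => //; exact: mlbm_mloc.
have YE t : 0 <= t -> Y t = 1%:M + mprim (fun s => A s *m Y s) t.
  move=> t0; apply/eqP; rewrite -subr_eq0 -normr_le0.
  apply/ler_addgt0Pl => e e0; rewrite addr0.
  pose C := 2 * expR (rate d c * t).
  have key n : `|Y t - (1%:M + mprim (fun s => A s *m Y s) t)| <= C / 2 ^+ n.
    have -> : Y t - (1%:M + mprim (fun s => A s *m Y s) t) =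
       (Y t - X n.+1 t) - mprim (fun s => A s *m (Y s - X n s)) t.
      under [in RHS]eq_fun do rewrite mulmxBr.
      by rewrite mprimB//= !opprD opprK -!addrA [- mprim _ _ + mprim _ _]addrC addKr.
    rewrite (le_trans (ler_normB _ _))//.
    have -> : C / 2 ^+ n = 2 / 2 ^+ n.+1 * expR (rate d c * t) +
        (2 / 2 ^+ n) / 2 * expR (rate d c * t).
      by rewrite /C exprS; field; rewrite expf_neq0.
    apply: lerD; first exact: YX.
    apply: mprim_exp_bound => //.
    - apply: mlocM => //; apply: mlocD; first exact/mlbm_mloc.
      by apply/mlocN/mlbm_mloc/mcont_mlbm.
    - by move=> s /andP[s0 _]; exact: YX.
  have : (fun n => C / 2 ^+ n) @ \oo --> (0 : R).
    rewrite -(mulr0 C); apply: cvgM; first exact: cvg_cst.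
    under eq_fun do rewrite -exprVn.
    by apply: cvg_expr; rewrite ger0_norm ?invr_ge0// invf_lt1// ltr1n.
  move=> /cvgrPdist_le/(_ _ e0)[N _ /(_ N (leqnn N))].
  rewrite sub0r normrN => H; rewrite (le_trans (key N))//.
  by rewrite (le_trans (ler_norm _)).
(* The pointwise limit [Y] is only known to be measurable and locally bounded. The right-hand side
   of its equation is continuous, and equals [Y] at nonnegative times. *)
exists (fun t => 1%:M + mprim (fun s => A s *m Y s) t); split.
  split; first by apply: mcontD; [exact: mcont_cst|exact: mprim_cont].
  move=> t; congr (_ + _); apply: eq_mprim => s /andP[s0 _].
  by rewrite -YE.
by move=> t t0; rewrite -YE// Y2.
Qed.

(** The contraction bounds the weighted norm of [Z] by half of itself; iterating, by m / 2^n for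
    every n. Continuity of [Z] is not asked for, so that cut-off functions qualify. *)
Lemma sol_unique_hom d l c (A : R -> 'M[R]_d) (Z : R -> 'M[R]_(d, l)) T :
  bsig c A -> mlbm Z ->
  (forall t, 0 <= t <= T -> Z t = mprim (fun s => A s *m Z s) t) ->
  forall t, 0 <= t <= T -> Z t = 0.
Proof.
move=> bA bZ ZE; have c0 := bsig_ge0 bA; have r0 := rate_gt0 d c0.
have jAZ : mloc (fun s => A s *m Z s).
  by apply: mlocM; [exact: bsig_mlbm bA|exact: mlbm_mloc].
have [m [m0 mP]] : exists m, 0 <= m /\ forall t, 0 <= t <= T -> `|Z t| <= m.
  have B i j : exists e, forall s, 0 <= s <= T -> `|Z s i j| <= e by exact: (bZ i j).2.
  pose e i j := projT1 (cid (B i j)).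
  exists (\sum_i \sum_j `|e i j|); split.
    by apply: sumr_ge0 => i _; apply: sumr_ge0.
  move=> t tT; apply: mx_norm_le => [|i j].
    by apply: sumr_ge0 => i _; apply: sumr_ge0.
  rewrite (bigD1 i)//= (bigD1 j)//= -addrA ler_wpDr//.
    by rewrite addr_ge0// ?sumr_ge0// => i' _; rewrite sumr_ge0.
  rewrite (le_trans _ (ler_norm _))//; rewrite /e; case: cid => /= e' e'P.
  exact: e'P.
have key n t : 0 <= t <= T -> `|Z t| <= m / 2 ^+ n * expR (rate d c * t).
  elim: n t => [|n IH] t tT.
    rewrite expr0 divr1 (le_trans (mP t tT))// ler_peMr// -expR0 ler_expR.
    by rewrite mulr_ge0 ?(ltW r0)//; case/andP: tT.
  have /andP[t0 tT'] := tT.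
  rewrite ZE// exprSr invfM mulrA; apply: mprim_exp_bound => //.
    by rewrite divr_ge0// exprn_ge0.
  by move=> s /andP[s0 st]; apply: IH; rewrite s0 (le_trans st).
move=> t tT; apply/eqP; rewrite -normr_le0; apply/ler_addgt0Pl => e e0; rewrite addr0.
have : (fun n => m * expR (rate d c * t) / 2 ^+ n) @ \oo --> (0 : R).
  rewrite -(mulr0 (m * expR (rate d c * t))); apply: cvgM; first exact: cvg_cst.
  under eq_fun do rewrite -exprVn.
  by apply: cvg_expr; rewrite ger0_norm ?invr_ge0// invf_lt1// ltr1n.
move=> /cvgrPdist_le/(_ _ e0)[N _ /(_ N (leqnn N))].
rewrite sub0r normrN => H; rewrite (le_trans (key N t tT))//.
by rewrite mulrAC (le_trans (ler_norm _)).
Qed.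

Definition sol d (A : R -> 'M[R]_d) : R -> 'M[R]_d :=
  xget (fun=> 0) [set X | is_sol A X].

Section Solution.
Variables (d : nat) (c : R) (A : R -> 'M[R]_d).
Hypothesis bA : bsig c A.

Lemma sol_is_sol : is_sol A (sol A).
Proof.
have [X [XP _]] := picard bA.
by rewrite /sol; apply: (@xgetPex _ _ [set X | is_sol A X]); exists X.
Qed.

Lemma sol_cont : mcont (sol A).
Proof. exact: sol_is_sol.1. Qed.

Lemma solE t : sol A t = 1%:M + mprim (fun s => A s *m sol A s) t.
Proof. exact: sol_is_sol.2. Qed.

Lemma sol_mlbm : mlbm (sol A).
Proof. exact/mcont_mlbm/sol_cont. Qed.

Lemma sol_mloc : mloc (fun s => A s *m sol A s).
Proof. by apply: mlocM; [exact: bsig_mlbm bA|exact/mlbm_mloc/sol_mlbm]. Qed.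

Lemma sol0 : sol A 0 = 1%:M.
Proof. by rewrite solE mprim0 addr0. Qed.

Lemma sol_unique l (Z : R -> 'M[R]_(d, l)) Z0 T : mlbm Z ->
  (forall t, 0 <= t <= T -> Z t = Z0 + mprim (fun s => A s *m Z s) t) ->
  forall t, 0 <= t <= T -> Z t = sol A t *m Z0.
Proof.
move=> bZ ZE t tT; apply/eqP; rewrite -subr_eq0; apply/eqP.
have jAZ : mloc (fun s => A s *m Z s).
  by apply: mlocM; [exact: bsig_mlbm bA|exact: mlbm_mloc].
apply: (sol_unique_hom (Z := fun t => Z t - sol A t *m Z0) bA _ _ tT).
  apply: mlbmD => //; apply: mlbmN; apply: mlbmM; first exact: sol_mlbm.
  exact: mlbm_cst.
move=> s sT; under eq_fun do rewrite mulmxBr mulmxA.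
have js := sol_mloc.
rewrite mprimB//; last by apply: mlocMr => //; exact: mlbm_cst.
by rewrite mprim_mulr// ZE// {1}solE mulmxDl mul1mx opprD addrACA subrr add0r.
Qed.

Lemma sol_growth t : 0 <= t -> `|sol A t| <= 2 * expR (rate d c * t).
Proof.
have [X [[cX XE] bX]] := picard bA.
move=> t0; rewrite -[sol A t]mulmx1 -(@sol_unique _ X _ t) ?bX//.
- exact: mcont_mlbm.
- by rewrite t0 lexx.
Qed.

End Solution.

(* The transposed solution of the adjoint equation Y' = - Y A, which is the
   inverse of [sol A]. *)
Definition isol d (A : R -> 'M[R]_d) t : 'M[R]_d := (sol (fun s => - (A s)^T) t)^T.

Section Inverse.
Variables (d : nat) (c : R) (A : R -> 'M[R]_d).
Hypothesis bA : bsig c A.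
Let bN : bsig c (fun s => - (A s)^T) := bsigN (bsig_tr bA).

Lemma isol_cont : mcont (isol A).
Proof. by apply: mcont_tr; exact: sol_cont bN. Qed.

Lemma isolE t : isol A t = 1%:M + mprim (fun s => - (isol A s *m A s)) t.
Proof.
rewrite {1}/isol (solE bN) linearD/= trmx1 -mprim_tr; congr (_ + mprim _ _).
by apply/funext => s; rewrite trmx_mul linearN/= trmxK mulmxN.
Qed.

Lemma isol_mlbm : mlbm (isol A).
Proof. exact/mcont_mlbm/isol_cont. Qed.

(** With Y = [isol A] and X = [sol A], the product rule for Y X has integrand - Y A X + Y A X =
    0. *)
Lemma isol_mul t : isol A t *m sol A t = 1%:M.
Proof.
have mA := bsig_mlbm bA.
have b1 := mlbm_mloc isol_mlbm.
rewrite isolE (solE bA) mprim_prod; last 2 first.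
- by apply: mlocN; exact: mlocMr.
- exact: sol_mloc bA.
rewrite mulmx1 -[RHS]addr0; congr (_ + _).
rewrite -[RHS](mprim_cst0 _ _ t); congr mprim; apply/funext => s.
by rewrite -isolE -(solE bA) mulNmx mulmxA addNr.
Qed.

Lemma sol_isol t : sol A t *m isol A t = 1%:M.
Proof. exact/mulmx1C/isol_mul. Qed.

Lemma sol_unit t : sol A t \in unitmx.
Proof. by have [_] := mulmx1_unit (isol_mul t). Qed.

End Inverse.

Lemma sol_shift d c (A : R -> 'M[R]_d) s t : bsig c A -> 0 <= s -> 0 <= t ->
  sol A (s + t) = sol (Defs.shift s A) t *m sol A s.
Proof.
move=> bA s0 t0; apply: (sol_unique (bsig_shift s bA) (Z := fun t => sol A (s + t)) (T := t)).
- exact/mcont_mlbm/mcont_shift/(sol_cont bA).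
- move=> r /andP[r0 _]; rewrite {1}(solE bA).
  have := mprim_shift s0 r0 (sol_mloc bA) => -> .
  by rewrite {1}(solE bA s) -addrA [_ + (_ - _)]addrC subrK.
- by rewrite t0 lexx.
Qed.

(** The value at 0 is left free because concatenation prescribes its blocks on half-open
    intervals. *)
Lemma sol_ext d c c' (A A' : R -> 'M[R]_d) T : bsig c A -> bsig c' A' ->
  (forall s, 0 < s <= T -> A s = A' s) ->
  forall t, 0 <= t <= T -> sol A t = sol A' t.
Proof.
move=> bA bA' AA t tT; rewrite -[RHS]mulmx1 [RHS]mulmx1 -[LHS]mulmx1; apply/esym.
apply: (sol_unique bA (sol_mlbm bA') _ tT) => r /andP[r0 rT].
rewrite {1}(solE bA'); congr (_ + _); apply: eq_mprim_oc.
- exact: sol_mloc bA'.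
- by apply: mlocM; [exact: bsig_mlbm bA|exact/mlbm_mloc/(sol_mlbm bA')].
- by move=> s /andP[s0 sr]; rewrite AA// s0 (le_trans sr).
Qed.

End Flow.

(** * Identification of [flow] with the solution operator *)

Section FlowSol.
Variable R : realType.

(** Makes a total, locally bounded measurable function out of one that is known on [[0, t]] only, as
    the uniqueness lemmas require; it also switches controls off after time [t]. *)
Definition zcut k l (t : R) (X : R -> 'M[R]_(k, l)) (s : R) : 'M[R]_(k, l) :=
  if 0 <= s <= t then X s else 0.

Lemma zcutE k l (t s : R) (X : R -> 'M[R]_(k, l)) : 0 <= s <= t -> zcut t X s = X s.
Proof. by rewrite /zcut => ->. Qed.

Lemma zcut_restrict k l t (X : R -> 'M[R]_(k, l)) i j :
  (fun s => zcut t X s i j) = (fun s => X s i j) \_ (`[0, t] : set R).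
Proof.
apply/funext => s; rewrite /zcut patchE mem_setE in_itv/=.
by case: ifP => //; rewrite mxE.
Qed.

Lemma within_coord k l (D : set R) (X : R -> 'M[R]_(k, l)) i j :
  {within D, continuous X} -> {within D, continuous (fun s => X s i j)}.
Proof.
move=> cX s; apply: (@continuous_comp (subspace D) 'M[R]_(k, l) R X (fun M => M i j)).
  exact: cX.
exact: coord_continuous.
Qed.

Lemma within_zcut_mlbm k l t (X : R -> 'M[R]_(k, l)) :
  {within `[0, t], continuous X} -> mlbm (zcut t X).
Proof.
move=> cX i j; have cXij := within_coord (i := i) (j := j) cX; split.
  rewrite zcut_restrict; apply/(measurable_restrictT _ _).1 => //.
  exact: subspace_continuous_measurable_fun.
have /compact_bounded : compact ((fun s => X s i j) @` (`[0, t] : set R)).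
  by apply: continuous_compact => //; exact: segment_compact.
move=> [M [_ /(_ (M + 1))]]; rewrite ltrDl ltr01 => /(_ isT) MP.
move=> T; exists `|M + 1| => s _; rewrite /zcut; case: ifPn => st.
  by rewrite (le_trans _ (ler_norm _))//; apply: MP; exists s => //=; rewrite in_itv.
by rewrite mxE normr0.
Qed.

Lemma mcont_within k l (D : set R) (X : R -> 'M[R]_(k, l)) :
  mcont X -> {within D, continuous X}.
Proof. by move=> cX; exact/continuous_subspaceT/mcont_continuous. Qed.

Section Agree.
Variables (d : nat) (c t : R) (A A' : R -> 'M[R]_d).
Hypothesis t0 : 0 <= t.
Hypothesis bA : bsig c A'.
Hypothesis AA : forall s, 0 <= s <= t -> A s = A' s.

(** [flow] is a choice, so its value is known once the set of candidate end values is shown to be a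
    singleton: existence comes from [sol], uniqueness from the cut-off candidate. *)
Lemma flow_sol : flow A t 0 = sol A' t.
Proof.
have tt : 0 <= t <= t by rewrite t0 lexx.
apply: xget_unique.
  exists (sol A') => //; split.
    exact/mcont_within/sol_cont/bA.
  move=> r; rewrite mem_setE in_itv/= (min_idPl t0) (max_idPr t0) => /andP[r0 rt].
  rewrite (solE bA) mx_oint0//; congr (_ + _); apply: eq_mprim => s /andP[s0 sr].
  by rewrite AA// s0 (le_trans sr).
move=> _ [X [cX XE] <-].
move: cX XE; rewrite (min_idPl t0) (max_idPr t0) => cX XE.
rewrite -(zcutE X tt) -[RHS]mulmx1.
apply: (sol_unique bA _ _ tt); first exact: within_zcut_mlbm.
move=> r rt; rewrite zcutE// XE; last by rewrite mem_setE in_itv.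
have /andP[r0 rt'] := rt.
rewrite mx_oint0//; congr (_ + _); apply: eq_mprim => s /andP[s0 sr].
by rewrite AA ?zcutE// s0 (le_trans sr).
Qed.

Lemma flow_isol : flow A 0 t = isol A' t.
Proof.
have tt : 0 <= t <= t by rewrite t0 lexx.
have z0 : 0 <= (0 : R) <= t by rewrite lexx t0.
apply: xget_unique.
  (* The solution normalized at time [t] is the one normalized at 0, times the inverse of its value
     at [t]. *)
  exists (fun r => sol A' r *m isol A' t); last by rewrite (sol0 bA) mul1mx.
  have c1 : mcont (fun r => sol A' r *m isol A' t).
    by apply: mcontM; [exact: sol_cont bA|exact: mcont_cst].
  split; first exact: mcont_within.
  move=> r; rewrite mem_setE in_itv/= (min_idPr t0) (max_idPl t0) => /andP[r0 rt].
  pose W s := A' s *m (sol A' s *m isol A' t).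
  have jW : mloc W.
    by apply: mlocM; [exact: bsig_mlbm bA|exact/mlbm_mloc/mcont_mlbm].
  transitivity (1%:M + mx_oint t r W); last first.
    congr (_ + _); apply/matrixP => i j; rewrite !mxE /oint.
    move: rt; rewrite le_eqVlt => /predU1P[->|rt].
      rewrite lexx; apply: eq_Rintegral => s; rewrite mem_setE in_itv/= => st.
      by rewrite /W AA//; move: st t0; lra.
    rewrite leNgt rt/=; congr (- _); apply: eq_Rintegral => s.
    rewrite mem_setE in_itv/= => st.
    by rewrite /W AA//; move: st r0; lra.
  rewrite mx_oint_mprim//.
  have mW s : mprim W s = mprim (fun s => A' s *m sol A' s) s *m isol A' t.
    rewrite -mprim_mulr; last exact: sol_mloc bA.
    by congr mprim; apply/funext => q; rewrite /W mulmxA.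
  have E : 1%:M = isol A' t + mprim (fun s => A' s *m sol A' s) t *m isol A' t.
    by rewrite -{1}(sol_isol bA t) {1}(solE bA t) mulmxDl mul1mx.
  by rewrite !mW {1}(solE bA r) mulmxDl mul1mx [in RHS]E -addrA [_ + (_ - _)]addrC subrK.
move=> _ [X [cX XE] <-].
move: cX XE; rewrite (min_idPr t0) (max_idPl t0) => cX XE.
have bZ := within_zcut_mlbm cX.
have jAZ : mloc (fun s => A' s *m zcut t X s).
  by apply: mlocM; [exact: bsig_mlbm bA|exact: mlbm_mloc].
have XZ r : 0 <= r <= t -> X r = 1%:M + (mprim (fun s => A' s *m zcut t X s) r -
    mprim (fun s => A' s *m zcut t X s) t).
  move=> /andP[r0 rt]; rewrite XE; last by rewrite mem_setE in_itv/= r0.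
  rewrite -mx_oint_mprim//; congr (_ + _).
  apply/matrixP => i j; rewrite !mxE /oint; case: ifP => [tr|_].
    apply: eq_Rintegral => s; rewrite mem_setE in_itv/= => st.
    by rewrite AA ?zcutE//; move: st t0 rt; lra.
  congr (- _); apply: eq_Rintegral => s; rewrite mem_setE in_itv/= => st.
  by rewrite AA ?zcutE//; move: st r0 rt; lra.
(* The equation based at [t] is read as an equation based at 0 with unknown initial value [X 0]; the
   condition X(t) = Id then determines [X 0]. *)
have E : zcut t X t = sol A' t *m X 0.
  apply: (sol_unique bA bZ _ tt) => r rt.
  by rewrite zcutE// XZ// (XZ 0 z0) mprim0 -addrA [X in _ + X]addrC sub0r addrA.
have Xt : X t = 1%:M by rewrite XZ// subrr addr0.
move: E; rewrite zcutE// Xt => E.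
by rewrite -[X 0]mul1mx -(isol_mul bA t) -mulmxA -E mulmx1.
Qed.

End Agree.

Lemma flow_bsig d c (A : R -> 'M[R]_d) t : bsig c A -> 0 <= t -> flow A t 0 = sol A t.
Proof. by move=> bA t0; exact: (flow_sol t0 bA). Qed.

End FlowSol.

(** * Trajectories by variation of constants *)

Section Trajectory.
Variable R : realType.

Section Variation.
Variables (n m : nat) (c e : R) (A : R -> 'M[R]_n) (B : R -> 'M[R]_(n, m)).
Hypothesis bA : bsig c A.
Hypothesis bB : bsig e B.

(** Variation of constants with Phi(t, s) split as Phi(t, 0) Phi(0, s), so that the integrand does
    not depend on [t] and the product rule applies. *)
Definition vconst (u : R -> 'cV[R]_m) (t : R) : 'cV[R]_n :=
  sol A t *m mprim (fun s => isol A s *m (B s *m u s)) t.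

Variable u : R -> 'cV[R]_m.
Hypothesis ju : mloc u.

Let jBu : mloc (fun s => B s *m u s).
Proof. by apply: mlocM => //; exact: bsig_mlbm bB. Qed.

Let jIBu : mloc (fun s => isol A s *m (B s *m u s)).
Proof. by apply: mlocM => //; exact: (isol_mlbm bA). Qed.

Lemma vconst_cont : mcont (vconst u).
Proof. by apply: mcontM; [exact: sol_cont bA|exact: mprim_cont]. Qed.

Lemma vconst_mlbm : mlbm (vconst u).
Proof. exact/mcont_mlbm/vconst_cont. Qed.

Lemma vconstE t : vconst u t = mprim (fun s => A s *m vconst u s + B s *m u s) t.
Proof.
rewrite {1}/vconst (solE bA) -[X in _ *m X]add0r mprim_prod//; last exact: sol_mloc bA.
rewrite mulmx0 add0r; congr mprim; apply/funext => s.
rewrite add0r -(solE bA) -mulmxA; congr (_ + _).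
by rewrite mulmxA (sol_isol bA) mul1mx.
Qed.

Lemma vconst_unique (x : R -> 'cV[R]_n) T :
  {within `[0, T], continuous x} ->
  (forall t, 0 <= t <= T -> x t = mx_oint 0 t (fun s => A s *m x s + B s *m u s)) ->
  forall t, 0 <= t <= T -> x t = vconst u t.
Proof.
move=> cx xE t tT; rewrite -(zcutE x tT).
have bZ := within_zcut_mlbm cx.
have bv := vconst_mlbm.
apply/eqP; rewrite -subr_eq0; apply/eqP.
apply: (sol_unique_hom (Z := fun t => zcut T x t - vconst u t) bA _ _ tT).
  by apply: mlbmD => //; exact: mlbmN.
move=> r rT; have /andP[r0 rT'] := rT.
rewrite zcutE// xE// vconstE mx_oint0//.
have -> : mprim (fun s => A s *m x s + B s *m u s) r =
    mprim (fun s => A s *m zcut T x s + B s *m u s) r.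
  by apply: eq_mprim => s /andP[s0 sr]; rewrite zcutE// s0 (le_trans sr).
have mA := bsig_mlbm bA.
rewrite -mprimB; last 2 first.
- by apply: mlocD => //; apply: mlocM => //; exact: mlbm_mloc.
- by apply: mlocD => //; apply: mlocM => //; exact: mlbm_mloc.
by congr mprim; apply/funext => s; rewrite mulmxBr opprD addrACA subrr addr0.
Qed.

Lemma vconst_trajectory : {within @halfline R, continuous (vconst u)} /\
  forall t, 0 <= t ->
    vconst u t = mx_oint 0 t (fun s => A s *m vconst u s + B s *m u s).
Proof.
split; first exact/mcont_within/vconst_cont.
by move=> t t0; rewrite mx_oint0// -vconstE.
Qed.

End Variation.
End Trajectory.

(** * Gramians *)

Section Squares.
Variable R : realType.

Definition sqn k (v : 'cV[R]_k) : R := \sum_i (v i 0) ^+ 2.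

Lemma sqnE k (v : 'cV[R]_k) : (v^T *m v) 0 0 = sqn v.
Proof. by rewrite mxE; apply: eq_bigr => i _; rewrite mxE expr2. Qed.

Lemma sqn_ge0 k (v : 'cV[R]_k) : 0 <= sqn v.
Proof. by apply: sumr_ge0 => i _; exact: sqr_ge0. Qed.

Lemma sqn0 k : sqn (0 : 'cV[R]_k) = 0.
Proof. by rewrite /sqn big1// => i _; rewrite mxE expr0n. Qed.

Lemma sqn_eq0 k (v : 'cV[R]_k) : sqn v = 0 -> v = 0.
Proof.
move/eqP; rewrite psumr_eq0 => [/allP v0|i _]; last exact: sqr_ge0.
apply/colP => i; rewrite mxE; apply/eqP.
by have := v0 i (mem_index_enum i); rewrite sqrf_eq0.
Qed.

Lemma sqn_norm k (v : 'cV[R]_k) : `|v| ^+ 2 <= sqn v.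
Proof.
rewrite -[leRHS]sqr_sqrtr ?sqn_ge0// ler_sqr ?nnegrE ?sqrtr_ge0//.
apply: mx_norm_le => [|i j]; first exact: sqrtr_ge0.
rewrite (ord1 j) -sqrtr_sqr ler_wsqrtr// /sqn (bigD1 i)//= lerDl.
by apply: sumr_ge0 => h _; exact: sqr_ge0.
Qed.

Lemma norm_sqn k (v : 'cV[R]_k) : sqn v <= k%:R * `|v| ^+ 2.
Proof.
rewrite mulr_natl -[k in _ *+ k]card_ord -sumr_const ler_sum// => i _.
by rewrite -[leLHS]ger0_norm ?sqr_ge0// normrX ler_sqr ?nnegrE// mx_norm_lb.
Qed.

Definition opsq k l (M : 'M[R]_(k, l)) : R := k%:R * (l%:R * `|M|) ^+ 2.

Lemma opsq_ge0 k l (M : 'M[R]_(k, l)) : 0 <= opsq M.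
Proof. by rewrite mulr_ge0 ?sqr_ge0. Qed.

Lemma sqnM k l (M : 'M[R]_(k, l)) (v : 'cV[R]_l) : sqn (M *m v) <= opsq M * sqn v.
Proof.
rewrite (le_trans (norm_sqn _))// /opsq -mulrA ler_wpM2l//.
apply: (@le_trans _ _ ((l%:R * `|M|) ^+ 2 * `|v| ^+ 2)).
  by rewrite -exprMn ler_sqr ?nnegrE ?mulr_ge0// mx_normM.
by rewrite ler_wpM2l ?sqr_ge0// sqn_norm.
Qed.

Definition qf k (W : 'M[R]_k) (x : 'cV[R]_k) : R := (x^T *m W *m x) 0 0.

Lemma qfE k l (M : 'M[R]_(k, l)) (N : 'M[R]_k) x :
  qf (M^T *m N *m M) x = qf N (M *m x).
Proof. by rewrite /qf trmx_mul !mulmxA. Qed.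

Lemma qfD k (V W : 'M[R]_k) x : qf (V + W) x = qf V x + qf W x.
Proof. by rewrite /qf mulmxDr mulmxDl mxE. Qed.

(** No spectral theory: if K bounds the form, nonnegativity at x - K^-1 W x, one step of gradient
    descent, leaves 0 <= x^T W x - K^-1 |W x|^2. *)
Lemma psd_bound k (W : 'M[R]_k) : W^T = W -> (forall x, 0 <= qf W x) ->
  exists2 K, 0 < K & forall x, sqn (W *m x) <= K * qf W x.
Proof.
move=> sW pW.
pose K := k%:R * `|W| * k%:R + 1.
have K0 : 0 < K by rewrite ltr_wpDl// !mulr_ge0.
have qK y : qf W y <= K * sqn y.
  have -> : qf W y = \sum_i \sum_j y i 0 * W i j * y j 0.
    rewrite /qf -mulmxA mxE; apply: eq_bigr => i _; rewrite !mxE mulr_sumr.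
    by apply: eq_bigr => j _; rewrite mulrA.
  apply: (@le_trans _ _ (\sum_(i < k) \sum_(j < k) `|W| * sqn y)).
    apply: ler_sum => i _; apply: ler_sum => j _.
    rewrite (le_trans (ler_norm _))// !normrM [`|y i 0| * _]mulrC -mulrA ler_pM//.
      exact: mx_norm_lb.
    rewrite (le_trans _ (sqn_norm y))// expr2.
    by rewrite ler_pM// mx_norm_lb.
  rewrite sumr_const card_ord sumr_const card_ord -mulrnA -[leLHS]mulr_natl natrM.
  have -> : k%:R * k%:R * (`|W| * sqn y) = k%:R * `|W| * k%:R * sqn y by ring.
  by rewrite ler_wpM2r ?sqn_ge0// lerDl.
exists K => // x.
pose z := x - K^-1 *: (W *m x).
have := pW z.
have -> : qf W z = qf W x - 2 * K^-1 * sqn (W *m x) + K^-1 ^+ 2 * qf W (W *m x).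
  have zT : z^T = x^T - K^-1 *: (x^T *m W).
    by rewrite /z linearB/= linearZ/= trmx_mul sW.
  rewrite /qf -sqnE zT /z !(mulmxBl, mulmxBr) -!(scalemxAl, scalemxAr) trmx_mul sW !mulmxA.
  rewrite !mxE.
  by ring.
have := qK (W *m x).
set a := sqn _; set b := qf W (W *m x) => ba h.
have : K^-1 ^+ 2 * b <= K^-1 * a.
  by rewrite expr2 -mulrA ler_wpM2l ?invr_ge0 ?(ltW K0)// ler_pdivrMl.
move=> h2; have h3 : 0 <= qf W x - K^-1 * a by lra.
by move: h3; rewrite subr_ge0 ler_pdivrMl.
Qed.

(** Writing x as W^-1 (W x) and applying [psd_bound] gives a substitute for the smallest
    eigenvalue. *)
Lemma posdef_bound k (W : 'M[R]_k) : W^T = W -> (forall x, 0 <= qf W x) ->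
  W \in unitmx -> exists2 g, 0 < g & forall x, g * sqn x <= qf W x.
Proof.
move=> sW pW uW; have [K K0 KP] := psd_bound sW pW.
pose L := opsq (invmx W) * K + 1.
have L0 : 0 < L by rewrite ltr_wpDl// mulr_ge0 ?opsq_ge0// ltW.
exists L^-1; first by rewrite invr_gt0.
move=> x; rewrite ler_pdivrMl//.
rewrite -{1}[x](mulKmx uW) (le_trans (sqnM _ _))//.
rewrite /L mulrDl mul1r; apply: ler_wpDr; first exact: pW.
rewrite -[leRHS]mulrA.
by rewrite ler_wpM2l ?opsq_ge0//; exact: KP.
Qed.

End Squares.

Section Gramian.
Variable R : realType.

Definition og d p (A : R -> 'M[R]_d) (C : R -> 'M[R]_(p, d)) (t : R) : 'M[R]_d :=
  mprim (fun s => (sol A s)^T *m (C s)^T *m C s *m sol A s) t.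

Section Obs.
Variables (d p : nat) (c e : R) (A : R -> 'M[R]_d) (C : R -> 'M[R]_(p, d)).
Hypothesis bA : bsig c A.
Hypothesis bC : bsig e C.

Lemma og_mlbm : mlbm (fun s => (sol A s)^T *m (C s)^T *m C s *m sol A s).
Proof.
have h := sol_mlbm bA; have g := bsig_mlbm bC.
by apply: mlbmM => //; apply: mlbmM => //; apply: mlbmM; exact: mlbm_tr.
Qed.

Lemma og_sym t : (og A C t)^T = og A C t.
Proof.
rewrite /og -mprim_tr; congr mprim; apply/funext => s.
by rewrite !trmx_mul !trmxK !mulmxA.
Qed.

(** This ties Gramians to the gain: the form is the energy on [[0, t]] of the free output issued
    from [x]. *)
Lemma qf_og t x : qf (og A C t) x = prim (fun s => sqn (C s *m sol A s *m x)) t.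
Proof.
have jo := mlbm_mloc og_mlbm.
rewrite /qf /og -mprim_mull// -mprim_mulr; last by apply: mlocM => //; exact: mlbm_cst.
rewrite mxE; congr prim; apply/funext => s.
by rewrite -sqnE !trmx_mul !mulmxA.
Qed.

Lemma qf_og_ge0 t x : 0 <= qf (og A C t) x.
Proof. by rewrite qf_og; apply: prim_ge0 => s _; exact: sqn_ge0. Qed.

Lemma og_cat s t : 0 <= s -> 0 <= t ->
  og A C (s + t) = og A C s +
    (sol A s)^T *m og (Defs.shift s A) (Defs.shift s C) t *m sol A s.
Proof.
move=> s0 t0; have jo := mlbm_mloc og_mlbm.
rewrite -[LHS](subrK (og A C s)) addrC; congr (_ + _).
rewrite /og -mprim_shift// -mprim_mull; last first.
  have h := sol_mlbm (bsig_shift s bA); have g := bsig_mlbm (bsig_shift s bC).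
  apply: mlbm_mloc.
  by apply: mlbmM => //; apply: mlbmM => //; apply: mlbmM; exact: mlbm_tr.
rewrite -mprim_mulr; last first.
  have h := sol_mlbm (bsig_shift s bA); have g := bsig_mlbm (bsig_shift s bC).
  apply: mlbm_mloc; apply: mlbmM; first exact: mlbm_cst.
  by apply: mlbmM => //; apply: mlbmM => //; apply: mlbmM; exact: mlbm_tr.
apply: eq_mprim => r /andP[r0 rt].
by rewrite (sol_shift bA s0 r0) !trmx_mul !mulmxA.
Qed.

Lemma og_ext c' e' (A' : R -> 'M[R]_d) (C' : R -> 'M[R]_(p, d)) t :
  bsig c' A' -> bsig e' C' ->
  (forall s, 0 < s <= t -> A s = A' s) -> (forall s, 0 < s <= t -> C s = C' s) ->
  og A C t = og A' C' t.
Proof.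
move=> bA' bC' AA CC; apply: eq_mprim_oc.
- exact/mlbm_mloc/og_mlbm.
- have h := sol_mlbm bA'; have g := bsig_mlbm bC'; apply: mlbm_mloc.
  by apply: mlbmM => //; apply: mlbmM => //; apply: mlbmM; exact: mlbm_tr.
- move=> s st; have -> : sol A s = sol A' s.
    by apply: (sol_ext bA bA' AA); case/andP: st => /ltW -> ->.
  by rewrite CC.
Qed.

End Obs.

Definition tsig n m p c (a : R -> triple R n m p) : Prop :=
  [/\ bsig c (fun s => mxA (a s)), bsig c (fun s => mxB (a s)) &
      bsig c (fun s => mxC (a s))].

Lemma tsig_shift n m p c (a : R -> triple R n m p) s :
  tsig c a -> tsig c (Defs.shift s a).
Proof.
by move=> [bA bB bC]; split; [exact: (bsig_shift s bA)|exact: (bsig_shift s bB)|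
  exact: (bsig_shift s bC)].
Qed.

Definition ogt n m p (a : R -> triple R n m p) : R -> 'M[R]_n :=
  og (fun s => mxA (a s)) (fun s => mxC (a s)).

(* The controllability Gramian is the observability Gramian of the dual system. *)
Definition cgt n m p (a : R -> triple R n m p) : R -> 'M[R]_n :=
  og (fun s => - (mxA (a s))^T) (fun s => (mxB (a s))^T).

Section GramianSol.
Variables (n m p : nat) (c : R) (a a' : R -> triple R n m p) (t : R).
Hypothesis bA : bsig c (fun s => mxA (a' s)).
Hypothesis t0 : 0 <= t.
Hypothesis aa : forall s, 0 <= s <= t -> a s = a' s.

Lemma obs_gramian_ogt : obs_gramian a t = ogt a' t.
Proof.
rewrite /obs_gramian mx_oint0//; apply: eq_mprim => s /andP[s0 st].
rewrite (flow_sol s0 bA) ?aa ?s0// => r /andP[r0 rs].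
by rewrite aa// r0 (le_trans rs).
Qed.

Lemma ctrl_gramian_cgt : ctrl_gramian a t = cgt a' t.
Proof.
rewrite /ctrl_gramian mx_oint0//; apply: eq_mprim => s /andP[s0 st].
rewrite (flow_isol s0 bA) ?aa ?s0//.
  by rewrite /isol !trmxK.
by move=> r /andP[r0 rs]; rewrite aa// r0 (le_trans rs).
Qed.

End GramianSol.
End Gramian.

(** * Analytic paths *)

Section Analytic.
Variable R : realType.
Implicit Types (f g : R -> R) (D : set R) (c : nat -> R).

Definition psum c (h : R) (N : nat) : R := \sum_(k < N) c k * h ^+ k.

(* The coefficient bound [M b^k] makes the series converge geometrically on the
   disk [|y - x| b <= 1/8], which leaves room for Cauchy products. *)
Definition analytic_at D f (x : R) : Prop :=
  exists c M b, [/\ 0 <= M, 0 < b, forall k, `|c k| <= M * b ^+ k &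
    forall y, D y -> `|y - x| * b <= 8^-1 -> psum c (y - x) @ \oo --> f y].

Lemma seriesE c h : series (fun k => c k * h ^+ k) = psum c h.
Proof. by apply/funext => N; rewrite /series/= big_mkord. Qed.

(** Abel's argument: convergence at one point y other than x bounds the terms c_k (y - x)^k, whence
    the coefficient bound with b = 1 / |y - x|. The disk of [analytic_at] then lies inside the given
    neighbourhood. *)
Lemma analytic_onP D f x : analytic_on D f -> D x ->
  (forall e, 0 < e -> exists y, [/\ D y, y != x & `|y - x| < e]) ->
  analytic_at D f x.
Proof.
move=> aD Dx acc; have [c [e e0 ce]] := aD x Dx.
have [y [Dy yx ye]] := acc e e0.
have hx : 0 < `|y - x| by rewrite normr_gt0 subr_eq0.
have /cvgP/cvg_series_cvg_0/cvgP cu := ce y Dy ye.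
have [M0 [_ /(_ (`|M0| + 1))]] := cvg_seq_bounded cu.
rewrite ltr_pwDr ?ler_norm// => /(_ isT) MP.
pose M := `|M0| + 1; pose b := `|y - x|^-1.
have b0 : 0 < b by rewrite invr_gt0.
exists c, M, b; split => //.
- by rewrite /M addr_ge0.
- move=> k; have := MP k I; rewrite /= normrM normrX /b exprVn.
  by rewrite ler_pdivlMr// exprn_gt0.
- move=> z Dz zb; rewrite -seriesE; apply: ce => //.
  apply: le_lt_trans ye; rewrite -(ler_pM2r b0) (le_trans zb)// divff ?gt_eqF//.
  by rewrite invf_le1// ler1n.
Qed.

(** Lets two functions share one [b]: a larger [b] weakens the coefficient bound and shrinks the
    disk. *)
Lemma analytic_at_widen D f x c M b b' : 0 <= M -> 0 < b -> b <= b' ->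
  (forall k, `|c k| <= M * b ^+ k) ->
  (forall y, D y -> `|y - x| * b <= 8^-1 -> psum c (y - x) @ \oo --> f y) ->
  (forall k, `|c k| <= M * b' ^+ k) /\
  (forall y, D y -> `|y - x| * b' <= 8^-1 -> psum c (y - x) @ \oo --> f y).
Proof.
move=> M0 b0 bb cM cf; split.
  move=> k; rewrite (le_trans (cM k))// ler_wpM2l//.
  by rewrite lerXn2r ?nnegrE ?(ltW b0)// (le_trans (ltW b0)).
by move=> y Dy yb; apply: cf => //; rewrite (le_trans _ yb)// ler_wpM2l.
Qed.

Lemma analytic_at_cst D (a : R) x : analytic_at D (fun=> a) x.
Proof.
exists (fun k => if k == 0%N then a else 0), `|a|, 1; split => //.
- by move=> k; rewrite expr1n mulr1; case: eqP; rewrite ?normr0.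
- move=> y _ _; rewrite -(cvg_shiftn 1).
  have -> : (fun n => psum (fun k => if k == 0%N then a else 0) (y - x) (n + 1)) = fun=> a.
    apply/funext => n; rewrite /psum addn1 big_ord_recl/= expr0 mulr1 big1 ?addr0//.
    by move=> i _; rewrite mul0r.
  exact: cvg_cst.
Qed.

Lemma analytic_atD D f g x : analytic_at D f x -> analytic_at D g x ->
  analytic_at D (fun y => f y + g y) x.
Proof.
move=> [c [M [b [M0 b0 cM cf]]]] [d [N [e [N0 e0 dN dg]]]].
have bm : b <= Num.max b e by rewrite le_max lexx.
have em : e <= Num.max b e by rewrite le_max lexx orbT.
have [cM' cf'] := analytic_at_widen M0 b0 bm cM cf.
have [dN' dg'] := analytic_at_widen N0 e0 em dN dg.
exists (fun k => c k + d k), (M + N), (Num.max b e); split.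
- exact: addr_ge0.
- exact: lt_le_trans bm.
- by move=> k; rewrite mulrDl (le_trans (ler_normD _ _))// lerD.
- move=> y Dy yb.
  have -> : psum (fun k => c k + d k) (y - x) =
      fun n => psum c (y - x) n + psum d (y - x) n.
    by apply/funext => n; rewrite /psum -big_split; apply: eq_bigr => i _; rewrite mulrDl.
  by apply: cvgD; [exact: cf'|exact: dg'].
Qed.

(** Truncating both series to polynomials [P] and [Q] makes the difference the part of [P * Q] of
    degree at least n. Its coefficients are at most M N (2b)^k, since k + 1 <= 2^k; there are at
    most n of them, so the bound on h leaves n M N 8^-n, and n 2^n <= 8^n. *)
Lemma cauchy_product_bound c d M N b h n : 0 <= M -> 0 <= N -> 0 < b ->
  (forall k, `|c k| <= M * b ^+ k) -> (forall k, `|d k| <= N * b ^+ k) ->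
  `|h| * (2 * b) <= 8^-1 ->
  `|psum c h n * psum d h n - psum (fun k => \sum_(j < k.+1) c j * d (k - j)%N) h n|
    <= M * N / 2 ^+ n.
Proof.
move=> M0 N0 b0 cM dN hb.
pose P := \poly_(k < n) c k; pose Q := \poly_(k < n) d k.
have hP : psum c h n = P.[h].
  rewrite (horner_coef_wide _ (size_poly _ _)); apply: eq_bigr => i _.
  by rewrite coef_poly ltn_ord.
have hQ : psum d h n = Q.[h].
  rewrite (horner_coef_wide _ (size_poly _ _)); apply: eq_bigr => i _.
  by rewrite coef_poly ltn_ord.
have sPQ : (size (P * Q)%R <= n + n)%N.
  rewrite (leq_trans (size_polyMleq _ _))// (leq_trans (leq_pred _))//.
  by rewrite leq_add// size_poly.
have cPQ k : `|(P * Q)`_k| <= M * N * (2 * b) ^+ k.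
  rewrite coefM (le_trans (ler_norm_sum _ _ _))//.
  apply: (@le_trans _ _ (\sum_(j < k.+1) M * N * b ^+ k)).
    apply: ler_sum => j _; rewrite normrM.
    have -> : b ^+ k = b ^+ j * b ^+ (k - j) by rewrite -exprD subnKC// -ltnS.
    rewrite mulrACA ler_pM// coef_poly; case: ifP => _; rewrite ?normr0//.
      by rewrite mulr_ge0// exprn_ge0// ltW.
    by rewrite mulr_ge0// exprn_ge0// ltW.
  rewrite sumr_const card_ord -[leLHS]mulr_natl exprMn mulrCA ler_wpM2l ?mulr_ge0//.
  rewrite ler_wpM2r ?exprn_ge0 ?(ltW b0)// -natrX ler_nat.
  by rewrite ltn_expl.
rewrite hP hQ -hornerM (horner_coef_wide _ sPQ).
rewrite -(big_mkord xpredT (fun i => (P * Q)`_i * h ^+ i)) (big_cat_nat (n := n)) ?leq_addr//=.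
rewrite big_mkord.
have -> : \sum_(i < n) (P * Q)`_i * h ^+ i = psum (fun k => \sum_(j < k.+1) c j * d (k - j)%N) h n.
  apply: eq_bigr => i _; congr (_ * _); rewrite coefM; apply: eq_bigr => j _.
  have jn : (j < n)%N by rewrite (leq_ltn_trans _ (ltn_ord i))// -ltnS.
  have ijn : (i - j < n)%N by rewrite (leq_ltn_trans (leq_subr _ _)).
  by rewrite !coef_poly jn ijn.
rewrite addrAC subrr add0r -{1}[n]add0n big_addn addnK big_mkord.
rewrite (le_trans (ler_norm_sum _ _ _))//.
apply: (@le_trans _ _ (\sum_(i < n) M * N * 8^-1 ^+ n)).
  apply: ler_sum => i _; rewrite normrM normrX.
  apply: (@le_trans _ _ (M * N * ((2 * b) ^+ (i + n) * `|h| ^+ (i + n)))).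
    by rewrite mulrA ler_wpM2r ?exprn_ge0// cPQ.
  rewrite ler_wpM2l ?mulr_ge0// -exprMn mulrC.
  have t0 : 0 <= `|h| * (2 * b) by rewrite !mulr_ge0// ltW.
  rewrite (@le_trans _ _ (8^-1 ^+ (i + n)))//.
    by rewrite lerXn2r ?nnegrE ?invr_ge0.
  by apply: ler_wiXn2l; rewrite ?invr_ge0 ?invf_le1 ?ler1n// leq_addl.
rewrite sumr_const card_ord -mulrnAr ler_wpM2l ?mulr_ge0// -[leLHS]mulr_natl.
have H : n%:R * 2 ^+ n <= 8 ^+ n :> R.
  rewrite -!natrX -natrM ler_nat (_ : 8 = 4 * 2)%N// expnMn leq_mul2r.
  by rewrite (ltnW (ltn_expl _ _)) ?orbT.
by rewrite exprVn ler_pdivrMr ?exprn_gt0// mulrC ler_pdivlMr ?exprn_gt0.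
Qed.

Lemma cvg_geometric0 (K : R) : (fun n => K / 2 ^+ n) @ \oo --> (0 : R).
Proof.
rewrite -(mulr0 K); apply: cvgM; first exact: cvg_cst.
under eq_fun do rewrite -exprVn.
by apply: cvg_expr; rewrite ger0_norm ?invr_ge0// invf_lt1// ltr1n.
Qed.

Lemma analytic_atM D f g x : analytic_at D f x -> analytic_at D g x ->
  analytic_at D (fun y => f y * g y) x.
Proof.
move=> [c [M [b [M0 b0 cM cf]]]] [d [N [e [N0 e0 dN dg]]]].
have bm : b <= Num.max b e by rewrite le_max lexx.
have em : e <= Num.max b e by rewrite le_max lexx orbT.
have [cM' cf'] := analytic_at_widen M0 b0 bm cM cf.
have [dN' dg'] := analytic_at_widen N0 e0 em dN dg.
set B := Num.max b e in bm em cM' cf' dN' dg'.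
have B0 : 0 < B by exact: lt_le_trans bm.
(* The k + 1 terms of the convolution are absorbed by k + 1 <= 2^k, hence the doubled rate. *)
exists (fun k => \sum_(j < k.+1) c j * d (k - j)%N), (M * N), (2 * B); split.
- exact: mulr_ge0.
- exact: mulr_gt0.
- move=> k; rewrite (le_trans (ler_norm_sum _ _ _))//.
  apply: (@le_trans _ _ (\sum_(j < k.+1) M * N * B ^+ k)).
    apply: ler_sum => j _; rewrite normrM.
    have -> : B ^+ k = B ^+ j * B ^+ (k - j) by rewrite -exprD subnKC// -ltnS.
    by rewrite mulrACA ler_pM.
  rewrite sumr_const card_ord -[leLHS]mulr_natl exprMn mulrCA ler_wpM2l ?mulr_ge0//.
  rewrite ler_wpM2r ?exprn_ge0 ?(ltW B0)// -natrX ler_nat.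
  by rewrite ltn_expl.
- move=> y Dy yb.
  have yB : `|y - x| * B <= 8^-1.
    by rewrite (le_trans _ yb)// ler_wpM2l// ler_peMl ?(ltW B0)// ler1n.
  have H n := cauchy_product_bound n M0 N0 B0 cM' dN' yb.
  have fg : (fun n => psum c (y - x) n * psum d (y - x) n) @ \oo --> f y * g y.
    by apply: cvgM; [exact: cf'|exact: dg'].
  have z : (fun n => psum c (y - x) n * psum d (y - x) n -
      psum (fun k => \sum_(j < k.+1) c j * d (k - j)%N) (y - x) n) @ \oo --> (0 : R).
    apply/cvgrPdist_le => eps eps0.
    have /cvgrPdist_le/(_ _ eps0) := cvg_geometric0 (M * N).
    apply: filterS => n; rewrite !sub0r !normrN => Hn.
    by rewrite (le_trans (H n))// (le_trans (ler_norm _)).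
  have L := cvgB fg z; rewrite subr0 in L.
  rewrite (_ : psum _ _ = fun n => psum c (y - x) n * psum d (y - x) n -
     (psum c (y - x) n * psum d (y - x) n - psum (fun k => \sum_(j < k.+1) c j * d (k - j)%N) (y - x) n)); first exact: L.
  by apply/funext => n; rewrite subKr.
Qed.

Lemma analytic_at_sum D (I : Type) (r : seq I) (F : I -> R -> R) x :
  (forall i, analytic_at D (F i) x) ->
  analytic_at D (fun y => \sum_(i <- r) F i y) x.
Proof.
move=> aF; elim: r => [|i r IH].
  by under eq_fun do rewrite big_nil; exact: analytic_at_cst.
by under eq_fun do rewrite big_cons; exact: analytic_atD.
Qed.

Lemma analytic_at_prod D (I : Type) (r : seq I) (F : I -> R -> R) x :
  (forall i, analytic_at D (F i) x) ->
  analytic_at D (fun y => \prod_(i <- r) F i y) x.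
Proof.
move=> aF; elim: r => [|i r IH].
  by under eq_fun do rewrite big_nil; exact: analytic_at_cst.
by under eq_fun do rewrite big_cons; exact: analytic_atM.
Qed.

Lemma analytic_at_det D d (W : R -> 'M[R]_d) x :
  (forall i j, analytic_at D (fun y => W y i j) x) ->
  analytic_at D (fun y => \det (W y)) x.
Proof.
move=> aW; rewrite /determinant; apply: analytic_at_sum => s.
by apply: analytic_atM; [exact: analytic_at_cst|exact: analytic_at_prod].
Qed.

(** The term [2 * t ^+ n], a bound for the rest of the series, is what makes the induction on [n]
    close. *)
Lemma geometric_tail (t : R) m n : 0 <= t -> t <= 2^-1 -> (m <= n)%N ->
  \sum_(m <= j < n) t ^+ j + 2 * t ^+ n <= 2 * t ^+ m.
Proof.
move=> t0 t2; elim: n => [|n IH]; first by rewrite leqn0 => /eqP ->; rewrite big_geq// add0r.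
rewrite leq_eqVlt => /predU1P[->|mn]; first by rewrite big_geq// add0r.
rewrite big_nat_recr//= (le_trans _ (IH mn))// -addrA lerD2l.
have : 0 <= t ^+ n by exact: exprn_ge0.
rewrite exprS; set u := t ^+ n => u0; have : t * u <= 2^-1 * u by rewrite ler_wpM2r.
lra.
Qed.

(** If the coefficients before c_k vanish, a zero at x + h gives |c_k| |h|^k <= 2 M (|h| b)^(k+1) by
    the geometric tail; dividing by |h|^k and letting h tend to 0 gives c_k = 0. *)
Lemma analytic_at_vanish D f x : analytic_at D f x ->
  (forall e, 0 < e -> exists y, [/\ D y, y != x, `|y - x| < e & f y = 0]) ->
  exists2 e, 0 < e & forall y, D y -> `|y - x| <= e -> f y = 0.
Proof.
move=> [c [M [b [M0 b0 cM cf]]]] acc.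
have c0 k : c k = 0.
  have [n] := ubnP k; elim: n k => // n IH k kn.
  have {}IH j : (j < k)%N -> c j = 0 by move=> jk; apply: IH; lia.
  apply/eqP; rewrite -normr_le0; apply/ler_addgt0Pl => e e0; rewrite addr0.
  (* [K] times |h| will bound [c k], so the zero is taken at distance less than e / K, and less than
     1 / (8 b) to stay in the disk of convergence. *)
  pose K := 2 * M * b ^+ k.+1 + 1.
  have K0 : 0 < K by rewrite ltr_wpDl// !mulr_ge0// exprn_ge0// ltW.
  have m0 : 0 < Num.min (e / K) (8^-1 / b) by rewrite lt_min !divr_gt0.
  have [y [Dy yx ym fy]] := acc _ m0.
  move: ym; rewrite lt_min => /andP[ye yb].
  have h0 : 0 < `|y - x| by rewrite normr_gt0 subr_eq0.
  have yb8 : `|y - x| * b <= 8^-1 by rewrite -ler_pdivlMr// ltW.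
  have := cf y Dy yb8; rewrite fy => cy.
  set h := y - x in h0 ye yb yb8 cy *.
  have bound N : (k < N)%N -> `|c k| * `|h| ^+ k <= `|psum c h N| + 2 * M * (`|h| * b) ^+ k.+1.
    move=> kN.
    have E : psum c h N = c k * h ^+ k + \sum_(k.+1 <= j < N) c j * h ^+ j.
      rewrite /psum -(big_mkord xpredT (fun j => c j * h ^+ j)).
      rewrite (big_cat_nat (n := k)) ?(ltnW kN)//= big_nat big1 ?add0r.
        by rewrite big_ltn.
      by move=> j /andP[_ jk]; rewrite IH// mul0r.
    have T : `|\sum_(k.+1 <= j < N) c j * h ^+ j| <= 2 * M * (`|h| * b) ^+ k.+1.
      rewrite (le_trans (ler_norm_sum _ _ _))//.
      apply: (@le_trans _ _ (\sum_(k.+1 <= j < N) M * (`|h| * b) ^+ j)).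
        apply: ler_sum => j _; rewrite normrM normrX exprMn mulrCA [leLHS]mulrC.
        by rewrite ler_wpM2l ?exprn_ge0.
      rewrite -mulr_sumr mulrAC [leRHS]mulrC ler_wpM2l//.
      have t0 : 0 <= `|h| * b by rewrite mulr_ge0// ltW.
      have t2 : `|h| * b <= 2^-1 by rewrite (le_trans yb8)// lef_pV2 ?posrE// ler_nat.
      apply: le_trans (geometric_tail t0 t2 kN); rewrite lerDl.
      by rewrite mulr_ge0// exprn_ge0.
    have := ler_normD (c k * h ^+ k + \sum_(k.+1 <= j < N) c j * h ^+ j) (- \sum_(k.+1 <= j < N) c j * h ^+ j).
    rewrite addrK -E normrN normrM normrX => H.
    by rewrite (le_trans H)// lerD2l.
  have lim : `|c k| * `|h| ^+ k <= 2 * M * (`|h| * b) ^+ k.+1.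
    apply/ler_addgt0Pl => e' e'0.
    have /cvgrPdist_le/(_ _ e'0)[N _ HN] := cy.
    have kN : (k < maxn N k.+1)%N by rewrite leq_max ltnSn orbT.
    have := HN (maxn N k.+1) (leq_maxl _ _); rewrite sub0r normrN => H.
    by rewrite (le_trans (bound _ kN))// lerD2r.
  have hk : 0 < `|h| ^+ k by rewrite exprn_gt0.
  have E : 2 * M * (`|h| * b) ^+ k.+1 = (2 * M * b ^+ k.+1 * `|h|) * `|h| ^+ k.
    by rewrite exprMn [`|h| ^+ k.+1]exprS; ring.
  move: lim; rewrite E ler_pM2r// => /le_trans; apply.
  rewrite (@le_trans _ _ (K * `|h|))//; first by rewrite ler_wpM2r// lerDl.
  by rewrite mulrC -ler_pdivlMr// ltW.
exists (8^-1 / b); first by rewrite divr_gt0.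
move=> y Dy yb; have := cf y Dy; rewrite -ler_pdivlMr// => /(_ yb) H.
have : psum c (y - x) @ \oo --> (0 : R).
  rewrite (_ : psum _ _ = fun=> 0); first exact: cvg_cst.
  by apply/funext => N; rewrite /psum big1// => i _; rewrite c0 mul0r.
by move=> /(cvg_unique _ H); apply.
Qed.

Lemma unit_segment_acc (x : R) : 0 <= x <= 1 ->
  forall e, 0 < e -> exists y, [/\ 0 <= y <= 1, y != x & `|y - x| < e].
Proof.
move=> x01 e e0; pose h := Num.min (e / 2) 2^-1.
have h0 : 0 < h by rewrite lt_min; lra.
have he : h <= e / 2 by rewrite ge_min lexx.
have h2 : h <= 2^-1 by rewrite ge_min lexx orbT.
have [xl|xl] := leP x 2^-1.
  exists (x + h); split; [lra|by rewrite -subr_eq0 addrAC subrr add0r gt_eqF|].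
  by rewrite addrAC subrr add0r gtr0_norm//; lra.
exists (x - h); split; [lra|by rewrite -subr_eq0 addrAC subrr add0r oppr_eq0 gt_eqF|].
by rewrite addrAC subrr add0r normrN gtr0_norm//; lra.
Qed.

(** Continuation along the segment: let s be the largest point up to which [f] vanishes from [l] on.
    Zeros accumulate at s from the left, so [f] vanishes around s, which forces s = 1. *)
Lemma analytic_vanish_end f l r :
  (forall x, 0 <= x <= 1 -> analytic_at [set` `[0, 1]] f x) ->
  0 <= l -> l < r -> r <= 1 -> (forall y, l <= y <= r -> f y = 0) -> f 1 = 0.
Proof.
move=> af l0 lr r1 flr.
pose S : set R := [set x | l <= x <= 1 /\ forall y, l <= y <= x -> f y = 0].
have Sr : S r by split=> //; rewrite (ltW lr).
have ubS : ubound S 1 by move=> x [/andP[]].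
have supS : has_sup S by split; [exists r|exists 1].
pose s := sup S.
have hubS : has_ubound S by exists 1.
have rs : r <= s by exact: ub_le_sup.
have s1 : s <= 1 by apply: ge_sup => //; exists r.
have below y : l <= y -> y < s -> f y = 0.
  move=> ly ys; have sy : 0 < s - y by rewrite subr_gt0.
  have [x [Sx1 Sx2]] := sup_adherent sy supS; rewrite opprB addrC subrK => yx.
  by apply: Sx2; rewrite ly ltW.
have s01 : 0 <= s <= 1.
  by rewrite s1 andbT (le_trans _ rs)// (le_trans l0 (ltW lr)).
have [|e e0 fe] := analytic_at_vanish (af s s01).
- move=> e e0; pose y := Num.max l (s - e / 2).
  have ys : y < s by rewrite gt_max (lt_le_trans lr rs)/=; lra.
  have ly : l <= y by rewrite le_max lexx.
  have ye : s - e / 2 <= y by rewrite le_max lexx orbT.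
  exists y; split.
  + by rewrite /= in_itv/=; move: ly ys l0 s1; lra.
  + by rewrite lt_eqF.
  + by rewrite ltr0_norm ?subr_lt0// opprB; lra.
  + exact: below.
pose s' := Num.min (s + e) 1.
have Ss' : S s'.
  have ls' : l <= s' by rewrite le_min; lra.
  split; first by rewrite ls' ge_min lexx orbT.
  move=> y /andP[ly ys']; have [ys|sy] := ltP y s; first exact: below.
  move: ys'; rewrite le_min => /andP[yse y1]; apply: fe.
    by rewrite /= in_itv/= y1 (le_trans l0).
  by rewrite ger0_norm ?subr_ge0// lerBlDl.
have s's : s' <= s by exact: ub_le_sup.
have s1' : s = 1.
  move: s's; rewrite ge_min => /orP[|]; lra.
apply: fe; first by rewrite /= in_itv/= ler01 lexx.
by rewrite s1' subrr normr0 ltW.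
Qed.

Lemma analytic_det_neq0 d (W : R -> 'M[R]_d) (P : set R) :
  mx_analytic_on [set` `[0, 1]] W -> \det (W 1) != 0 ->
  interior [set l | 0 <= l <= 1 /\ P l] !=set0 ->
  exists l, [/\ 0 <= l <= 1, P l & \det (W l) != 0].
Proof.
move=> aW W1 [l0 [e /= e0 eP]].
apply: contrapT => H.
have Pl y : `|l0 - y| < e -> 0 <= y <= 1 /\ P y by move=> ye; apply: eP.
have dl y : `|l0 - y| < e -> \det (W y) = 0.
  move=> /Pl [y01 Py]; apply/eqP/negPn/negP => dy; apply: H.
  by exists y.
have [l01 _] : 0 <= l0 <= 1 /\ P l0 by apply: Pl; rewrite subrr normr0.
have l1 : 0 <= l0 + e / 2 <= 1.
  have [] // : 0 <= l0 + e / 2 <= 1 /\ P (l0 + e / 2).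
  by apply: Pl; rewrite opprD addrA subrr add0r normrN gtr0_norm; lra.
move/eqP: W1; apply; apply: (analytic_vanish_end (f := fun y => \det (W y)) (l := l0) (r := l0 + e / 2)).
- move=> x x01; apply: analytic_at_det => i j; apply: analytic_onP (aW i j) _ _.
    by rewrite /= in_itv.
  by move=> e' /(unit_segment_acc x01)[y [y01 yx ye]]; exists y; split.
- by case/andP: l01.
- lra.
- by case/andP: l1.
- by move=> y y1; apply: dl; rewrite ler0_norm; lra.
Qed.

(** A vector v with v W' = 0 satisfies v = v (W - W') W^-1, hence |v| <= |v| / 2 once W' is close
    enough to W. *)
Lemma unitmx_open d (W : 'M[R]_d) : W \in unitmx ->
  exists2 e, 0 < e & forall W' : 'M[R]_d, `|W' - W| <= e -> W' \in unitmx.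
Proof.
move=> uW; pose k := d%:R * `|invmx W| * d%:R + 1.
have k0 : 0 < k by rewrite ltr_wpDl// !mulr_ge0.
exists (k^-1 / 2); first by rewrite divr_gt0// invr_gt0.
move=> W' WW'; rewrite unitmxE unitfE; apply/negP => /det0P[v v0 vW'].
have vE : v = v *m (W - W') *m invmx W.
  by rewrite mulmxBr vW' subr0 mulmxK.
have nv : 0 < `|v| by rewrite normr_gt0.
have : `|v| <= (d%:R * `|invmx W| * d%:R) * (k^-1 / 2) * `|v|.
  rewrite {1}vE (le_trans (mx_normM _ _))//.
  apply: (@le_trans _ _ (d%:R * (d%:R * `|v| * (k^-1 / 2)) * `|invmx W|)).
    rewrite ler_wpM2r// ler_wpM2l// (le_trans (mx_normM _ _))//.
    by rewrite ler_wpM2l ?mulr_ge0// distrC.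
  by rewrite le_eqVlt; apply/orP; left; apply/eqP; ring.
rewrite -{1}[`|v|]mul1r ler_pM2r// => H.
have : d%:R * `|invmx W| * d%:R * (k^-1 / 2) <= k * (k^-1 / 2).
  by rewrite ler_wpM2r ?divr_ge0 ?invr_ge0 ?ltW// ltrDl.
have -> : k * (k^-1 / 2) = 2^-1 by rewrite mulrA mulfV ?gt_eqF// mul1r.
by move=> H2; have := le_trans H H2; lra.
Qed.

End Analytic.

(** * Piecewise constant signals with an invertible Gramian *)

Section PiecewiseConstant.
Variable R : realType.

(** Replaces differentiation at 0 from the right: on a short interval [f] stays within half of
    [|f 0|] of [f 0], which a vanishing primitive contradicts unless [f 0] is 0. *)
Lemma prim_eq0_at0 (f : R -> R) : continuous f ->
  (forall t, 0 < t -> prim f t = 0) -> f 0 = 0.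
Proof.
move=> cf f0; apply: contrapT => /eqP fn0.
have e0 : 0 < `|f 0| / 2 by rewrite divr_gt0// normr_gt0.
have /cvgrPdist_le/(_ _ e0) [d /= d0 dP] := cf 0.
have h0 : 0 < d / 2 by rewrite divr_gt0.
have lf : loc_int f by exact/lbm_loc_int/continuous_lbm.
have lc : loc_int (fun=> f 0) by exact/lbm_loc_int/lbm_cst.
have : `|prim (fun s => f 0 - f s) (d / 2)| <= `|f 0| / 2 * (d / 2).
  rewrite -(prim_cst (`|f 0| / 2) (ltW h0)) (le_trans (prim_norm _ _))//.
    by apply: loc_intD => //; exact: loc_intN.
  apply: prim_le.
  - by apply: loc_int_norm; apply: loc_intD => //; exact: loc_intN.
  - exact/lbm_loc_int/lbm_cst.
  - move=> s /andP[s0 sd]; apply: dP; rewrite /= sub0r normrN ger0_norm//.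
    by apply: le_lt_trans sd _; lra.
rewrite primB// f0// subr0 prim_cst ?(ltW h0)// normrM [`|d / 2|]gtr0_norm//.
have : 0 < `|f 0| by rewrite normr_gt0.
by rewrite ler_pM2r//; lra.
Qed.

Lemma ker_qf k (W : 'M[R]_k) x : W^T = W -> (forall x, 0 <= qf W x) ->
  qf W x = 0 -> W *m x = 0.
Proof.
move=> sW pW q0; have [K _ KP] := psd_bound sW pW.
apply: sqn_eq0; apply/eqP; rewrite eq_le sqn_ge0 andbT.
by rewrite (le_trans (KP x))// q0 mulr0.
Qed.

Lemma kermx_rank d (W1 W2 : 'M[R]_d) (v : 'rV[R]_d) :
  (forall u : 'rV_d, u *m W1 = 0 -> u *m W2 = 0) -> (\rank W1 <= \rank W2)%N ->
  v *m W2 = 0 -> v *m W1 = 0.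
Proof.
move=> W12 rW vW2.
have ks : (kermx W1 <= kermx W2)%MS.
  by apply/rV_subP => u /sub_kermxP uW; apply/sub_kermxP; exact: W12.
have [_ E] := mxrank_leqif_sup ks.
apply/sub_kermxP; apply: submx_trans (_ : (kermx W2 <= _)%MS); first exact/sub_kermxP.
by rewrite -E eqn_leq (mxrankS ks) !mxrank_ker leq_sub2l.
Qed.

(** Among the subspaces contained in [P], one of largest dimension contains every [w] in [P], since
    otherwise the line of [w] could be added. *)
Lemma vspace_of_pred d (P : 'cV[R]_d -> Prop) : P 0 ->
  (forall (a : R) u v, P u -> P v -> P (a *: u + v)) ->
  exists W : {vspace 'cV[R]_d}, forall w, w \in W <-> P w.
Proof.
move=> P0 PD.
pose Q k := `[< exists2 W : {vspace 'cV[R]_d}, (forall w, w \in W -> P w) & \dim W = k >].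
have Q0 : exists k, Q k.
  exists 0%N; apply/asboolP; exists 0%VS; rewrite ?dimv0//.
  by move=> w; rewrite memv0 => /eqP ->.
have Qb k : Q k -> (k <= d * 1)%N.
  move=> /asboolP[W _ <-]; have := dimvS (subvf W).
  by rewrite dimvf.
case: (ex_maxnP Q0 Qb) => k /asboolP[W WP Wk] kmax.
exists W => w; split; first exact: WP.
move=> Pw; have : Q (\dim (W + <[w]>)%VS).
  apply/asboolP; exists (W + <[w]>)%VS => // z /memv_addP[u uW [v /vlineP[a ->] ->]].
  by rewrite addrC; apply: PD => //; exact: WP.
move=> /kmax; rewrite -Wk => dW.
have E : W == (W + <[w]>)%VS by rewrite eqEdim addvSl.
by rewrite (eqP E) memvE addvSr.
Qed.

Section GoodSignals.
Variables (X : Type) (M : set X) (d p : nat) (c : R).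
Variables (al : X -> 'M[R]_d) (ga : X -> 'M[R]_(p, d)).
Hypothesis bal : forall x, M x -> `|al x| <= c.
Hypothesis bga : forall x, M x -> `|ga x| <= c.

(** Values and measurability are required on the whole line, which makes [sol] available and is
    stable under concatenation. The maps [al] and [ga] are abstract because the section serves
    twice: with (A, C), and with (- A^T, B^T) for controllability. *)
Definition good_sig (t : R) (a : R -> X) : Prop :=
  [/\ 0 < t, sig_pc M t a, forall s, M (a s),
      forall i j, measurable_fun setT (fun s => al (a s) i j) &
      forall i j, measurable_fun setT (fun s => ga (a s) i j)].

Definition gram (a : R -> X) : R -> 'M[R]_d :=
  og (fun s => al (a s)) (fun s => ga (a s)).

Lemma good_al t a : good_sig t a -> bsig c (fun s => al (a s)).
Proof. by move=> [_ _ Ma mA _]; split=> // s; exact: bal. Qed.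

Lemma good_ga t a : good_sig t a -> bsig c (fun s => ga (a s)).
Proof. by move=> [_ _ Ma _ mC]; split=> // s; exact: bga. Qed.

Lemma good_cst t x : 0 < t -> M x -> good_sig t (fun=> x).
Proof.
move=> t0 Mx; split => //; try by move=> i j; exact: measurable_cst.
by split=> //; exists set0.
Qed.

Lemma measurable_concat (f : X -> R) s (a b : R -> X) :
  measurable_fun setT (fun r => f (a r)) -> measurable_fun setT (fun r => f (b r)) ->
  measurable_fun setT (fun r => f (concat s a b r)).
Proof.
move=> ma mb.
have -> : (fun r => f (concat s a b r)) = (fun r => if r <= s then f (a r) else f (b (r - s))).
  by apply/funext => r; rewrite /concat; case: ifP.
apply: measurable_fun_ifT => //.
  by apply: measurable_fun_ler => //; exact: measurable_cst.
have : measurable_fun setT ((fun r => f (b r)) \o (fun r => r - s)).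
  by apply: measurableT_comp => //; exact: measurable_funB.
exact.
Qed.

Lemma good_concat s t a b : good_sig s a -> good_sig t b ->
  good_sig (s + t) (concat s a b).
Proof.
move=> [s0 [aM [E fE aE]] Ma ma1 ma2] [t0 [bM [F fF bF]] Mb mb1 mb2].
have Mc r : M (concat s a b r) by rewrite /concat; case: ifP.
split=> //; first exact: addr_gt0.
- split; first by move=> r _.
  exists (E `|` ((fun r => s + r) @` F) `|` [set s]).
    by rewrite !finite_setU; split; [split=> //; exact: finite_image|exact: finite_set1].
  move=> s1 s2 s10 s12 s2t avoid; rewrite /concat.
  have [s2s|ss2] := leP s2 s.
    rewrite (le_trans s12 s2s); apply: aE => // r rI Er.
    by apply: (avoid r rI); left; left.
  have [s1s|ss1] := leP s1 s.
    exfalso; apply: (avoid s); last by right.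
    by rewrite s1s ltW.
  apply: bF; rewrite ?subr_ge0 ?lerD2r ?(ltW ss1)//; first by rewrite lerBlDl.
  move=> r rI Fr; apply: (avoid (s + r)); first by lra.
  by left; right; exists r.
- by move=> i j; exact: (measurable_concat (f := fun x => al x i j)).
- by move=> i j; exact: (measurable_concat (f := fun x => ga x i j)).
Qed.

Lemma gram_concat s t a b : good_sig s a -> good_sig t b ->
  gram (concat s a b) (s + t) = gram a s +
    (sol (fun s => al (a s)) s)^T *m gram b t *m sol (fun s => al (a s)) s.
Proof.
move=> ga' gb; have gc := good_concat ga' gb.
have [s0 _ _ _ _] := ga'; have [t0 _ _ _ _] := gb.
have A1 := good_al gc; have A2 := good_ga gc.
have pre r : 0 < r <= s -> concat s a b r = a r.
  by rewrite /concat => /andP[_ ->].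
have post r : 0 < r <= t -> concat s a b (s + r) = b r.
  by move=> /andP[r0 _]; rewrite /concat gerDl leNgt r0/= addrAC subrr add0r.
have E1 : og (fun r => al (concat s a b r)) (fun r => ga (concat s a b r)) s = gram a s.
  by apply: (og_ext A1 A2 (good_al ga') (good_ga ga')) => r /pre ->.
have E2 : sol (fun r => al (concat s a b r)) s = sol (fun r => al (a r)) s.
  by apply: (sol_ext A1 (good_al ga') (T := s)) => [r /pre ->//|]; rewrite lexx ltW.
have E3 : og (Defs.shift s (fun r => al (concat s a b r)))
    (Defs.shift s (fun r => ga (concat s a b r))) t = gram b t.
  by apply: (og_ext (bsig_shift s A1) (bsig_shift s A2) (good_al gb) (good_ga gb)) => r /post E;
    rewrite /Defs.shift E.
have := og_cat A1 A2 (ltW s0) (ltW t0).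
by rewrite E1 E2 E3.
Qed.

Lemma gram_sym t a : (gram a t)^T = gram a t.
Proof. exact: og_sym. Qed.

Lemma gram_ge0 t a x : good_sig t a -> 0 <= qf (gram a t) x.
Proof. by move=> g; exact: (qf_og_ge0 (good_al g) (good_ga g)). Qed.

(** The Gramian of a concatenation is a sum of two positive semidefinite terms, so a vector in its
    kernel annihilates both. *)
Lemma ker_gram_concat s t a b (x : 'cV[R]_d) : good_sig s a -> good_sig t b ->
  gram (concat s a b) (s + t) *m x = 0 ->
  gram a s *m x = 0 /\ gram b t *m (sol (fun s => al (a s)) s *m x) = 0.
Proof.
move=> gga ggb; rewrite gram_concat// => k0.
have : qf (gram a s + (sol (fun s => al (a s)) s)^T *m gram b t *m sol (fun s => al (a s)) s) x = 0.
  by rewrite /qf -mulmxA k0 mulmx0 mxE.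
rewrite qfD qfE => /eqP; rewrite paddr_eq0 ?gram_ge0// => /andP[/eqP q1 /eqP q2].
split; apply: ker_qf => //; try exact: gram_sym; move=> y; exact: gram_ge0.
Qed.

Hypothesis unobs : forall W : {vspace 'cV[R]_d},
  (forall x, M x -> (forall w, w \in W -> ga x *m w = 0) /\
                    (forall w, w \in W -> al x *m w \in W)) ->
  forall w, w \in W -> w = 0.

(** States that no piecewise constant signal detects. They turn out to form an invariant subspace on
    which every [ga x] vanishes, hence to be 0. *)
Definition invisible (y : 'cV[R]_d) : Prop :=
  forall t a, good_sig t a -> gram a t *m y = 0.

Lemma invisible_ga x y : M x -> invisible y -> ga x *m y = 0.
Proof.
move=> Mx iy; apply: sqn_eq0.
have g1 := good_cst ltr01 Mx.
pose f s := sqn (ga x *m sol (fun=> al x) s *m y).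
have <- : f 0 = sqn (ga x *m y) by rewrite /f (sol0 (good_al g1)) mulmx1.
apply: prim_eq0_at0.
  move=> s; rewrite /f /sqn; apply: cvg_big => [|i _]; first exact: add_continuous.
  have cm : mcont (fun s => ga x *m sol (fun=> al x) s *m y).
    apply: mcontM; last exact: mcont_cst.
    by apply: mcontM; [exact: mcont_cst|exact: sol_cont (good_al g1)].
  by apply: cvgM; exact: cm.
move=> t t0; have gt := good_cst t0 Mx.
by rewrite -(qf_og (good_al gt) (good_ga gt)) /qf -mulmxA (iy _ _ gt) mulmx0 mxE.
Qed.

(** Follow the constant signal [x] for a time s, then [b]: the Gramian of [b] kills both [y] and the
    state reached at s, hence their difference, the integral of [al x] along the motion. The
    integrand therefore vanishes at time 0. *)
Lemma invisible_al x y : M x -> invisible y -> invisible (al x *m y).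
Proof.
move=> Mx iy t b gb; apply/matrixP => i j; rewrite [RHS]mxE.
have g1 := good_cst ltr01 Mx.
have cm : mcont (fun s => gram b t *m (al x *m (sol (fun=> al x) s *m y))).
  apply: mcontM; first exact: mcont_cst.
  apply: mcontM; first exact: mcont_cst.
  by apply: mcontM; [exact: sol_cont (good_al g1)|exact: mcont_cst].
have -> : (gram b t *m (al x *m y)) i j =
    (gram b t *m (al x *m (sol (fun=> al x) 0 *m y))) i j.
  by rewrite (sol0 (good_al g1)) mul1mx.
apply: (prim_eq0_at0 (f := fun s => (gram b t *m (al x *m (sol (fun=> al x) s *m y))) i j)).
  exact: cm.
move=> s s0; have gs := good_cst s0 Mx.
have bx : bsig c (fun=> al x) := good_al gs.
have jx : mloc (fun r => al x *m (sol (fun=> al x) r *m y)).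
  apply: mlbm_mloc; apply: mlbmM; first exact: mlbm_cst.
  by apply: mlbmM; [exact: sol_mlbm bx|exact: mlbm_cst].
have E : sol (fun=> al x) s *m y = y + mprim (fun r => al x *m (sol (fun=> al x) r *m y)) s.
  rewrite {1}(solE bx) mulmxDl mul1mx; congr (_ + _).
  rewrite -mprim_mulr; last exact: sol_mloc bx.
  by congr mprim; apply/funext => r; rewrite mulmxA.
have [_ H] := ker_gram_concat gs gb (iy _ _ (good_concat gs gb)).
have {H} : gram b t *m (y + mprim (fun r => al x *m (sol (fun=> al x) r *m y)) s) = 0.
  by rewrite -E.
rewrite mulmxDr [X in X + _](iy _ _ gb) add0r -mprim_mull//.
by move=> /matrixP/(_ i j); rewrite !mxE.
Qed.

Lemma invisible_eq0 y : invisible y -> y = 0.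
Proof.
move=> iy.
have [W WP] : exists W : {vspace 'cV[R]_d}, forall w, w \in W <-> invisible w.
  apply: vspace_of_pred; first by move=> t a _; rewrite mulmx0.
  move=> a u v iu iv t b g.
  by rewrite mulmxDr -scalemxAr iu// iv// scaler0 addr0.
apply: (unobs (W := W)); last exact/WP.
by move=> x Mx; split=> w /WP iw; [exact: invisible_ga|apply/WP; exact: invisible_al].
Qed.

(* The kernel of a Gramian of largest rank is contained in the kernels of all
   the others, since concatenation can only shrink kernels. *)
Lemma exists_good_gram : M !=set0 ->
  exists t a, good_sig t a /\ gram a t \in unitmx.
Proof.
move=> [x0 Mx0].
pose Q k := `[< exists t a, good_sig t a /\ \rank (gram a t) = k >].
have Q0 : exists k, Q k.
  exists (\rank (gram (fun=> x0) 1)); apply/asboolP; exists 1, (fun=> x0).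
  by split=> //; exact: good_cst.
have Qb k : Q k -> (k <= d)%N.
  by move=> /asboolP[t [a [_ <-]]]; exact: rank_leq_row.
case: (ex_maxnP Q0 Qb) => k /asboolP[t [a [g rk]]] kmax.
exists t, a; split=> //.
rewrite unitmxE unitfE; apply/negP => /det0P[v v0 vW].
have av : gram a t *m v^T = 0.
  by apply: trmx_inj; rewrite trmx_mul gram_sym trmxK vW trmx0.
(* Appending [b] can only shrink the kernel, while the rank cannot exceed the maximum; the kernel is
   therefore unchanged and still contains [v], so [b] does not see the state reached from [v]. *)
have inv : invisible (sol (fun s => al (a s)) t *m v^T).
  move=> s b gb; have gc := good_concat g gb.
  have rk2 : (\rank (gram (concat t a b) (t + s)) <= \rank (gram a t))%N.
    apply: leq_trans (eq_leq (esym rk)).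
    by apply: kmax; apply/asboolP; exists (t + s), (concat t a b).
  have ks (u : 'rV[R]_d) : u *m gram (concat t a b) (t + s) = 0 -> u *m gram a t = 0.
    move=> uW.
    have [H _] : gram a t *m u^T = 0 /\ gram b s *m (sol (fun s => al (a s)) t *m u^T) = 0.
      apply: ker_gram_concat => //.
      by apply: trmx_inj; rewrite trmx_mul gram_sym trmxK uW trmx0.
    by apply: trmx_inj; rewrite trmx_mul gram_sym H trmx0.
  have vc : v *m gram (concat t a b) (t + s) = 0 := kermx_rank ks rk2 vW.
  have kc : gram (concat t a b) (t + s) *m v^T = 0.
    by apply: trmx_inj; rewrite trmx_mul gram_sym trmxK vc trmx0.
  exact: (ker_gram_concat g gb kc).2.
have := invisible_eq0 inv => sv0.
move/eqP: v0; apply; apply: trmx_inj; rewrite trmx0.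
by rewrite -[v^T](mulKmx (sol_unit (good_al g) t)) sv0 mulmx0.
Qed.

End GoodSignals.
End PiecewiseConstant.

(** * Minimal realizations *)

Section MinimalRealization.
Variable R : realType.

Lemma col_spanP n (P : 'M[R]_n) (c : pred 'I_n) (x : 'cV[R]_n) : P \in unitmx ->
  x \in col_span P c <-> forall j, ~~ c j -> (invmx P *m x) j 0 = 0.
Proof.
move=> uP; split.
  have [W WP] : exists W : {vspace 'cV[R]_n}, forall w, w \in W <->
      (forall j, ~~ c j -> (invmx P *m w) j 0 = 0).
    apply: vspace_of_pred; first by move=> j _; rewrite mulmx0 mxE.
    move=> a u v u0 v0 j cj.
    by rewrite mulmxDr -scalemxAr [LHS]mxE [X in X + _]mxE u0// v0// mulr0 addr0.
  have cW : (col_span P c <= W)%VS.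
    apply/span_subvP => w /mapP[i].
    rewrite mem_filter => /andP[ci _] ->; apply/WP => j cj.
    rewrite colE mulmxA mulVmx// mul1mx !mxE andbT.
    by case: eqP => // ij; rewrite ij ci in cj.
  by move=> /(subvP cW)/WP.
move=> x0.
have -> : x = \sum_j (invmx P *m x) j 0 *: col j P.
  rewrite -{1}[x](mulKVmx uP); apply/colP => i; rewrite summxE mxE.
  by apply: eq_bigr => j _; rewrite !mxE mulrC.
apply: memv_suml => j _; have [cj|cj] := boolP (c j).
  apply/memvZ/memv_span/map_f.
  by rewrite mem_filter cj mem_enum.
by rewrite x0// scale0r mem0v.
Qed.

Lemma pid_mul n r (y : 'cV[R]_n) i :
  ((pid_mx r : 'M[R]_n) *m y) i 0 = if (i < r)%N then y i 0 else 0.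
Proof.
rewrite mxE (bigD1 i)//= big1 ?addr0; last first.
  move=> j ji; rewrite mxE; case: eqP => [/val_inj ij|_]; last by rewrite mul0r.
  by rewrite ij eqxx in ji.
by rewrite mxE eqxx/=; case: ifP => _; rewrite ?mul1r ?mul0r.
Qed.

Section Facts.
Variables (n m p r n' : nat) (M : set (triple R n m p)).
Variables (P : 'M[R]_n) (Q : 'M[R]_r).
Hypothesis PQ : minimal_realization n' M P Q.

(** [L1] and [L2] take coordinates in the bases [P] and [Q] and truncate them; [S1] and [S2] are
    their right inverses. *)
Let L1 : 'M[R]_(r, n) := pid_mx r *m invmx P.
Let S1 : 'M[R]_(n, r) := P *m (pid_mx r : 'M[R]_(r, n))^T.
Let L2 : 'M[R]_(n', r) := pid_mx n' *m invmx Q.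
Let S2 : 'M[R]_(r, n') := Q *m (pid_mx n' : 'M[R]_(n', r))^T.

(* [min_proj] maps a state to that of the minimal realization; the kernel of
   [unreach] is the reachable space. *)
Definition min_proj : 'M[R]_(n', n) := L2 *m L1.
Definition unreach : 'M[R]_n := 1%:M - S1 *m L1.

Lemma min_mapE (s : triple R n m p) : min_map n' P Q s =
  (min_proj *m mxA s *m (S1 *m S2), min_proj *m mxB s, mxC s *m (S1 *m S2)).
Proof.
by rewrite /min_map /reduce /min_proj /mxA /mxB /mxC/= /L1 /L2 /S1 /S2 !mulmxA.
Qed.

(** The first two facts keep the unreachable component of a trajectory from the origin at 0, the
    third carries states and outputs to the minimal realization, and the last two feed the
    construction of invertible Gramians. *)
Lemma min_real_facts : [/\
  forall s, M s -> unreach *m mxB s = 0,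
  forall s, M s -> unreach *m mxA s = unreach *m mxA s *m unreach,
  forall s (x : 'cV[R]_n), M s -> unreach *m x = 0 ->
    min_proj *m (mxA s *m x) = mxA (min_map n' P Q s) *m (min_proj *m x) /\
    mxC s *m x = mxC (min_map n' P Q s) *m (min_proj *m x),
  forall W : {vspace 'cV[R]_n'}, contains_reachable (min_map n' P Q @` M) W ->
    forall w, w \in W &
  forall W : {vspace 'cV[R]_n'}, within_unobservable (min_map n' P Q @` M) W ->
    forall w, w \in W -> w = 0].
Proof.
have [[V [[Vc Vmin] rV uP PV]] [N [[Nw Nmax] n'E uQ QN]]] := PQ.
have rn : (r <= n)%N.
  by rewrite rV; have := dimvS (subvf V); rewrite dimvf -[X in (_ <= X)%N]/(n * 1)%N muln1.
have n'r : (n' <= r)%N by rewrite n'E leq_subr.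
have LS1 : L1 *m S1 = 1%:M.
  rewrite /L1 /S1 mulmxA -(mulmxA _ _ P) mulVmx// mulmx1 tr_pid_mx mul_pid_mx.
  by rewrite minnn (minn_idPr rn) pid_mx_1.
have LS2 : L2 *m S2 = 1%:M.
  rewrite /L2 /S2 mulmxA -(mulmxA _ _ Q) mulVmx// mulmx1 tr_pid_mx mul_pid_mx.
  by rewrite minnn (minn_idPr n'r) pid_mx_1.
have SL1 x : S1 *m (L1 *m x) = P *m ((pid_mx r : 'M[R]_n) *m (invmx P *m x)).
  rewrite /S1 /L1 !mulmxA -(mulmxA P) tr_pid_mx mul_pid_mx.
  by rewrite !minnn.
have VP x : x \in V <-> S1 *m (L1 *m x) = x.
  rewrite -PV col_spanP//; split=> [x0|xE j jr].
    rewrite SL1 -[RHS](mulKVmx uP); congr (_ *m _); apply/colP => i.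
    by rewrite pid_mul; case: ifPn => // ir; rewrite x0.
  by rewrite -xE SL1 mulKmx// pid_mul (negbTE jr).
have NP x : x \in N <-> L2 *m x = 0.
  have L2E (i : 'I_n') : (L2 *m x) i 0 = (invmx Q *m x) (widen_ord n'r i) 0.
    rewrite /L2 -mulmxA mxE (bigD1 (widen_ord n'r i))//= big1 ?addr0; last first.
      move=> j ji; rewrite mxE; case: eqP => [ij|_]; last by rewrite mul0r.
      by move/eqP: ji; case; apply: val_inj; rewrite /= ij.
    by rewrite mxE eqxx ltn_ord mul1r.
  rewrite -QN col_spanP//; split=> [x0|xE j jr].
    apply/colP => i; rewrite L2E [RHS]mxE; apply: x0.
    by rewrite -ltnNge/=.
  rewrite -ltnNge in jr; have := L2E (Ordinal jr); rewrite xE mxE => ->.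
  by congr (_ _ _); apply: val_inj.
have KP x : unreach *m x = 0 <-> x \in V.
  rewrite VP /unreach mulmxBl mul1mx -mulmxA; split=> [/eqP|->].
    by rewrite subr_eq0 => /eqP <-.
  by rewrite subrr.
have S1V y : S1 *m y \in V by apply/VP; rewrite (mulmxA L1) LS1 mul1mx.
have zero_mx k l (X : 'M[R]_(k, l)) : (forall v : 'cV_l, X *m v = 0) -> X = 0.
  move=> X0; apply/matrixP => i j.
  have /colP/(_ i) := X0 (delta_mx j 0).
  by rewrite -colE mxE => ->; rewrite !mxE.
have F3 s x : M s -> x \in V ->
    min_proj *m (mxA s *m x) = mxA (min_map n' P Q s) *m (min_proj *m x) /\
    mxC s *m x = mxC (min_map n' P Q s) *m (min_proj *m x).
  move=> Ms xV; have /VP xE := xV.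
  have sM : (reduce r P @` M) (reduce r P s) by exists s.
  have [C0 A0] := Nw _ sM.
  (* [y] differs from [S2 (L2 y)] by a vector of N, on which the reduced C vanishes and which the
     reduced A keeps in N, the kernel of [L2]. *)
  set y := L1 *m x in xE.
  have kN : y - S2 *m (L2 *m y) \in N.
    by apply/NP; rewrite mulmxBr (mulmxA L2 S2) LS2 mul1mx subrr.
  rewrite min_mapE /mxA /mxC/= -/(mxA s) -/(mxC s) /min_proj -!mulmxA -/y.
  have /NP := A0 _ kN; rewrite mulmxBr mulmxBr => /eqP; rewrite subr_eq0 => /eqP Ay.
  have /eqP := C0 _ kN; rewrite mulmxBr subr_eq0 => /eqP Cy.
  split; rewrite -{1}xE.
    by move: Ay; rewrite /reduce /mxA/= /y /L1 /L2 /S1 /S2 -!mulmxA.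
  by move: Cy; rewrite /reduce /mxC/= /y /L1 /L2 /S1 /S2 -!mulmxA.
split.
- by move=> s Ms; apply: zero_mx => v; rewrite -mulmxA; apply/KP; exact: (Vc s Ms).1.
- move=> s Ms; rewrite {3}/unreach mulmxBr mulmx1.
  rewrite [X in _ - X](_ : _ = 0) ?subr0//.
  apply: zero_mx => v.
  rewrite -(mulmxA (unreach *m mxA s)) -(mulmxA unreach) -(mulmxA S1); apply/KP.
  by apply: (Vc s Ms).2; exact: S1V.
- by move=> s x Ms /KP xV; exact: F3.
- move=> W WM w.
  (* The part of V which [min_proj] sends into W contains the ranges of all B and is invariant, so
     minimality makes it all of V, whose image is the whole space. *)
  have [W2 W2P] : exists W2 : {vspace 'cV[R]_n}, forall x, x \in W2 <->
      (x \in V /\ min_proj *m x \in W).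
    apply: vspace_of_pred; first by rewrite mulmx0 !mem0v.
    move=> a u v [uV uW] [vV vW]; split; first by rewrite memvD ?memvZ.
    by rewrite mulmxDr -scalemxAr memvD ?memvZ.
  have VW2 : (V <= W2)%VS.
    apply: Vmin => s Ms.
    have sM : (min_map n' P Q @` M) (min_map n' P Q s) by exists s.
    have [BW AW] := WM _ sM; split=> [v|x].
      apply/W2P; split; first exact: (Vc s Ms).1.
      by have := BW v; rewrite min_mapE /mxB/= mulmxA.
    move=> /W2P[xV xW]; apply/W2P; split; first exact: (Vc s Ms).2.
    by rewrite (F3 s x Ms xV).1; exact: AW.
  have /W2P[_] : S1 *m (S2 *m w) \in W2 by apply: (subvP VW2); exact: S1V.
  by rewrite /min_proj -(mulmxA L2 L1) (mulmxA L1 S1) LS1 mul1mx (mulmxA L2 S2) LS2 mul1mx.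
- move=> W WM w wW.
  (* The preimage of W under [L2] is invariant and unobservable, so it lies in N, where [L2]
     vanishes. *)
  have [W1 W1P] : exists W1 : {vspace 'cV[R]_r}, forall x, x \in W1 <-> L2 *m x \in W.
    apply: vspace_of_pred; first by rewrite mulmx0 mem0v.
    by move=> a u v uW vW; rewrite mulmxDr -scalemxAr memvD ?memvZ.
  have W1N : (W1 <= N)%VS.
    apply: Nmax => _ [s Ms <-].
    have sM : (min_map n' P Q @` M) (min_map n' P Q s) by exists s.
    have [CW AW] := WM _ sM.
    have H x : min_proj *m (S1 *m x) = L2 *m x.
      by rewrite /min_proj -(mulmxA L2 L1) (mulmxA L1 S1) LS1 mul1mx.
    split=> x /W1P xW.
      have [_] := F3 s _ Ms (S1V x); rewrite H CW// /reduce /mxC/= /S1 !mulmxA.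
      by move=> ->.
    apply/W1P; have [+ _] := F3 s _ Ms (S1V x); rewrite H => E.
    have -> : L2 *m (mxA (reduce r P s) *m x) = min_proj *m (mxA s *m (S1 *m x)).
      by rewrite /reduce /mxA/= /min_proj /L1 /S1 !mulmxA.
    by rewrite E; exact: AW.
  have : S2 *m w \in W1 by apply/W1P; rewrite (mulmxA L2 S2) LS2 mul1mx.
  by move=> /(subvP W1N)/NP; rewrite (mulmxA L2 S2) LS2 mul1mx.
Qed.

End Facts.
End MinimalRealization.

(** * Bounded measurable signals on the whole line *)

Section SignalExtension.
Variable R : realType.

(* Extension by 0 off the domain, measurable on the whole line. *)
Definition restrict_sig n m p (D : set R) (a : R -> triple R n m p) (s : R) : triple R n m p :=
  if s \in D then a s else (0, 0, 0).

Lemma restrict_sigE n m p (D : set R) (a : R -> triple R n m p) s :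
  D s -> restrict_sig D a s = a s.
Proof. by move=> Ds; rewrite /restrict_sig mem_set. Qed.

Lemma restrict_sig_bsig n m p k l (D : set R) (a : R -> triple R n m p) c
    (f : triple R n m p -> 'M[R]_(k, l)) : 0 <= c -> measurable D -> f (0, 0, 0) = 0 ->
  mx_measurable D (fun s => f (a s)) -> (forall s, D s -> `|f (a s)| <= c) ->
  bsig c (fun s => f (restrict_sig D a s)).
Proof.
move=> c0 mD f0 mf bf; split=> [i j|s]; last first.
  rewrite /restrict_sig; case: ifPn => [|_]; last by rewrite f0 normr0.
  by rewrite inE; exact: bf.
have -> : (fun s => f (restrict_sig D a s) i j) = (fun s => f (a s) i j) \_ D.
  by apply/funext => s; rewrite /restrict_sig patchE; case: ifP => //; rewrite f0 mxE.
exact/(measurable_restrictT _ _).1.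
Qed.

Lemma restrict_tsig n m p (M : set (triple R n m p)) (D : set R) (a : R -> triple R n m p) c :
  0 <= c -> (forall s, M s -> [/\ `|mxA s| <= c, `|mxB s| <= c & `|mxC s| <= c]) ->
  measurable D -> Linfty_triple D M a -> tsig c (restrict_sig D a).
Proof.
move=> c0 Mc mD [Ma [mA mB mC] _].
have Ma' s : D s -> M (a s) by move=> Ds; apply: Ma; rewrite inE.
by split; [apply: (restrict_sig_bsig (f := @mxA R n m p))|
  apply: (restrict_sig_bsig (f := @mxB R n m p))|
  apply: (restrict_sig_bsig (f := @mxC R n m p))] => // s /Ma'/Mc[].
Qed.

Lemma bsig_le k l c c' (A : R -> 'M[R]_(k, l)) : c <= c' -> bsig c A -> bsig c' A.
Proof. by move=> cc [mA bA]; split=> // s; rewrite (le_trans (bA s)). Qed.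

Lemma bsig_mull k l q c (L : 'M[R]_(k, l)) (A : R -> 'M[R]_(l, q)) : bsig c A ->
  bsig (l%:R * `|L| * c) (fun s => L *m A s).
Proof.
move=> bA; have lA := mlbmM (@mlbm_cst _ _ _ L) (bsig_mlbm bA).
split=> [i j|s]; first exact: (lA i j).1.
by rewrite (le_trans (mx_normM _ _))// ler_wpM2l ?mulr_ge0//; exact: bA.2.
Qed.

Lemma bsig_mulr k l q c (A : R -> 'M[R]_(k, l)) (L : 'M[R]_(l, q)) : bsig c A ->
  bsig (l%:R * c * `|L|) (fun s => A s *m L).
Proof.
move=> bA; have lA := mlbmM (bsig_mlbm bA) (@mlbm_cst _ _ _ L).
split=> [i j|s]; first exact: (lA i j).1.
by rewrite (le_trans (mx_normM _ _))// ler_wpM2r// ler_wpM2l//; exact: bA.2.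
Qed.

Lemma tsig_min n m p r n' (P : 'M[R]_n) (Q : 'M[R]_r) c :
  exists c', forall a : R -> triple R n m p, tsig c a ->
    tsig c' (fun s => min_map n' P Q (a s)).
Proof.
pose L := min_proj n' P Q.
pose S := (P *m (pid_mx r : 'M[R]_(r, n))^T) *m (Q *m (pid_mx n' : 'M[R]_(n', r))^T).
pose c1 := n%:R * (n%:R * `|L| * c) * `|S|; pose c2 := n%:R * `|L| * c.
pose c3 := n%:R * c * `|S|.
exists (Num.max c1 (Num.max c2 c3)) => a [bA bB bC].
have E s := min_mapE n' P Q (a s).
split.
- apply: (bsig_le _ (_ : bsig c1 _)); first by rewrite le_max lexx.
  under eq_fun do rewrite E.
  exact: bsig_mulr (bsig_mull _ bA).
- apply: (bsig_le _ (_ : bsig c2 _)); first by rewrite !le_max lexx orbT.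
  under eq_fun do rewrite E.
  exact: bsig_mull bB.
- apply: (bsig_le _ (_ : bsig c3 _)); first by rewrite !le_max lexx !orbT.
  under eq_fun do rewrite E.
  exact: bsig_mulr bC.
Qed.

End SignalExtension.

(** * Trajectories and outputs of the minimal realization *)

Section MinimalTrajectory.
Variable R : realType.
Variables (n m p r n' : nat) (M : set (triple R n m p)).
Variables (P : 'M[R]_n) (Q : 'M[R]_r).
Hypothesis PQ : minimal_realization n' M P Q.
Variables (c c' : R) (a : R -> triple R n m p).
Hypothesis ba : tsig c a.
Hypothesis bam : tsig c' (fun s => min_map n' P Q (a s)).
Hypothesis Ma : forall s, 0 <= s -> M (a s).
Variable u : R -> 'cV[R]_m.
Hypothesis ju : mloc u.

Let A s := mxA (a s).
Let B s := mxB (a s).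
Let A' s := mxA (min_map n' P Q (a s)).
Let B' s := mxB (min_map n' P Q (a s)).
Let L := min_proj n' P Q.
Let K := unreach r P.

Lemma min_vconst t : 0 <= t ->
  L *m vconst A B u t = vconst A' B' u t /\
  mxC (a t) *m vconst A B u t = mxC (min_map n' P Q (a t)) *m vconst A' B' u t.
Proof.
have [bA bB _] := ba; have [bA' bB' _] := bam.
have [KB KA LAC _ _] := min_real_facts PQ.
pose X := vconst A B u.
have cX : mcont X := vconst_cont bA bB ju.
have jF : mloc (fun s => A s *m X s + B s *m u s).
  apply: mlocD; last by apply: mlocM => //; exact: bsig_mlbm bB.
  by apply: mlocM; [exact: bsig_mlbm bA|exact/mlbm_mloc/mcont_mlbm].
have XE s : X s = mprim (fun s => A s *m X s + B s *m u s) s := vconstE bA bB ju s.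
(* From K B = 0 and K A = K A K, the function K X solves the homogeneous equation with matrix K A,
   with initial value 0. *)
have KX s : 0 <= s -> K *m X s = 0.
  move=> s0.
  have bKA := bsig_mull K bA.
  apply: (sol_unique_hom (Z := fun s => K *m X s) (T := s) bKA).
  - by apply: mlbmM; [exact: mlbm_cst|exact: mcont_mlbm].
  - move=> q /andP[q0 qs]; rewrite {1}XE -mprim_mull//.
    apply: eq_mprim => v /andP[v0 vq].
    have Mv := Ma v0; rewrite mulmxDr (mulmxA K (B v)) KB// mul0mx addr0.
    have E := KA _ Mv; rewrite -/K in E.
    by rewrite (mulmxA K (A v)) {1}E -(mulmxA (K *m mxA (a v))).
  - by rewrite s0 lexx.
move=> t0.
have LX : L *m X t = vconst A' B' u t.
  have cLX : mcont (fun s => L *m X s) by apply: mcontM => //; exact: mcont_cst.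
  apply: (vconst_unique bA' bB' ju (x := fun s => L *m X s) (T := t)).
  - exact: mcont_within.
  - move=> s /andP[s0 st]; rewrite mx_oint0// {1}XE -mprim_mull//.
    apply: eq_mprim => v /andP[v0 vs].
    have Mv := Ma v0; rewrite mulmxDr; congr (_ + _).
      exact: (LAC _ _ Mv (KX v v0)).1.
    by rewrite mulmxA /L /B /B' (min_mapE n' P Q (a v)).
  - by rewrite t0 lexx.
split=> //; rewrite -LX.
exact: (LAC _ _ (Ma t0) (KX t t0)).2.
Qed.

End MinimalTrajectory.

(** * Energies and gain *)

Section Energy.
Variable R : realType.
Notation mu := (@lebesgue_measure R).

Definition energy k (u : R -> 'cV[R]_k) : \bar R :=
  (\int[mu]_(t in @halfline R) (sqn (u t))%:E)%E.

Lemma L2normE k (u : R -> 'cV[R]_k) : L2norm u = (energy u `^ 2^-1)%E.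
Proof. by []. Qed.

Lemma energy_ge0 k (u : R -> 'cV[R]_k) : (0 <= energy u)%E.
Proof. by apply: integral_ge0 => t _; rewrite lee_fin sqn_ge0. Qed.

Lemma measurable_halfline : measurable (@halfline R).
Proof. exact: measurable_itv. Qed.

Lemma measurable_sqn k (D : set R) (u : R -> 'cV[R]_k) : mx_measurable D u ->
  measurable_fun D (fun t => sqn (u t)).
Proof.
move=> mu'; rewrite /sqn; apply: measurable_sum => i.
by under eq_fun do rewrite expr2; apply: measurable_funM; exact: mu'.
Qed.

Lemma energy_lb k (u : R -> 'cV[R]_k) (D : set R) : measurable D -> D `<=` @halfline R ->
  mx_measurable (@halfline R) u -> (\int[mu]_(t in D) (sqn (u t))%:E <= energy u)%E.
Proof.
move=> mD Dh mu'; apply: ge0_subset_integral => //.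
- exact: measurable_halfline.
- by apply/measurable_EFinP; exact: measurable_sqn.
- by move=> t _; rewrite lee_fin sqn_ge0.
Qed.

Lemma energy_ub k (u : R -> 'cV[R]_k) K : mx_measurable (@halfline R) u ->
  (forall t : R, 0 <= t -> (\int[mu]_(s in `[0%R, t]) (sqn (u s))%:E <= K)%E) ->
  (energy u <= K)%E.
Proof.
move=> mu' uK; pose F (i : nat) : set R := [set` `[0, i%:R]].
have FE : \bigcup_i F i = @halfline R.
  apply/seteqP; split => x /=.
    by move=> [i _]; rewrite /F /halfline /= !in_itv/= andbT => /andP[].
  rewrite /halfline /= in_itv/= andbT => x0; exists (Num.truncn x).+1 => //.
  by rewrite /F/= in_itv/= x0 ltW// truncnS_gt.
have ndF : nondecreasing_seq F.
  move=> i j ij; apply/subsetPset => x; rewrite /F/= !in_itv/= => /andP[-> xi].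
  by rewrite (le_trans xi)// ler_nat.
have H : (fun i => \int[mu]_(t in F i) (sqn (u t))%:E)%E @ \oo --> energy u.
  rewrite /energy -FE; apply: ge0_nondecreasing_set_cvg_integral => //.
  - by move=> i; exact: mseg.
  - move=> i; apply/measurable_EFinP; apply: measurable_funS (measurable_sqn mu') => //.
      exact: measurable_halfline.
    by rewrite -FE; exact: bigcup_sup.
  - by move=> i t _; rewrite lee_fin sqn_ge0.
rewrite -(cvg_lim _ H)//; apply: lime_le; first exact: cvgP H.
by near=> i; exact: uK.
Unshelve. all: by end_near. Qed.

Lemma L2_loc k (u : R -> 'cV[R]_k) : L2 u ->
  [/\ mloc u, loc_int (fun s => sqn (u s)) & (energy u < +oo)%E].
Proof.
move=> [mu' nu].
have fu : (energy u < +oo)%E.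
  by move: nu; rewrite L2normE => /lty_poweRy; apply; rewrite invr_neq0.
have sub t : [set` `[0, t]] `<=` @halfline R.
  by move=> s; rewrite /halfline /= !in_itv/= andbT => /andP[].
have js : loc_int (fun s => sqn (u s)).
  move=> t; apply/integrableP; split.
    apply/measurable_EFinP; apply: measurable_sqn => i j.
    by apply: measurable_funS (mu' i j) => //; exact: measurable_halfline.
  apply: le_lt_trans fu; apply: le_trans (energy_lb (mseg 0 t) (sub t) mu').
  rewrite le_eqVlt; apply/orP; left; apply/eqP; apply: eq_integral => s _.
  by rewrite /= ger0_norm ?sqn_ge0.
split=> // i j t.
(* Entries will be dominated through |x| <= 1 + x^2. *)
have j1 : mu.-integrable `[0, t] (EFin \o (fun s => 1 + sqn (u s))).
  by apply: (loc_intD (lbm_loc_int (lbm_cst 1)) js).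
apply: le_integrable j1 => //.
  apply/measurable_EFinP.
  by apply: measurable_funS (mu' i j) => //; exact: measurable_halfline.
move=> s _; rewrite /= lee_fin [leRHS]ger0_norm ?addr_ge0 ?sqn_ge0//.
have : (u s i j) ^+ 2 <= sqn (u s).
  rewrite (ord1 j) /sqn (bigD1 i)//= lerDl; apply: sumr_ge0 => h _; exact: sqr_ge0.
rewrite -real_normK ?num_real//; set x := `|u s i j|.
have : 0 <= (x - 1) ^+ 2 by exact: sqr_ge0.
have : 0 <= x by exact: normr_ge0.
rewrite expr2 => x0 x1 x2; nra.
Qed.

Lemma energy_prim k (u : R -> 'cV[R]_k) t : mx_measurable (@halfline R) u ->
  loc_int (fun s => sqn (u s)) -> ((prim (fun s => sqn (u s)) t)%:E <= energy u)%E.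
Proof.
move=> mu' js; rewrite /prim -EFin_Rintegral//.
apply: energy_lb => //.
by move=> s; rewrite /halfline /= !in_itv/= andbT => /andP[].
Qed.

(* For v' = - l v + g, integrate 0 <= v(T)^2 = 2 int v v' and use
   2 v g <= l v^2 + g^2 / l. *)
Lemma convolution_l2 (g : R -> R) (l T : R) : 0 < l -> 0 <= T ->
  loc_int g -> loc_int (fun s => g s ^+ 2) ->
  l ^+ 2 * prim (fun t => (expR (- l * t) * prim (fun s => expR (l * s) * g s) t) ^+ 2) T
    <= prim (fun s => g s ^+ 2) T.
Proof.
move=> l0 T0 jg jg2.
pose w s := expR (l * s) * g s; pose E t := expR (- l * t).
pose v t := E t * prim w t; pose h s := - l * v s + g s.
have bE : lbm E by exact/continuous_lbm/mcont_expR.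
have jw : loc_int w by apply: loc_intM => //; exact/continuous_lbm/mcont_expR.
have bpw : lbm (prim w) by exact/continuous_lbm/prim_continuous.
have bv : lbm v by exact: lbmM.
have jh : loc_int h by apply: loc_intD => //; apply/loc_intZ/lbm_loc_int.
pose f s := - l * E s.
have jf : loc_int f by apply/loc_intZ/lbm_loc_int.
have Ef t : 0 <= t -> E t = 1 + prim f t.
  move=> t0; rewrite primZ; last exact: lbm_loc_int.
  by rewrite prim_exp ?oppr_eq0 ?gt_eqF// mulrC divfK ?oppr_eq0 ?gt_eqF// addrC subrK.
have EE s : E s * expR (l * s) = 1.
  by rewrite /E -expRD mulNr addNr expR0.
have vh t : 0 <= t -> v t = prim h t.
  move=> t0; rewrite /v Ef// mulrDl mul1r prim_prod// -primD//; last first.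
    apply: loc_intD; last by apply: loc_intM => //; exact/continuous_lbm/prim_continuous.
    by under eq_fun do rewrite mulrC; exact: loc_intM.
  apply: eq_prim => s /andP[s0 st].
  have -> : w s + (f s * prim w s + prim f s * w s) = f s * prim w s + (1 + prim f s) * w s by ring.
  rewrite -Ef// /h /v /f; congr (_ + _); first by rewrite mulrA.
  by rewrite /w mulrA EE mul1r.
have jvh : loc_int (fun s => v s * h s) by exact: loc_intM.
have v2 : v T ^+ 2 = 2 * prim (fun s => v s * h s) T.
  rewrite expr2 {1 2}vh// prim_prod//.
  rewrite -primZ//; apply: eq_prim => s /andP[s0 sT].
  by rewrite -vh//; ring.
have : 0 <= 2 * prim (fun s => v s * h s) T by rewrite -v2 sqr_ge0.
have jv2 : loc_int (fun s => v s ^+ 2).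
  by apply: lbm_loc_int; under eq_fun do rewrite expr2; exact: lbmM.
have : 2 * prim (fun s => v s * h s) T <=
    prim (fun s => l^-1 * g s ^+ 2 - l * v s ^+ 2) T.
  rewrite -primZ//; apply: prim_le.
  - exact: loc_intZ.
  - by apply: loc_intD; [exact: loc_intZ|apply: loc_intN; exact: loc_intZ].
  - move=> s _; rewrite /h -subr_ge0.
    have -> : l^-1 * g s ^+ 2 - l * v s ^+ 2 - 2 * (v s * (- l * v s + g s)) =
        l^-1 * (g s - l * v s) ^+ 2 by field; rewrite gt_eqF.
    by rewrite mulr_ge0 ?invr_ge0 ?(ltW l0)// sqr_ge0.
rewrite primB ?primZ//; [|exact: loc_intZ|exact: loc_intZ].
move=> H1 H2.
have : 0 <= l^-1 * prim (fun s => g s ^+ 2) T - l * prim (fun s => v s ^+ 2) T by lra.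
rewrite subr_ge0 -(ler_pM2l l0) mulrA mulrA mulfV ?gt_eqF// mul1r.
by rewrite expr2.
Qed.

End Energy.

(** * The gain in terms of energies, and its upper bound *)

Section Gain.
Variable R : realType.
Notation mu := (@lebesgue_measure R).

Lemma eq_energy k (u v : R -> 'cV[R]_k) : (forall t, 0 <= t -> u t = v t) ->
  energy u = energy v.
Proof.
move=> uv; apply: eq_integral => t; rewrite inE/= /halfline/= in_itv/= andbT => t0.
by rewrite uv.
Qed.

Lemma energy_gt0 k (u : R -> 'cV[R]_k) : mx_measurable (@halfline R) u ->
  ~ ae_zero u -> (0 < energy u)%E.
Proof.
move=> mu' nu; rewrite lt_neqAle energy_ge0 andbT; apply/eqP => /esym e0; apply: nu.
have ms : measurable_fun (@halfline R) (fun t => (sqn (u t))%:E).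
  by apply/measurable_EFinP; exact: measurable_sqn.
have [+ _] := ae_eq_integral_abs mu (@measurable_halfline R) ms.
have -> : (\int[mu]_(x in halfline (R:=R)) `|(sqn (u x))%:E| = 0)%E.
  rewrite -[RHS]e0; apply: eq_integral => t _.
  by rewrite abse_EFin ger0_norm// sqn_ge0.
move=> /(_ erefl); apply: filterS => t H /H [] /sqn_eq0.
by [].
Qed.

Lemma poweR_half (x : R) : 0 <= x -> (x%:E `^ 2^-1)%E = (Num.sqrt x)%:E.
Proof. by move=> x0; rewrite poweR_EFin powR12_sqrt. Qed.

(** The input energy is finite and positive, so the ratio can be cleared even when the output energy
    is infinite. *)
Lemma L2norm_ratio k l (y : R -> 'cV[R]_k) (u : R -> 'cV[R]_l) (e : R) : 0 < e ->
  energy u = e%:E -> forall h, 0 <= h ->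
  (L2norm y / L2norm u <= h%:E)%E <-> (energy y <= (h ^+ 2)%:E * energy u)%E.
Proof.
move=> e0 eu h h0; have se : 0 < Num.sqrt e by rewrite sqrtr_gt0.
rewrite !L2normE eu poweR_half ?(ltW e0)// inver gt_eqF//.
rewrite lee_pdivrMr// -EFinM.
have := energy_ge0 y; case: (energy y) => [f| |]//.
- rewrite lee_fin => f0; rewrite poweR_half// -EFinM !lee_fin.
  rewrite -[X in _ <-> _ <= X](_ : (h * Num.sqrt e) ^+ 2 = _); last first.
    by rewrite exprMn sqr_sqrtr// ltW.
  have he : 0 <= h * Num.sqrt e by rewrite mulr_ge0// ltW.
  rewrite -{2}[f]sqr_sqrtr// ler_sqr ?nnegrE ?sqrtr_ge0//.
- by rewrite poweRyr ?invr_neq0.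
Qed.

Definition output n m p (a : R -> triple R n m p) (x : R -> 'cV[R]_n) (t : R) : 'cV[R]_p :=
  mxC (a t) *m x t.

Lemma finite_L2gain n m p (T : set (R -> triple R n m p)) (g : R) : 0 <= g ->
  (forall a u x, T a -> L2 u -> trajectory a u x ->
    (energy (output a x) <= g%:E * energy u)%E) -> L2gain T \is a fin_num.
Proof.
move=> g0 H.
have ub : (L2gain T <= (Num.sqrt g)%:E)%E.
  rewrite /L2gain ge_max lee_fin sqrtr_ge0/=.
  apply: ge_ereal_sup => _ [a [u [x [Ta Lu nu tx ->]]]].
  have [ju js fu] := L2_loc Lu; have pu := energy_gt0 Lu.1 nu.
  have eu : energy u = (fine (energy u))%:E by rewrite fineK// ge0_fin_numE// ltW.
  have e0 : 0 < fine (energy u) by rewrite fine_gt0// pu.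
  apply/(L2norm_ratio (output a x) e0 eu (sqrtr_ge0 g)).
  by rewrite sqr_sqrtr//; exact: H.
have lb : (0 <= L2gain T)%E by rewrite /L2gain le_max lexx.
by rewrite ge0_fin_numE// (le_lt_trans ub)// ltry.
Qed.

Lemma L2gain_bound n m p (T : set (R -> triple R n m p)) : L2gain T <> +oo%E ->
  exists2 g : R, 0 <= g & forall a u x, T a -> L2 u -> ~ ae_zero u -> trajectory a u x ->
    (energy (output a x) <= g%:E * energy u)%E.
Proof.
move=> gT; have lb : (0 <= L2gain T)%E by rewrite /L2gain le_max lexx.
have gE : L2gain T = (fine (L2gain T))%:E.
  by rewrite fineK// ge0_fin_numE// ltey; apply/eqP.
have h0 : 0 <= fine (L2gain T) by exact: fine_ge0.
exists (fine (L2gain T) ^+ 2); first exact: sqr_ge0.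
move=> a u x Ta Lu nu tx.
have [ju js fu] := L2_loc Lu; have pu := energy_gt0 Lu.1 nu.
have eu : energy u = (fine (energy u))%:E by rewrite fineK// ge0_fin_numE// ltW.
have e0 : 0 < fine (energy u) by rewrite fine_gt0// pu.
apply/(L2norm_ratio (output a x) e0 eu h0).
rewrite -gE /L2gain le_max; apply/orP; right.
by apply: ereal_sup_ubound; exists a, u, x.
Qed.

Lemma sqn_entry k (v : 'cV[R]_k) i : `|v i 0| <= Num.sqrt (sqn v).
Proof.
rewrite -sqrtr_sqr ler_wsqrtr// /sqn (bigD1 i)//= lerDl.
by apply: sumr_ge0 => h _; exact: sqr_ge0.
Qed.

Section Bounds.
Variables (n m p r n' : nat) (M : set (triple R n m p)) (c : R).
Hypothesis c0 : 0 <= c.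
Hypothesis Mc : forall s, M s -> [/\ `|mxA s| <= c, `|mxB s| <= c & `|mxC s| <= c].
Variables (T : set (R -> triple R n m p)).
Hypothesis TM : T `<=` Linfty_triple (@halfline R) M.
Variables (P : 'M[R]_n) (Q : 'M[R]_r).
Hypothesis PQ : minimal_realization n' M P Q.

Definition rsig (a : R -> triple R n m p) : R -> triple R n m p :=
  restrict_sig (@halfline R) a.

Definition msig (a : R -> triple R n m p) : R -> triple R n' m p :=
  fun s => min_map n' P Q (rsig a s).

Lemma rsigE a s : 0 <= s -> rsig a s = a s.
Proof. by move=> s0; rewrite /rsig restrict_sigE//= /halfline/= in_itv/= s0. Qed.

Lemma rsig_tsig a : T a -> tsig c (rsig a).
Proof.
move=> Ta; apply: (restrict_tsig c0 Mc); first exact: measurable_halfline.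
exact: TM.
Qed.

Lemma rsigM a s : T a -> 0 <= s -> M (rsig a s).
Proof.
move=> Ta s0; rewrite rsigE//; have [+ _ _] := TM Ta; apply.
by rewrite inE/= /halfline/= in_itv/= s0.
Qed.

Lemma trajectory_min a u x c' : tsig c' (msig a) -> T a -> mloc u -> trajectory a u x ->
  forall t, 0 <= t ->
  output a x t = mxC (msig a t) *m
    vconst (fun s => mxA (msig a s)) (fun s => mxB (msig a s)) u t.
Proof.
move=> bm Ta ju [cx xE] t t0.
have [bA bB bC] := rsig_tsig Ta.
have xv : x t = vconst (fun s => mxA (rsig a s)) (fun s => mxB (rsig a s)) u t.
  apply: (vconst_unique bA bB ju (x := x) (T := t)).
  - apply: continuous_subspaceW cx => s; rewrite /halfline /= !in_itv/= andbT.
    by case/andP.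
  - move=> s /andP[s0 st]; rewrite xE// !mx_oint0//; apply: eq_mprim => q /andP[q0 qs].
    by rewrite rsigE.
  - by rewrite t0 lexx.
have [_ CE] := min_vconst PQ (rsig_tsig Ta) bm (fun s => rsigM Ta (s := s)) ju t0.
by rewrite /output xv -{1}(rsigE a t0) CE.
Qed.

Lemma trajectory_exists a u : T a -> mloc u -> exists x, trajectory a u x.
Proof.
move=> Ta ju; have [bA bB bC] := rsig_tsig Ta.
have [cv vE] := vconst_trajectory bA bB ju.
exists (vconst (fun s => mxA (rsig a s)) (fun s => mxB (rsig a s)) u); split=> // t t0.
rewrite vE// !mx_oint0//; apply: eq_mprim => q /andP[q0 qs].
by rewrite rsigE.
Qed.

Let Tmin : set (R -> triple R n' m p) := class_image (@halfline R) (min_map n' P Q) T.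

Lemma msig_Tmin a : T a -> Tmin (msig a).
Proof.
move=> Ta; exists a => // s; rewrite inE/= /halfline/= in_itv/= andbT => s0.
by rewrite /msig rsigE.
Qed.

Lemma msig_classA a : T a -> classA Tmin (fun s => mxA (msig a s)).
Proof. by move=> Ta; exists (msig a) => //; exact: msig_Tmin. Qed.

Lemma classA_msig A : classA Tmin A -> exists2 a, T a &
  forall t, 0 <= t -> flow A t 0 = sol (fun s => mxA (msig a s)) t.
Proof.
move=> [b [a Ta bE] AE]; exists a => // t t0.
have [c' bm] := @tsig_min R n m p r n' P Q c.
have [bA' _ _] := bm _ (rsig_tsig Ta).
apply: (flow_sol t0 bA') => s /andP[s0 _].
have sh : s \in @halfline R by rewrite inE/= /halfline/= in_itv/= s0.
by rewrite AE// bE// /msig rsigE.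
Qed.

Hypothesis A0 : assumption_A0 (classA Tmin).

(** A0 keeps the tails of signals in the class, so bounds on flows from time 0 become bounds from
    any starting time. *)
Lemma msig_shift_flow a s : T a -> 0 <= s -> exists2 A, classA Tmin A &
  forall t, 0 <= t -> flow A t 0 = sol (Defs.shift s (fun s => mxA (msig a s))) t.
Proof.
move=> Ta s0; exists (Defs.shift s (fun s => mxA (msig a s))).
  exact: A0 (msig_classA Ta) s0.
move=> t t0; have [c' bm] := @tsig_min R n m p r n' P Q c.
have [bA' _ _] := bm _ (rsig_tsig Ta).
exact: flow_bsig (bsig_shift s bA') t0.
Qed.

Lemma gain_upper (K0 l : R) : 0 < l -> 0 <= K0 ->
  (forall A t, classA Tmin A -> 0 <= t -> `|flow A t 0| <= K0 * expR (- l * t)) ->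
  exists2 g : R, 0 <= g & forall a u x, T a -> L2 u -> trajectory a u x ->
    (energy (output a x) <= g%:E * energy u)%E.
Proof.
move=> l0 K00 HK.
have [c1 bm1] := @tsig_min R n m p r n' P Q c.
pose c' := Num.max 0 c1.
have c'0 : 0 <= c' by rewrite le_max lexx.
have bm a : T a -> tsig c' (msig a).
  move=> /rsig_tsig/bm1 [b1 b2 b3].
  by split; [apply: bsig_le b1|apply: bsig_le b2|apply: bsig_le b3]; rewrite le_max lexx orbT.
(* [K1] collects the constants of Phi(t, s) B(s) u(s), and [K2] those of the squared output.
   Dimensions enter through the sup norm of products, and [p] through the sum over the entries of
   the output. *)
pose K1 := n'%:R * K0 * (m%:R * c').
have K10 : 0 <= K1 by rewrite !mulr_ge0.
pose K2 := p%:R * (n'%:R * c' * K1) ^+ 2.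
have K20 : 0 <= K2 by rewrite mulr_ge0// sqr_ge0.
exists (K2 * (l ^+ 2)^-1 * m%:R ^+ 2).
  by rewrite !mulr_ge0// ?invr_ge0 sqr_ge0.
move=> a u x Ta Lu tx.
have [ju js fu] := L2_loc Lu.
have [bA bB bC] := bm a Ta.
pose A s := mxA (msig a s); pose B s := mxB (msig a s); pose C s := mxC (msig a s).
pose z := vconst A B u.
have yE := trajectory_min (bm a Ta) Ta ju tx.
have mz : mlbm z := vconst_mlbm bA bB ju.
have my : mlbm (fun t => C t *m z t) by apply: mlbmM => //; exact: bsig_mlbm bC.
have mey : mx_measurable (@halfline R) (fun t => C t *m z t).
  by move=> i j; apply: measurable_funTS; exact: (my i j).1.
rewrite (eq_energy (v := fun t => C t *m z t)); last by move=> t t0; exact: yE.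
have ly : lbm (fun t => sqn (C t *m z t)).
  by apply: lbm_sum => i; under eq_fun do rewrite expr2; apply: lbmM; exact: my.
(* The sum of absolute values dominates the sup norm and is locally integrable; the state is then
   bounded by the scalar convolution [v] below. *)
pose g s := \sum_i `|u s i 0|.
have jg : loc_int g by apply: loc_int_sum => i; exact: (loc_int_norm (ju i 0)).
have g0 s : 0 <= g s by apply: sumr_ge0.
have g2 s : g s ^+ 2 <= m%:R ^+ 2 * sqn (u s).
  rewrite -[sqn (u s)]sqr_sqrtr ?sqn_ge0// -exprMn ler_sqr ?nnegrE ?mulr_ge0 ?sqrtr_ge0//.
  rewrite mulr_natl -[X in _ *+ X]card_ord -sumr_const; apply: ler_sum => i _.
  exact: sqn_entry.
have gu s : `|u s| <= g s.
  apply: mx_norm_le => // i j; rewrite (ord1 j) /g (bigD1 i)//= lerDl.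
  by apply: sumr_ge0.
have jg2 : loc_int (fun s => g s ^+ 2).
  move=> t; apply: (le_integrable _ _ _ (loc_intZ (m%:R ^+ 2) js t)) => //.
    have /measurable_EFinP mg : measurable_fun `[0, t] (EFin \o g) by case/integrableP: (jg t).
    have mg2 : measurable_fun `[0, t] (fun s => g s ^+ 2).
      by apply: (eq_measurable_fun (g \* g)); [move=> s _; rewrite /= expr2|exact: measurable_funM].
    exact/measurable_EFinP.
  move=> s _; rewrite /= lee_fin !ger0_norm ?sqr_ge0//.
  by rewrite mulr_ge0 ?sqr_ge0 ?sqn_ge0.
pose v t := expR (- l * t) * prim (fun s => expR (l * s) * g s) t.
have jw : loc_int (fun s => expR (l * s) * g s).
  by apply: loc_intM => //; exact/continuous_lbm/mcont_expR.
have v0 t : 0 <= v t.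
  by rewrite mulr_ge0 ?expR_ge0//; apply: prim_ge0 => s _; rewrite mulr_ge0 ?expR_ge0.
have lv : lbm v.
  by apply: lbmM; [exact/continuous_lbm/mcont_expR|exact/continuous_lbm/prim_continuous].
have jI : mloc (fun s => isol A s *m (B s *m u s)).
  apply: mlocM; first exact: (isol_mlbm bA).
  by apply: mlocM => //; exact: bsig_mlbm bB.
have zv t : 0 <= t -> `|z t| <= K1 * v t.
  move=> t0; apply: mx_norm_le => [|i j]; first by rewrite mulr_ge0.
  rewrite /z /vconst -mprim_mull// mxE.
  have jSI : mloc (fun s => sol A t *m (isol A s *m (B s *m u s))).
    by apply: mlocM => //; exact: mlbm_cst.
  apply: le_trans (prim_norm _ (jSI i j)) _.
  rewrite /v mulrA -primZ//; apply: prim_le.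
  - exact/loc_int_norm/jSI.
  - exact: loc_intZ.
  - move=> s /andP[s0 st]; apply: le_trans (mx_norm_lb _ i j) _.
    have ts0 : 0 <= t - s by rewrite subr_ge0.
    (* Phi(t, s) is the flow over the time [t - s] of the signal shifted by [s]. *)
    have -> : sol A t *m (isol A s *m (B s *m u s)) =
        sol (Defs.shift s A) (t - s) *m (B s *m u s).
      have := sol_shift bA s0 ts0; rewrite addrC subrK => ->.
      by rewrite -mulmxA (mulmxA (sol A s)) (sol_isol bA) mul1mx.
    have [A1 A1T A1E] := msig_shift_flow Ta s0.
    have := HK _ _ A1T ts0; rewrite A1E// => HA.
    apply: le_trans (mx_normM _ _) _.
    have -> : K1 * expR (- l * t) * (expR (l * s) * g s) =
        (n'%:R * (K0 * expR (- l * (t - s)))) * (m%:R * c' * g s).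
      rewrite (_ : - l * (t - s) = - l * t + l * s) ?expRD /K1; last by ring.
      by ring.
    apply: ler_pM; rewrite ?mulr_ge0//.
      by rewrite ler_wpM2l.
    apply: le_trans (mx_normM _ _) _.
    by apply: ler_pM; rewrite ?mulr_ge0// ler_wpM2l//; exact: bB.2.
have yv t : 0 <= t -> sqn (C t *m z t) <= K2 * v t ^+ 2.
  move=> t0; apply: le_trans (norm_sqn _) _.
  have k0 : 0 <= n'%:R * c' * K1 by rewrite !mulr_ge0.
  have kv : 0 <= n'%:R * c' * K1 * v t by apply: mulr_ge0.
  rewrite /K2 -(mulrA p%:R) ler_wpM2l// -exprMn ler_sqr ?nnegrE//.
  apply: le_trans (mx_normM _ _) _.
  rewrite -(mulrA (n'%:R * c') K1); apply: ler_pM; rewrite ?zv// ?mulr_ge0//.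
  by rewrite ler_wpM2l//; exact: bC.2.
apply: energy_ub => // t t0.
have -> : (\int[mu]_(s in `[0%R, t]) (sqn (C s *m z s))%:E)%E =
    (prim (fun s => sqn (C s *m z s)) t)%:E.
  by rewrite /prim -EFin_Rintegral//; exact: lbm_loc_int.
apply: (@le_trans _ _ ((K2 * (l ^+ 2)^-1 * m%:R ^+ 2)%:E * (prim (fun s => sqn (u s)) t)%:E)%E); last first.
  by apply: lee_wpmul2l; [rewrite lee_fin !mulr_ge0// ?invr_ge0 sqr_ge0|exact: energy_prim Lu.1 js].
rewrite -EFinM lee_fin.
have lv2 : loc_int (fun s => v s ^+ 2).
  by apply: lbm_loc_int; under eq_fun do rewrite expr2; exact: lbmM.
apply: (@le_trans _ _ (K2 * prim (fun s => v s ^+ 2) t)).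
  rewrite -primZ//; apply: prim_le; [exact: lbm_loc_int|exact: loc_intZ|].
  by move=> s /andP[s0 _]; exact: yv.
have H : l ^+ 2 * prim (fun s => v s ^+ 2) t <= m%:R ^+ 2 * prim (fun s => sqn (u s)) t.
  apply: le_trans (convolution_l2 l0 t0 jg jg2) _.
  by rewrite -primZ//; apply: prim_le => //; exact: loc_intZ.
set X := prim (fun s => sqn (u s)) t in H *; set Y := prim _ t in H *.
have -> : K2 / l ^+ 2 * m%:R ^+ 2 * X = K2 * ((l ^+ 2)^-1 * (m%:R ^+ 2 * X)) by rewrite !mulrA.
by rewrite ler_wpM2l// ler_pdivlMl// exprn_gt0.
Qed.

End Bounds.
End Gain.

(** * Steering *)

Section Steering.
Variable R : realType.
Notation mu := (@lebesgue_measure R).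

Lemma zcut_mlbm k l t (X : R -> 'M[R]_(k, l)) : mlbm X -> mlbm (zcut t X).
Proof.
move=> bX i j; split.
  rewrite zcut_restrict; apply/(measurable_restrictT _ _).1 => //.
  by apply: measurable_funTS; exact: (bX i j).1.
move=> T; have [c cP] := (bX i j).2 T; exists `|c| => s sT; rewrite /zcut.
case: ifP => _; last by rewrite mxE normr0.
by rewrite (le_trans (cP s sT))// ler_norm.
Qed.

Lemma energy_zcut k t (v : R -> 'cV[R]_k) : mlbm v ->
  energy (zcut t v) = (prim (fun s => sqn (v s)) t)%:E.
Proof.
move=> bv.
have lv : lbm (fun s => sqn (v s)).
  by apply: lbm_sum => i; under eq_fun do rewrite expr2; apply: lbmM; exact: bv.
rewrite /prim -EFin_Rintegral//; last exact: (lbm_loc_int lv t).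
have -> : [set` `[0, t]] = @halfline R `&` [set` `[0, t]].
  apply/seteqP; split => s; rewrite /halfline /= ?in_itv/= ?andbT; last by case.
  by move=> /andP[-> ->].
rewrite integral_mkcondr; apply: eq_integral => s _.
rewrite patchE mem_setE in_itv/= /zcut; case: ifP => // _.
by rewrite sqn0.
Qed.

Lemma loc_int_sub (f : R -> R) s t : 0 <= s -> loc_int f ->
  mu.-integrable `[s, t] (EFin \o f).
Proof.
move=> s0 jf; apply: integrableS (jf t) => //.
by move=> q /=; rewrite !in_itv/=; move: s0; lra.
Qed.

Lemma le_of_eq disp (X : porderType disp) (x y : X) : x = y -> (x <= y)%O.
Proof. by move->. Qed.

Lemma energy_tail k (y : R -> 'cV[R]_k) s t : mlbm y -> 0 <= s -> 0 <= t ->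
  ((prim (fun q => sqn (y (s + q))) t)%:E <= energy y)%E.
Proof.
move=> my s0 t0.
have ly : lbm (fun t => sqn (y t)).
  by apply: lbm_sum => i; under eq_fun do rewrite expr2; apply: lbmM; exact: my.
have sub : [set` `[s, s + t]] `<=` @halfline R.
  move=> q; rewrite /halfline /= !in_itv/= andbT => /andP[+ _].
  exact: le_trans.
have my' : mx_measurable (@halfline R) y.
  by move=> i j; apply: measurable_funTS; exact: (my i j).1.
apply: le_trans (energy_lb (mseg _ _) sub my').
move: ly; set f := fun t => _ => ly.
have jf := lbm_loc_int ly.
have [_ i2] := shift_integral s0 t0 jf.
apply: (le_trans _ (le_of_eq (esym (EFin_Rintegral (mseg s (s + t)) (loc_int_sub (s + t) s0 jf))))).
by rewrite i2 /prim.
Qed.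

Lemma ae_zero_energy k (u : R -> 'cV[R]_k) : mlbm u -> ae_zero u -> energy u = 0%E.
Proof.
move=> bu zu.
have ms : measurable_fun (@halfline R) (fun t => (sqn (u t))%:E).
  apply/measurable_EFinP; apply: measurable_sqn => i j.
  by apply: measurable_funTS; exact: (bu i j).1.
have [_ <-] := ae_eq_integral_abs mu (@measurable_halfline R) ms.
  by apply: eq_integral => t _; rewrite abse_EFin ger0_norm// sqn_ge0.
pose nu : {measure set (measurableTypeR R) -> \bar R} := mu.
have ff : Filter (almost_everywhere nu) by typeclasses eauto.
have {zu} : \forall t \near almost_everywhere nu, @halfline R t -> (sqn (u t))%:E = 0%E.
  by apply: (@filterS _ _ ff _ _ _ zu) => t H /H ->; rewrite sqn0.
exact.
Qed.

Lemma qf_eq0 k (W : 'M[R]_k) x : x = 0 -> qf W x = 0.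
Proof. by move->; rewrite /qf mulmx0 mxE. Qed.

Section Steer.
Variables (n m : nat) (c : R) (A : R -> 'M[R]_n) (B : R -> 'M[R]_(n, m)) (tc : R).
Hypothesis bA : bsig c A.
Hypothesis bB : bsig c B.
Hypothesis tc0 : 0 <= tc.
Let W := og (fun s => - (A s)^T) (fun s => (B s)^T) tc.
Let bN : bsig c (fun s => - (A s)^T) := bsigN (bsig_tr bA).
Let bBT : bsig c (fun s => (B s)^T) := bsig_tr bB.

(** The classical minimum energy control B^T Phi(0, s)^T eta, switched off after [tc]: the solution
    of the adjoint equation is Phi(0, s)^T. *)
Definition control (eta : 'cV[R]_n) : R -> 'cV[R]_m :=
  zcut tc (fun s => (B s)^T *m sol (fun s => - (A s)^T) s *m eta).

Lemma control_mlbm eta : mlbm (control eta).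
Proof.
apply: zcut_mlbm; apply: mlbmM; last exact: mlbm_cst.
by apply: mlbmM; [exact: bsig_mlbm bBT|exact: (sol_mlbm bN)].
Qed.

Lemma control_energy eta : energy (control eta) = (qf W eta)%:E.
Proof.
rewrite energy_zcut; first by rewrite /W (qf_og bN bBT).
apply: mlbmM; last exact: mlbm_cst.
by apply: mlbmM; [exact: bsig_mlbm bBT|exact: (sol_mlbm bN)].
Qed.

Lemma control_L2 eta : L2 (control eta).
Proof.
split; first by move=> i j; apply: measurable_funTS; exact: (control_mlbm eta i j).1.
by rewrite L2normE control_energy poweR_lty// ltry.
Qed.

Lemma control_reach eta t : 0 <= t ->
  vconst A B (control eta) (tc + t) =
  sol (Defs.shift tc A) t *m (sol A tc *m (W *m eta)).
Proof.
move=> t0; rewrite /vconst (sol_shift bA tc0 t0) -mulmxA; congr (_ *m (_ *m _)).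
pose f s := isol A s *m (B s *m control eta s).
have jf : mloc f.
  apply: mlbm_mloc; apply: mlbmM; first exact: (isol_mlbm bA).
  by apply: mlbmM; [exact: bsig_mlbm bB|exact: control_mlbm].
(* The control is off strictly after [tc] but need not vanish at [tc], hence the comparison on a
   half-open interval. *)
have E1 : mprim f (tc + t) = mprim f tc.
  apply/eqP; rewrite -subr_eq0 -mprim_shift//; apply/eqP.
  rewrite -[RHS](mprim_cst0 _ _ t); apply: eq_mprim_oc.
  - exact: mloc_shift.
  - exact/mlbm_mloc/mlbm_cst.
  - move=> s /andP[s0 st]; rewrite /f /control /zcut gerDl (leNgt s) s0 andbF.
    by rewrite !mulmx0.
rewrite -/f E1 /W /og -mprim_mulr; last exact/mlbm_mloc/(og_mlbm bN bBT).
apply: eq_mprim => s st.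
by rewrite /f /control zcutE// /isol trmxK !mulmxA.
Qed.

(** Needed because the gain only tests nonzero inputs; zero energy would put [eta] in the kernel of
    the positive semidefinite [W]. *)
Lemma control_not_ae_zero eta : W *m eta != 0 -> ~ ae_zero (control eta).
Proof.
move=> We /(ae_zero_energy (control_mlbm eta)).
rewrite control_energy => -[q0]; move/eqP: We; apply.
apply: ker_qf q0; first exact: og_sym.
by move=> x; exact: (qf_og_ge0 bN bBT).
Qed.

End Steer.

Section Core.
Variables (n m p r n' : nat) (M : set (triple R n m p)) (c c' : R).
Hypothesis c0 : 0 <= c.
Hypothesis Mc : forall s, M s -> [/\ `|mxA s| <= c, `|mxB s| <= c & `|mxC s| <= c].
Variables (T : set (R -> triple R n m p)).
Hypothesis TM : T `<=` Linfty_triple (@halfline R) M.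
Variables (P : 'M[R]_n) (Q : 'M[R]_r).
Hypothesis PQ : minimal_realization n' M P Q.
Hypothesis bm : forall a : R -> triple R n m p, tsig c a ->
  tsig c' (fun s => min_map n' P Q (a s)).
Variable g : R.
Hypothesis gP : forall a u x, T a -> L2 u -> ~ ae_zero u -> trajectory a u x ->
    (energy (output a x) <= g%:E * energy u)%E.

(* A control which reaches xi at time tc and then vanishes turns the gain bound
   into a bound on the free output issued from xi. *)
Lemma free_output_bound a tc al tau xi : T a -> 0 <= tc -> 0 <= al -> 0 <= tau ->
  let am := msig n' P Q a in
  let W := cgt am tc in
  W \in unitmx ->
  qf (ogt (Defs.shift (tc + al) am) tau)
     (sol (Defs.shift tc (fun s => mxA (am s))) al *m xi) <=
  g * qf W (invmx W *m (isol (fun s => mxA (am s)) tc *m xi)).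
Proof.
move=> Ta tc0 al0 tau0 am W uW.
have ba : tsig c' am := bm (rsig_tsig c0 Mc TM Ta).
have [bA bB bC] := ba.
(* For [xi = 0] the control is zero, an input excluded by [gP]; both sides are then 0. *)
have [xi0|xi0] := eqVneq xi 0.
  apply: (@le_trans _ _ 0).
    by apply: le_of_eq; apply: qf_eq0; rewrite xi0; exact: mulmx0.
  apply/le_of_eq/esym; apply: (etrans _ (mulr0 g)); congr (g * _); apply: qf_eq0.
  by rewrite xi0 (mulmx0 _ (isol _ _)); exact: mulmx0.
pose A s := mxA (am s); pose B s := mxB (am s); pose C s := mxC (am s).
(* With this choice the state at time [tc], the image of [W *m eta] under [sol A tc], is [xi]. *)
pose eta := invmx W *m (isol A tc *m xi).
have We : W *m eta = isol A tc *m xi by rewrite /eta mulKVmx.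
pose u := control A B tc eta.
have nz : W *m eta != 0.
  rewrite We; apply/eqP => i0; move/eqP: xi0; apply.
  by rewrite -[xi]mul1mx -(sol_isol bA tc) -mulmxA i0 mulmx0.
have Lu : L2 u := control_L2 tc bA bB eta.
have ju : mloc u := mlbm_mloc (control_mlbm tc bA bB eta).
have nu : ~ ae_zero u := control_not_ae_zero bA bB nz.
have [x tx] := trajectory_exists c0 Mc TM Ta ju.
have H := gP Ta Lu nu tx.
have yE := trajectory_min c0 Mc TM PQ ba Ta ju tx.
have zE t : 0 <= t -> vconst A B u (tc + t) = sol (Defs.shift tc A) t *m xi.
  move=> t0; rewrite (control_reach bA bB tc0 eta t0) We.
  by rewrite (mulmxA (sol A tc)) (sol_isol bA) mul1mx.
have mz : mlbm (vconst A B u) := vconst_mlbm bA bB ju.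
have my : mlbm (fun t => C t *m vconst A B u t) by apply: mlbmM => //; exact: bsig_mlbm bC.
rewrite (eq_energy yE) (control_energy tc bA bB eta) -EFinM in H.
have s0 : 0 <= tc + al by exact: addr_ge0.
rewrite -lee_fin; apply: le_trans H.
apply: le_trans (energy_tail my s0 tau0).
rewrite /ogt (qf_og (bsig_shift (tc + al) bA) (bsig_shift (tc + al) bC)).
rewrite lee_fin le_eqVlt; apply/orP; left; apply/eqP.
apply: eq_prim => s /andP[s0' st].
have bAs := bsig_shift tc bA.
rewrite -(addrA tc) (zE _ (addr_ge0 al0 s0')) (sol_shift bAs al0 s0').
rewrite shift_shift.
by rewrite (addrA tc) -!mulmxA.
Qed.

End Core.
End Steering.

(** * Infinite concatenations with prescribed first blocks *)

Section Concatenation.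
Variable R : realType.
Variable X : Type.

Lemma series_le (d : nat -> R) j k : (forall k, 0 <= d k) -> (j <= k)%N ->
  series d j <= series d k.
Proof.
move=> d0 jk; rewrite /series/= (big_cat_nat (n := j) (p := k))//= lerDl.
by apply: sumr_ge0.
Qed.

Lemma concat_infty_exists (F : R -> set (R -> X)) (d : nat -> R) (b : nat -> R -> X) :
  (forall k, 0 <= d k) -> (forall k, F (d k) (b k)) -> series d @ \oo --> +oo ->
  exists2 a, concat_infty F a & forall k s,
    series d k < s <= series d k.+1 -> a s = b k (s - series d k).
Proof.
move=> d0 Fb dy.
pose S s k := series d k < s <= series d k.+1.
(* Time 0 belongs to no half-open block; the default [b 0%N 0] is the value that [concat_infty]
   prescribes there. *)
pose a s := if pselect (exists k, S s k) is left h
  then b (projT1 (cid h)) (s - series d (projT1 (cid h))) else b 0%N 0.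
have aE k s : series d k < s <= series d k.+1 -> a s = b k (s - series d k).
  move=> ks; rewrite /a; case: pselect => [h|[]]; last by exists k.
  case: cid => /= j js; have [jk|kj|->//] := ltngtP j k; exfalso.
  - have := series_le d0 jk; case/andP: js => _ h1; case/andP: ks => h2 _ h3.
    by have := le_lt_trans (le_trans h1 h3) h2; rewrite ltxx.
  - have := series_le d0 kj; case/andP: js => h1 _; case/andP: ks => _ h2 h3.
    by have := le_lt_trans (le_trans h2 h3) h1; rewrite ltxx.
have s0 k : 0 <= series d k.
  by rewrite -[0](_ : series d 0%N = 0) ?series_le// /series/= big_geq.
exists a => //; exists d, b; split=> //.
rewrite /a; case: pselect => // h; exfalso; case: h => k; rewrite /S => /andP[+ _].
by rewrite ltNge s0.
Qed.

(* Members of F_oo have infinitely many pieces: the last one is repeated. *)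
Lemma three_blocks (F : R -> set (R -> X)) (t1 t2 t3 : R) (g1 g2 g3 : R -> X) :
  0 <= t1 -> 0 <= t2 -> 0 < t3 -> F t1 g1 -> F t2 g2 -> F t3 g3 ->
  exists a, [/\ concat_infty F a, forall s, 0 < s <= t1 -> a s = g1 s,
    forall s, 0 < s <= t2 -> a (t1 + s) = g2 s &
    forall s, 0 < s <= t3 -> a (t1 + t2 + s) = g3 s].
Proof.
move=> t10 t20 t30 F1 F2 F3.
pose d k := nth t3 [:: t1; t2] k; pose b k := nth g3 [:: g1; g2] k.
have d0 k : 0 <= d k by case: k => [|[|k]]//; rewrite /d/= nth_nil ltW.
have Fb k : F (d k) (b k) by case: k => [|[|k]]//; rewrite /d /b/= !nth_nil.
have s0 : series d 0%N = 0 by rewrite /series/= big_geq.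
have s1 : series d 1%N = t1 by rewrite /series/= big_nat1.
have s2 : series d 2%N = t1 + t2 by rewrite /series/= big_nat_recr//= big_nat1.
have sk k : series d k.+2 = t1 + t2 + k%:R * t3.
  elim: k => [|k IH]; first by rewrite s2 mul0r addr0.
  by rewrite seriesSr IH /d/= nth_nil -addrA -[k.+1]addn1 natrD mulrDl mul1r.
have dy : series d @ \oo --> +oo.
  rewrite -(cvg_shiftn 2); apply/cvgryPge => N.
  near=> k; rewrite /= addn2 sk.
  have : `|N| / t3 < k%:R.
    apply: lt_le_trans (truncnS_gt _) _; rewrite ler_nat; near: k.
    exact: nbhs_infty_gt.
  rewrite ltr_pdivrMr// => h; have := ler_norm N; lra.
have [a Fa aE] := concat_infty_exists d0 Fb dy.
exists a; split=> // s /andP[s0' st].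
- by rewrite (aE 0%N) s0 ?s1 ?subr0// s0'.
- by rewrite (aE 1%N) s1 ?s2; [rewrite addrAC subrr add0r|rewrite ltrDl s0' lerD2l].
- have := sk 1%N; rewrite mul1r => s3.
  by rewrite (aE 2%N) s2 ?s3; [rewrite addrAC subrr add0r|rewrite ltrDl s0' lerD2l].
Unshelve. all: by end_near. Qed.

End Concatenation.

(** * Invertible Gramians within the family of signals *)

Section GramianSignals.
Variable R : realType.

(** [gr] stands for either Gramian. The tolerance is the radius within which matrices stay
    invertible, so the determinant is nonzero at the end of the path, and then at some parameter
    whose signal is in [G]. *)
Lemma analytic_gramian n m p (G : R -> set (R -> triple R n m p))
    (gr : (R -> triple R n m p) -> R -> 'M[R]_n) a t :
  (forall eps, 0 < eps -> exists (tl : R -> R) (al : R -> R -> triple R n m p),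
     [/\ forall l, 0 <= l <= 1 -> 0 < tl l,
         mx_analytic_on [set` `[0, 1]] (fun l => gr (al l) (tl l)),
         `|gr (al 1) (tl 1) - gr a t| <= eps &
         interior [set l | 0 <= l <= 1 /\ G (tl l) (al l)] !=set0]) ->
  gr a t \in unitmx ->
  exists t' b, [/\ 0 < t', G t' b & gr b t' \in unitmx].
Proof.
move=> H /unitmx_open[e e0 eP]; have [tl [al [t0 an a1 iP]]] := H e e0.
have d1 : \det (gr (al 1) (tl 1)) != 0 by rewrite -unitfE -unitmxE; exact: eP.
have [l [l01 Gl dl]] := analytic_det_neq0 an d1 iP.
by exists (tl l), (al l); split=> //; [exact: t0|rewrite unitmxE unitfE].
Qed.

Lemma T2_ctrl n m p (M : set (triple R n m p)) (G : R -> set (R -> triple R n m p)) a t :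
  assumption_T2 M G -> 0 < t -> sig_pc M t a -> ctrl_gramian a t \in unitmx ->
  exists t' b, [/\ 0 < t', G t' b & ctrl_gramian b t' \in unitmx].
Proof.
move=> [_ T2] t0 pa; apply: analytic_gramian => eps eps0.
have [tl [al [t1 _ [an _] [a1 _] iP]]] := T2 t eps a t0 eps0 pa.
by exists tl, al; split=> // l l01; apply: t1; rewrite inE/= in_itv.
Qed.

Lemma T2_obs n m p (M : set (triple R n m p)) (G : R -> set (R -> triple R n m p)) a t :
  assumption_T2 M G -> 0 < t -> sig_pc M t a -> obs_gramian a t \in unitmx ->
  exists t' b, [/\ 0 < t', G t' b & obs_gramian b t' \in unitmx].
Proof.
move=> [_ T2] t0 pa; apply: analytic_gramian => eps eps0.
have [tl [al [t1 _ [_ an] [_ a1] iP]]] := T2 t eps a t0 eps0 pa.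
by exists tl, al; split=> // l l01; apply: t1; rewrite inE/= in_itv.
Qed.

Lemma pc_obs n m p (M : set (triple R n m p)) c : M !=set0 ->
  (forall s, M s -> [/\ `|mxA s| <= c, `|mxB s| <= c & `|mxC s| <= c]) ->
  (forall W : {vspace 'cV[R]_n}, within_unobservable M W -> forall w, w \in W -> w = 0) ->
  exists t a, [/\ 0 < t, sig_pc M t a & obs_gramian a t \in unitmx].
Proof.
move=> M0 Mc unobs.
have bal x : M x -> `|mxA x| <= c by move=> /Mc[].
have bga x : M x -> `|mxC x| <= c by move=> /Mc[].
have [|t [a [ga' ua]]] := exists_good_gram bal bga _ M0.
  by move=> W h; apply: unobs => s Ms; exact: h.
have [t0 pa _ _ _] := ga'.
exists t, a; split=> //.
by rewrite (obs_gramian_ogt (good_al bal ga') (ltW t0) (fun s _ => erefl (a s))).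
Qed.

(** By duality: an unobservable subspace of (- A^T, B^T) has an orthogonal complement that contains
    the reachable space. That complement is the whole space, so the subspace is 0. *)
Lemma pc_ctrl n m p (M : set (triple R n m p)) c : M !=set0 ->
  (forall s, M s -> [/\ `|mxA s| <= c, `|mxB s| <= c & `|mxC s| <= c]) ->
  (forall W : {vspace 'cV[R]_n}, contains_reachable M W -> forall w, w \in W) ->
  exists t a, [/\ 0 < t, sig_pc M t a & ctrl_gramian a t \in unitmx].
Proof.
move=> M0 Mc reach.
have c0 : 0 <= c by have [x /Mc[+ _ _]] := M0; exact: le_trans.
have bal x : M x -> `|- (mxA x)^T| <= c.
  move=> /Mc[h _ _]; rewrite normrN; apply: mx_norm_le => // i j.
  by rewrite mxE (le_trans (mx_norm_lb _ _ _)).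
have bga x : M x -> `|(mxB x)^T| <= c.
  move=> /Mc[_ h _]; apply: mx_norm_le => // i j.
  by rewrite mxE (le_trans (mx_norm_lb _ _ _)).
have [|t [a [ga' ua]]] := exists_good_gram bal bga _ M0.
  move=> W h.
  have [V VP] : exists V : {vspace 'cV[R]_n}, forall v, v \in V <->
      (forall w, w \in W -> w^T *m v = 0).
    apply: vspace_of_pred; first by move=> w _; rewrite mulmx0.
    move=> k u v Pu Pv w wW.
    by rewrite mulmxDr -scalemxAr Pu// Pv// scaler0 addr0.
  have Vc : contains_reachable M V.
    move=> s Ms; have [h1 h2] := h s Ms; split=> [v|x /VP xV]; apply/VP => w wW.
      apply: trmx_inj; rewrite !trmx_mul trmxK -mulmxA (h1 w wW) mulmx0.
      by apply/matrixP => i j; rewrite !mxE.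
    rewrite mulmxA -[w^T *m mxA s]trmxK trmx_mul trmxK.
    have := xV _ (h2 w wW); rewrite mulNmx linearN/= mulNmx => /eqP.
    by rewrite oppr_eq0 => /eqP.
  move=> w wW; apply: sqn_eq0; rewrite -sqnE.
  by have /VP/(_ w wW) -> := reach V Vc w; rewrite mxE.
have [t0 pa _ _ _] := ga'.
exists t, a; split=> //.
have bA : bsig c (fun s => mxA (a s)).
  have := bsigN (bsig_tr (good_al bal ga')).
  by congr (bsig _ _); apply/funext => s; rewrite linearN/= opprK trmxK.
by rewrite (ctrl_gramian_cgt bA (ltW t0) (fun s _ => erefl (a s))).
Qed.

End GramianSignals.

(** * Gramians of signals of the class containing a prescribed block *)

Section MinimalGramians.
Variable R : realType.

Lemma isol_ext d c c' (A A' : R -> 'M[R]_d) t : bsig c A -> bsig c' A' ->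
  (forall s, 0 < s <= t -> A s = A' s) -> 0 <= t -> isol A t = isol A' t.
Proof.
move=> bA bA' AA t0; apply: (congr1 trmx).
apply: (sol_ext (bsigN (bsig_tr bA)) (bsigN (bsig_tr bA')) (T := t)).
  by move=> s st; rewrite AA.
by rewrite t0 lexx.
Qed.

Variables (n m p r n' : nat) (M : set (triple R n m p)) (c : R).
Hypothesis c0 : 0 <= c.
Hypothesis Mc : forall s, M s -> [/\ `|mxA s| <= c, `|mxB s| <= c & `|mxC s| <= c].
Hypothesis M0 : M !=set0.
Variables (T : set (R -> triple R n m p)) (G : R -> set (R -> triple R n m p)).
Hypothesis TM : T `<=` Linfty_triple (@halfline R) M.
Hypothesis GM : forall t : R, 0 <= t -> G t `<=` Linfty_triple (segment0 t) M.
Variables (P : 'M[R]_n) (Q : 'M[R]_r).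
Hypothesis PQ : minimal_realization n' M P Q.
Hypothesis T2 : assumption_T2 (min_map n' P Q @` M)
  (fun t => class_image (segment0 t) (min_map n' P Q) (G t)).

Definition fsig t (g : R -> triple R n m p) : R -> triple R n' m p :=
  fun s => min_map n' P Q (restrict_sig (segment0 t) g s).

Lemma msig_fsig t a g : (forall s, 0 < s <= t -> a s = g s) ->
  forall s, 0 < s <= t -> msig n' P Q a s = fsig t g s.
Proof.
move=> ag s /andP[s0 st]; rewrite /msig rsigE ?(ltW s0)// /fsig restrict_sigE ?ag ?s0//.
by rewrite /segment0 /= in_itv/= (ltW s0).
Qed.

Lemma fsig_tsig c' t g : (forall a : R -> triple R n m p, tsig c a ->
    tsig c' (fun s => min_map n' P Q (a s))) -> 0 <= t -> G t g -> tsig c' (fsig t g).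
Proof.
move=> bm t0 Gg; apply: bm; apply: (restrict_tsig c0 Mc); first exact: measurable_itv.
exact: GM Gg.
Qed.

Lemma min_bounded : exists c', forall s, (min_map n' P Q @` M) s ->
  [/\ `|mxA s| <= c', `|mxB s| <= c' & `|mxC s| <= c'].
Proof.
have [c' bm] := @tsig_min R n m p r n' P Q c.
exists c' => _ [x Mx <-]; have [hA hB hC] := Mc Mx.
have [] := bm (fun=> x).
  by split; split=> // i j; exact: measurable_cst.
by move=> [_ b1] [_ b2] [_ b3]; split; [exact: (b1 0)|exact: (b2 0)|exact: (b3 0)].
Qed.

(** [W] and [J] depend on the block [g] alone and serve every signal that starts with it, which
    makes the later bounds uniform. *)
Lemma exists_ctrl_signal : exists (t : R) (g : R -> triple R n m p) (W J : 'M[R]_n'),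
  [/\ 0 < t, G t g, W \in unitmx & forall a, T a -> (forall s, 0 < s <= t -> a s = g s) ->
    cgt (msig n' P Q a) t = W /\ isol (fun s => mxA (msig n' P Q a s)) t = J].
Proof.
have [c1 Mc1] := min_bounded.
have M1 : (min_map n' P Q @` M) !=set0 by have [x Mx] := M0; exists (min_map n' P Q x), x.
have [_ _ _ reach _] := min_real_facts PQ.
have [t [a [t0 pa ua]]] := pc_ctrl M1 Mc1 reach.
(* T2 yields a signal [b] of the reduced family; [g] is a signal of [G] that projects to it, and the
   gain is tested on signals built from [g]. *)
have [t' [b [t'0 [g Gg bg] ub]]] := T2_ctrl T2 t0 pa ua.
have [c' bm] := @tsig_min R n m p r n' P Q c.
have bf := fsig_tsig bm (ltW t'0) Gg; have [bA bB bC] := bf.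
exists t', g, (cgt (fsig t' g) t'), (isol (fun s => mxA (fsig t' g s)) t').
split; [exact: t'0|exact: Gg| |].
  rewrite -(ctrl_gramian_cgt bA (ltW t'0) (a := b))// => s st.
  by rewrite bg ?inE//= /fsig restrict_sigE.
move=> a' Ta' ag; have am := msig_fsig ag.
have [bA' bB' bC'] : tsig c' (msig n' P Q a') := bm _ (rsig_tsig c0 Mc TM Ta').
split.
  apply: (og_ext (bsigN (bsig_tr bA')) (bsig_tr bB') (bsigN (bsig_tr bA)) (bsig_tr bB)) => s st;
  by rewrite am.
apply: (isol_ext bA' bA _ (ltW t'0)) => s st.
by rewrite am.
Qed.

Lemma exists_obs_signal : exists (t : R) (g : R -> triple R n m p) (W : 'M[R]_n'),
  [/\ 0 < t, G t g, W \in unitmx /\ W^T = W, (forall x, 0 <= qf W x) &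
   forall a s, T a -> 0 <= s -> (forall q, 0 < q <= t -> a (s + q) = g q) ->
    ogt (Defs.shift s (msig n' P Q a)) t = W].
Proof.
have [c1 Mc1] := min_bounded.
have M1 : (min_map n' P Q @` M) !=set0 by have [x Mx] := M0; exists (min_map n' P Q x), x.
have [_ _ _ _ unobs] := min_real_facts PQ.
have [t [a [t0 pa ua]]] := pc_obs M1 Mc1 unobs.
have [t' [b [t'0 [g Gg bg] ub]]] := T2_obs T2 t0 pa ua.
have [c' bm] := @tsig_min R n m p r n' P Q c.
have bf := fsig_tsig bm (ltW t'0) Gg; have [bA bB bC] := bf.
exists t', g, (ogt (fsig t' g) t'); split; [exact: t'0|exact: Gg| | |].
- split; last exact: og_sym.
  rewrite -(obs_gramian_ogt bA (ltW t'0) (a := b))// => s st.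
  by rewrite bg ?inE//= /fsig restrict_sigE.
- by move=> x; exact: (qf_og_ge0 bA bC).
move=> a' s Ta' s0 ag.
have [bA' bB' bC'] := tsig_shift s (bm _ (rsig_tsig c0 Mc TM Ta')).
have am q : 0 < q <= t' -> Defs.shift s (msig n' P Q a') q = fsig t' g q.
  move=> qt; have q0 : 0 <= q by case/andP: qt => /ltW.
  rewrite /Defs.shift /msig rsigE ?addr_ge0// ag// /fsig restrict_sigE//.
  by rewrite /segment0 /= in_itv/= q0; case/andP: qt.
by apply: (og_ext bA' bC' bA bC) => q qt; rewrite am.
Qed.

End MinimalGramians.

(** * Uniform bound on the flows of the family *)

Section FamilyBound.
Variable R : realType.

Lemma pmul_le_div (a K X Y : R) : 0 < a -> a * X <= K * Y -> X <= K / a * Y.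
Proof. by move=> a0 h; rewrite mulrAC ler_pdivlMr// mulrC. Qed.

Lemma qf_le_sqn k (W : 'M[R]_k) x : qf W x <= k%:R * (k%:R * `|W|) * sqn x.
Proof.
apply: le_trans (ler_norm _) _; apply: le_trans (mx_norm_lb _ 0 0) _.
apply: le_trans (mx_normM _ _) _.
have tx : `|x^T| <= `|x|.
  by apply: mx_norm_le => // i j; rewrite mxE mx_norm_lb.
apply: (@le_trans _ _ (k%:R * (k%:R * `|x| * `|W|) * `|x|)).
  rewrite ler_wpM2r// ler_wpM2l// (le_trans (mx_normM _ _))//.
  by rewrite ler_wpM2r// ler_wpM2l.
have := sqn_norm x; set N := `|x|; set L := `|W| => h.
have -> : k%:R * (k%:R * N * L) * N = k%:R * (k%:R * L) * N ^+ 2 by ring.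
by rewrite ler_wpM2l// !mulr_ge0// normr_ge0.
Qed.

Lemma norm_le_sqn k l (Phi : 'M[R]_(k, l)) K : 0 <= K ->
  (forall x, sqn (Phi *m x) <= K * sqn x) -> `|Phi| <= Num.sqrt K.
Proof.
move=> K0 H; apply: mx_norm_le => [|i j]; first exact: sqrtr_ge0.
have := H (delta_mx j 0); rewrite -colE => h.
have -> : Phi i j = col j Phi i 0 by rewrite mxE.
apply: le_trans (sqn_entry _ _) _; rewrite ler_wsqrtr// (le_trans h)//.
rewrite /sqn (bigD1 j)//= big1 ?addr0 => [|q qj].
  by rewrite mxE !eqxx expr1n mulr1.
by rewrite mxE (negbTE qj) expr0n.
Qed.

Variables (n m p r n' : nat) (M : set (triple R n m p)) (c : R).
Hypothesis c0 : 0 <= c.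
Hypothesis Mc : forall s, M s -> [/\ `|mxA s| <= c, `|mxB s| <= c & `|mxC s| <= c].
Hypothesis M0 : M !=set0.
Variables (T : set (R -> triple R n m p)) (G : R -> set (R -> triple R n m p)).
Hypothesis TM : T `<=` Linfty_triple (@halfline R) M.
Hypothesis GM : forall t : R, 0 <= t -> G t `<=` Linfty_triple (segment0 t) M.
Hypothesis GT : concat_infty G `<=` T.
Variables (P : 'M[R]_n) (Q : 'M[R]_r).
Hypothesis PQ : minimal_realization n' M P Q.
Let Gmin : R -> set (R -> triple R n' m p) :=
  fun t => class_image (segment0 t) (min_map n' P Q) (G t).
Hypothesis T2 : assumption_T2 (min_map n' P Q @` M) Gmin.
Variable g : R.
Hypothesis g0 : 0 <= g.
Hypothesis gP : forall a u x, T a -> L2 u -> ~ ae_zero u -> trajectory a u x ->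
    (energy (output a x) <= g%:E * energy u)%E.
Notation msig := (msig n' P Q).

(** The constant is fixed by [gc] and the gain before [a], [al] and [tau] are chosen: blocks of any
    length may follow. *)
Lemma steered_output : exists (tc : R) (gc : R -> triple R n m p) (K : R),
  [/\ 0 < tc, G tc gc, 0 <= K & forall a, T a -> (forall s, 0 < s <= tc -> a s = gc s) ->
    forall al tau xi, 0 <= al -> 0 <= tau ->
    qf (ogt (Defs.shift (tc + al) (msig a)) tau)
      (sol (Defs.shift tc (fun s => mxA (msig a s))) al *m xi) <= K * sqn xi].
Proof.
have [c' bm] := @tsig_min R n m p r n' P Q c.
have [tc [gc [W [J [tc0 Gg uW WJ]]]]] := exists_ctrl_signal c0 Mc M0 TM GM PQ T2.
exists tc, gc, (g * (n'%:R * (n'%:R * `|W|) * opsq (invmx W *m J))).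
have k0 : 0 <= n'%:R * (n'%:R * `|W|) by rewrite !mulr_ge0// normr_ge0.
split=> //; first by rewrite !mulr_ge0// ?opsq_ge0// normr_ge0.
move=> a Ta ag al tau xi al0 tau0.
have [WE JE] := WJ a Ta ag.
have uW' : cgt (msig a) tc \in unitmx by rewrite WE.
have := free_output_bound c0 Mc TM PQ bm gP xi Ta (ltW tc0) al0 tau0 uW'.
rewrite WE JE => h; apply: le_trans h _.
rewrite -(mulrA g) ler_wpM2l// mulmxA.
apply: le_trans (qf_le_sqn _ _) _.
by rewrite -(mulrA (n'%:R * (n'%:R * `|W|))) ler_wpM2l// sqnM.
Qed.

Lemma familyA_sol c' th A : (forall a : R -> triple R n m p, tsig c a ->
    tsig c' (fun s => min_map n' P Q (a s))) -> 0 <= th ->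
  familyA Gmin th A -> exists2 f, G th f &
    forall t, 0 <= t <= th -> flow A t 0 = sol (fun s => mxA (fsig n' P Q th f s)) t.
Proof.
move=> bm th0 [b [f Gf bf] Ab]; exists f => // t /andP[t0 tth].
have [bA _ _] := fsig_tsig c0 Mc GM bm th0 Gf.
apply: (flow_sol t0 bA) => s /andP[s0 st].
have sth : s \in segment0 th by rewrite inE/= /segment0/= in_itv/= s0 (le_trans st).
by rewrite Ab// bf// /fsig restrict_sigE// -inE.
Qed.

Lemma family_bound : exists2 K, 0 <= K & forall th A, 0 <= th -> familyA Gmin th A ->
  `|flow A th 0| <= K.
Proof.
have [c' bm] := @tsig_min R n m p r n' P Q c.
have [tc [gc [K [tc0 Gc K0 KP]]]] := steered_output.
have [to [go [Wo [to0 Go [uW sW] pW WoP]]]] := exists_obs_signal c0 Mc M0 TM GM PQ T2.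
have [ga ga0 gaP] := posdef_bound sW pW uW.
exists (Num.sqrt (K / ga)); first exact: sqrtr_ge0.
move=> th A th0 /(familyA_sol bm th0)[f Gf ->]; last by rewrite th0 lexx.
(* The state [x] reached at [tc] is moved by [f]; the window of [go] then returns output energy at
   least [ga] times the square of the result. *)
have [a [aG a1 a2 a3]] := three_blocks (ltW tc0) th0 to0 Gc Gf Go.
have Ta := GT aG.
apply: norm_le_sqn; first by rewrite divr_ge0// ltW.
move=> x; have := KP a Ta a1 th to x th0 (ltW to0).
rewrite (WoP a (tc + th) Ta (addr_ge0 (ltW tc0) th0) a3) => h.
have [bA _ _] := fsig_tsig c0 Mc GM bm th0 Gf.
have [bA' _ _] := tsig_shift tc (bm _ (rsig_tsig c0 Mc TM Ta)).
have E : sol (Defs.shift tc (fun s => mxA (msig a s))) th =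
    sol (fun s => mxA (fsig n' P Q th f s)) th.
  apply: (sol_ext bA' bA (T := th)); last by rewrite th0 lexx.
  move=> s sth; have s0 : 0 <= s by case/andP: sth => /ltW.
  have tcs : 0 <= tc + s by rewrite addr_ge0// ltW.
  rewrite /Defs.shift /msig rsigE// a2// /fsig restrict_sigE//.
  by rewrite /segment0 /= in_itv/= s0; case/andP: sth.
rewrite -E; exact: (pmul_le_div ga0 (le_trans (gaP _) h)).
Qed.

End FamilyBound.

(** * Assumption A3 on the whole space *)

Section FullCompression.
Variable R : realType.

(** Here the projection and its dual are the identity up to coordinates. The columns of [E] are the
    basis used by [mx_of_end]; rectangular matrices bridge two dimensions which are equal but not
    convertible. *)
Lemma compress_full d : exists (PV : 'Hom('cV[R]_d, subvs_of {:'cV[R]_d}))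
    (PS : 'Hom(subvs_of {:'cV[R]_d}, 'cV[R]_d))
    (E : 'M[R]_(d, _)) (E' : 'M[R]_(_, d)),
  [/\ is_projection PV, is_dual PV PS, E *m E' = 1%:M, E' *m E = 1%:M &
      forall A, compress PV PS A = E' *m A *m E].
Proof.
pose V := subvs_of {:'cV[R]_d}.
pose PV : 'Hom('cV[R]_d, V) := linfun (vsproj fullv).
pose PS : 'Hom(V, 'cV[R]_d) := linfun vsval.
have PVE y : PV y = vsproj fullv y by rewrite lfunE.
have PSE x : PS x = vsval x by rewrite lfunE.
have vPV y : vsval (PV y) = y by rewrite PVE vsprojK// memvf.
pose b := vbasis {:V}.
pose E : 'M[R]_(d, \dim {:V}) := \matrix_(i, j) vsval b`_j i 0.
pose E' : 'M[R]_(\dim {:V}, d) := \matrix_(i, j) coord b i (PV (delta_mx j 0)).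
have Ecol j : col j E = vsval b`_j by apply/colP => i; rewrite !mxE.
have E'm (y : 'cV[R]_d) i : (E' *m y) i 0 = coord b i (PV y).
  rewrite [in RHS](matrix_sum_delta y) mxE linear_sum [RHS]linear_sum/=.
  apply: eq_bigr => j _; rewrite (big_ord1 _ (fun k => y j k *: delta_mx j k)).
  by rewrite !linearZ/= mxE mulrC.
have fb : free b by exact: basis_free (vbasisP _).
have Em (z : 'cV[R]_(\dim {:V})) : E *m z = vsval (\sum_i z i 0 *: b`_i).
  apply/colP => i; rewrite mxE linear_sum/= summxE; apply: eq_bigr => j _.
  by rewrite !mxE mulrC.
exists PV, PS, E, E'; split.
- by move=> x; rewrite PVE vsvalK.
- move=> x y; rewrite vPV PSE -[RHS]trmxK trmx_mul trmxK.
  by apply/matrixP => i j; rewrite [RHS]mxE (ord1 i) (ord1 j).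
- apply/matrixP => i j; rewrite -[LHS](_ : (col j (E *m E')) i 0 = _); last by rewrite mxE.
  rewrite colE -mulmxA Em; under eq_bigr do rewrite E'm.
  by rewrite -(coord_vbasis (memvf _)) vPV !mxE eqxx andbT.
- apply/matrixP => i j; rewrite -[LHS](_ : (col j (E' *m E)) i 0 = _); last by rewrite mxE.
  rewrite colE -mulmxA -colE Ecol E'm; have -> : PV (vsval b`_j) = b`_j by rewrite PVE vsvalK.
  by rewrite coord_free// mxE eq_sym.
- move=> A; apply/matrixP => i j; rewrite -[RHS](_ : (col j (E' *m A *m E)) i 0 = _); last by rewrite mxE.
  by rewrite colE -!mulmxA -colE Ecol E'm !mxE PSE.
Qed.

Lemma sol_conj d q c (A : R -> 'M[R]_d) (E : 'M[R]_(d, q)) (E' : 'M[R]_(q, d)) :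
  bsig c A -> E *m E' = 1%:M -> E' *m E = 1%:M ->
  exists2 c', bsig c' (fun s => E' *m A s *m E) &
    forall t, 0 <= t -> sol (fun s => E' *m A s *m E) t = E' *m sol A t *m E.
Proof.
move=> bA EE E'E; have bE := bsig_mulr E (bsig_mull E' bA).
eexists; first exact: bE.
move=> t t0; rewrite -[LHS]mulmx1.
have lS : mlbm (fun s => E' *m sol A s *m E).
  apply: mlbmM; last exact: mlbm_cst.
  by apply: mlbmM; [exact: mlbm_cst|exact: sol_mlbm bA].
apply/esym; apply: (sol_unique bE lS (T := t)); last by rewrite t0 lexx.
move=> s st; rewrite {1}(solE bA) mulmxDr mulmxDl mulmx1 E'E; congr (_ + _).
have jA := sol_mloc bA.
rewrite -mprim_mull// -mprim_mulr; last by apply: mlocM => //; exact: mlbm_cst.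
congr mprim; apply/funext => u.
by rewrite !mulmxA -(mulmxA (E' *m A u) E E') EE mulmx1.
Qed.

(** From V^-1 - W^-1 = V^-1 (W - V) W^-1: when V is close to W, the right-hand side is at most
    |V^-1| / 2, hence |V^-1| <= 2 |W^-1|, and the identity then gives a Lipschitz bound at W. *)
Lemma invmx_near d (W : 'M[R]_d) : W \in unitmx ->
  {for W, continuous (@invmx R d)}.
Proof.
move=> uW; have [e0 e00 eP] := unitmx_open uW.
pose k := d%:R * d%:R * `|invmx W| + 1.
have k0 : 0 < k by rewrite ltr_wpDl// !mulr_ge0// normr_ge0.
have dk : d%:R * d%:R * `|invmx W| <= k by rewrite lerDl.
have main (V : 'M[R]_d) : `|V - W| <= Num.min e0 (2^-1 / k) ->
    `|invmx V - invmx W| <= 2 * `|invmx W| * k * `|V - W|.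
  rewrite le_min => /andP[V1 V2]; have uV := eP V V1.
  have D : invmx V - invmx W = invmx V *m ((W - V) *m invmx W).
    by rewrite mulmxBl mulmxBr mulmxV// mulmx1 mulmxA mulVmx// mul1mx.
  have h1 : `|invmx V - invmx W| <= `|invmx V| * (k * `|V - W|).
    rewrite D (le_trans (mx_normM _ _))//.
    have h := mx_normM (W - V) (invmx W); rewrite distrC in h.
    have := normr_ge0 (invmx V); have := normr_ge0 (V - W).
    move: h dk; set x := `|_ *m _|; set y := `|V - W|; set z := `|invmx V|.
    set w := `|invmx W| => h hk y0 z0.
    rewrite -mulrA mulrCA ler_wpM2l//.
    apply: (@le_trans _ _ (d%:R * (d%:R * y * w))); first by rewrite ler_wpM2l.
    have -> : d%:R * (d%:R * y * w) = (d%:R * d%:R * w) * y by ring.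
    by rewrite ler_wpM2r.
  have h2 : `|invmx V| <= 2 * `|invmx W|.
    have := ler_normD (invmx V - invmx W) (invmx W); rewrite subrK => h.
    have hk : k * `|V - W| <= 2^-1 by rewrite mulrC -ler_pdivlMr.
    have : `|invmx V| * (k * `|V - W|) <= `|invmx V| * 2^-1 by rewrite ler_wpM2l.
    by move: h h1; lra.
  apply: le_trans h1 _; rewrite -(mulrA (2 * _)) ler_wpM2r//.
  by rewrite mulr_ge0// ltW.
have h := @cvgrPdist_le R _ _ (nbhs W) _ (@invmx R d) (invmx W).
apply/h => e ee.
pose L := 2 * `|invmx W| * k + 1.
have L0 : 0 < L by rewrite ltr_wpDl// !mulr_ge0// ltW.
have m0 : 0 < Num.min (Num.min e0 (2^-1 / k)) (e / L).
  by rewrite !lt_min e00 !divr_gt0.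
have := @nbhsx_ballx _ _ W _ m0.
apply: filterS => V; rewrite -ball_normE/= distrC => /ltW.
rewrite le_min => /andP[V1 V2]; rewrite distrC (le_trans (main V V1))//.
apply: (@le_trans _ _ (L * `|V - W|)); first by rewrite ler_wpM2r// lerDl.
by rewrite mulrC -ler_pdivlMr.
Qed.

(** A3 bounds a product containing a matrix of [K]; removing that matrix costs the norm of its
    inverse, which compactness makes uniform. *)
Lemma compact_invmx d (K : set 'M[R]_d) : compact K -> K `<=` [set k | k \in unitmx] ->
  exists2 b, 0 <= b & forall k, K k -> `|invmx k| <= b.
Proof.
move=> cK Ku; have ci : {within K, continuous (@invmx R d)}.
  by apply: continuous_in_subspaceT => W; rewrite inE => /Ku; exact: invmx_near.
have [b [_ bP]] := compact_bounded (continuous_compact ci cK).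
exists (`|b| + 1); first by rewrite addr_ge0.
move=> k Kk; apply: (bP (`|b| + 1)) => /=; last by exists k.
by rewrite (le_lt_trans (ler_norm b))// ltrDl.
Qed.

(* On the whole space, compressing is conjugating by a fixed isomorphism. *)
Lemma A3_compare d (S : set (R -> 'M[R]_d)) (F : R -> set (R -> 'M[R]_d)) :
  (forall A, S A -> exists c A0, bsig c A0 /\ forall s, 0 <= s -> A s = A0 s) ->
  (forall t A, 0 <= t -> F t A ->
    exists c A0, bsig c A0 /\ forall s, 0 <= s <= t -> A s = A0 s) ->
  compressions_A3 S F ->
  exists2 k, 0 <= k & forall t A, 0 <= t -> S A -> exists (th : R) A',
    [/\ t <= th, F th A' & `|flow A t 0| <= k * `|flow A' th 0|].
Proof.
move=> SB FB A3; have [PV [PS [E [E' [pV dV EE E'E cE]]]]] := compress_full d.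
have [_ [C [De [K [C0 De0 cK Ku H]]]]] := A3 _ _ _ pV dV.
have [b b0 bP] := compact_invmx cK Ku.
move: E E' EE E'E cE C0 cK Ku H bP.
set q := \dim _ => E E' EE E'E cE C0 cK Ku H bP.
have conj (A A0 : R -> 'M[R]_d) (B : R -> 'M[R]_q) (c t : R) : 0 <= t -> bsig c A0 ->
    (forall s, 0 <= s <= t -> A s = A0 s) ->
    (forall s, 0 <= s <= t -> B s = compress PV PS (A s)) ->
    flow A t 0 = sol A0 t /\ flow B t 0 = E' *m sol A0 t *m E.
  move=> t0 bA AA BA; split; first exact: (flow_sol t0 bA).
  have [c' bE <-//] := sol_conj bA EE E'E.
  by apply: (flow_sol t0 bE) => s st; rewrite BA// AA.
(* The constant of the expression [XE] below: the bounds on its factors other than [Y], with one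
   dimension per product from [mx_normM]. *)
pose k := q%:R * (q%:R * `|E| * (q%:R * (q%:R * C * (d%:R * (d%:R * `|E'|) * `|E|)) * b)) * `|E'|.
exists k; first by rewrite !mulr_ge0// ?normr_ge0.
move=> t A t0 SA.
have [c [A0 [bA AA]]] := SB A SA.
have SB' : class_image (@halfline R) (compress PV PS) S (fun s => compress PV PS (A s)).
  by exists A.
have [kk [th [B [Kk /andP[tth _] [A' FA' BA'] HC _]]]] := H t _ t0 SB'.
have th0 : 0 <= th by exact: le_trans tth.
have [c' [A0' [bA' AA']]] := FB th A' th0 FA'.
exists th, A'; split=> //.
have [-> f2] := conj A A0 (fun s => compress PV PS (A s)) c t t0 bA
   (fun s (st : 0 <= s <= t) => AA s (proj1 (andP st))) (fun s _ => erefl).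
have [-> f4] := conj A' A0' B c' th th0 bA' AA'
   (fun s st => BA' s (mem_set (st : segment0 th s))).
rewrite f2 f4 in HC.
set X := sol A0 t in HC *; set Y := sol A0' th in HC *.
have uY : Y \in unitmx := sol_unit bA' th.
have uk : kk \in unitmx := Ku _ Kk.
set Z := (_ *m _ *m invmx _) in HC.
have uEY : E' *m Y *m E \in unitmx.
  have h : (E' *m invmx Y *m E) *m (E' *m Y *m E) = 1%:M.
    rewrite !mulmxA -(mulmxA (E' *m invmx Y) E E') EE mulmx1.
    by rewrite -(mulmxA E' (invmx Y) Y) mulVmx// mulmx1 E'E.
  by have [] := mulmx1_unit h.
(* The flow [X] is recovered from [Z], the quantity bounded by A3, by multiplying back by the flow
   of the family and by the inverse of [kk]. *)
have XE : X = E *m (Z *m (E' *m Y *m E) *m invmx kk) *m E'.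
  rewrite /Z -(mulmxA _ (invmx _)) mulVmx// mulmx1 -(mulmxA _ kk) mulmxV// mulmx1.
  by rewrite !mulmxA EE mul1mx -mulmxA EE mulmx1.
rewrite {1}XE.
have mM k1' k2 k3 (U : 'M[R]_(k1', k2)) (V : 'M[R]_(k2, k3)) u v : `|U| <= u -> `|V| <= v ->
    `|U *m V| <= k2%:R * u * v.
  move=> hu hv; apply: le_trans (mx_normM _ _) _.
  rewrite -!mulrA ler_wpM2l//; apply: ler_pM => //; exact: normr_ge0.
have nk := bP _ Kk.
have s1 := mM _ _ _ _ _ _ _ (mM _ _ _ E' Y _ _ (lexx _) (lexx _)) (lexx `|E|).
have s2 := mM _ _ _ _ _ _ _ (mM _ _ _ Z _ _ _ HC s1) nk.
have s3 := mM _ _ _ _ _ _ _ (mM _ _ _ E _ _ _ (lexx _) s2) (lexx `|E'|).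
apply: le_trans s3 _; rewrite le_eqVlt; apply/orP; left; apply/eqP.
rewrite /k; set y := `|Y|; set e := `|E|; set e' := `|E'|.
ring.
Qed.

End FullCompression.

(** * The spectral radius *)

Section SpectralRadius.
Variable R : realType.
Variables (d : nat) (S : set (R -> 'M[R]_d)).

(** The factor K^(1/t) tends to 1: for t larger than |ln K| / de it is at most exp de, where de is
    the room between w and ln (exp w + e). *)
Lemma radius_le K w : 0 < K ->
  (forall A t, S A -> 0 <= t -> `|flow A t 0| <= K * expR (w * t)) ->
  (gen_spectral_radius S <= (expR w)%:E)%E.
Proof.
move=> K0 H; apply/lee_addgt0Pr => e e0.
pose de := ln (expR w + e) - w.
have ee0 : 0 < expR w + e by rewrite addr_gt0// expR_gt0.
have de0 : 0 < de.
  by rewrite /de subr_gt0 -[ltLHS](expRK w) ltr_ln ?posrE ?expR_gt0// ltrDl.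
pose N := `|ln K| / de.
have N0 : 0 <= N by rewrite divr_ge0// ltW.
have VN : pinfty_nbhs R [set t | N < t] by exists N; rewrite num_real.
apply: le_trans (ereal_inf_lbound _) _.
  by exists [set t | N < t]; first exact: VN.
apply: ge_ereal_sup => _ [t /= Nt <-].
apply: ge_ereal_sup => _ [A SA <-].
have t0 : 0 < t by exact: le_lt_trans Nt.
rewrite -EFinD lee_fin.
have h := H A t SA (ltW t0).
have p0 : 0 <= K * expR (w * t) by rewrite mulr_ge0 ?expR_ge0// ltW.
apply: (@le_trans _ _ ((K * expR (w * t)) `^ t^-1)).
  by apply: ge0_ler_powR; rewrite ?nnegrE ?invr_ge0 ?(ltW t0)//; exact: normr_ge0.
have p1 : 0 < K * expR (w * t) by rewrite mulr_gt0 ?expR_gt0.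
rewrite /powR gt_eqF// lnM ?posrE ?expR_gt0// expRK.
rewrite -[leRHS]lnK ?posrE// ler_expR mulrDr (mulrC w) mulKf ?gt_eqF//.
rewrite -lerBrDr -/de.
rewrite ler_pdivrMl//; apply: le_trans (ler_norm _) _.
by move: Nt; rewrite /N ltr_pdivrMr// => /ltW.
Qed.

Lemma radius_lt1 c : 0 <= c ->
  (forall A t, S A -> 0 <= t -> `|flow A t 0| <= 2 * expR (c * t)) ->
  (gen_spectral_radius S < 1)%E ->
  exists K l, [/\ 0 < l, 0 <= K &
    forall A t, S A -> 0 <= t -> `|flow A t 0| <= K * expR (- l * t)].
Proof.
move=> c0 growth /ereal_inf_lt [_ [V [N [_ VN]] <-] sV].
have [q [q0 q1 qV]] : exists q : R, [/\ 0 < q, q < 1 &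
    forall A t, N < t -> S A -> `|flow A t 0| `^ t^-1 <= q].
  have [q qE] : exists2 q : R, q < 1 & (ereal_sup [set ereal_sup
      [set (`|flow A t 0| `^ t^-1)%:E | A in S] | t in V] <= q%:E)%E.
    move: sV; case: ereal_sup => [s| |]; rewrite ?lte_fin ?ltNge ?leey// => s1.
      by exists s => //; rewrite ltNge.
    by exists 0; rewrite ?ltr01// leNye.
  (* The maximum keeps the bound positive, so that [ln q] below is meaningful. *)
  move=> sq; exists (Num.max q 2^-1); split.
  - by rewrite lt_max; apply/orP; right; rewrite invr_gt0.
  - by rewrite gt_max qE/=; lra.
  - move=> A t Nt SA; rewrite le_max; apply/orP; left; rewrite -lee_fin.
    apply: le_trans sq; apply: le_trans; last first.
      by apply: ereal_sup_ubound; exists t; [exact: VN|reflexivity].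
    by apply: ereal_sup_ubound; exists A.
pose l := - ln q; have l0 : 0 < l by rewrite oppr_gt0 ln_lt0// q0.
pose N' := `|N| + 1.
have N'0 : 0 < N' by rewrite ltr_wpDl.
(* After [N'] the constant 1 is enough; before it the growth bound is used, and exp(l N') makes up
   for the decay demanded. *)
pose K := Num.max 1 (2 * expR (c * N') * expR (l * N')).
exists K, l; split=> //; first by rewrite le_max ler01.
move=> A t SA t0; have [tN|Nt] := leP t N'.
  apply: (@le_trans _ _ (2 * expR (c * N') * expR (l * N') * expR (- l * t))).
    apply: le_trans (growth A t SA t0) _.
    rewrite -mulrA -mulrA ler_pM2l// -!expRD ler_expR.
    have : c * t <= c * N' by rewrite ler_wpM2l.
    have : l * t <= l * N' by rewrite ler_wpM2l// ltW.
    lra.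
  by rewrite ler_wpM2r ?expR_ge0// /K le_max lexx orbT.
have t1 : 0 < t by exact: lt_trans Nt.
have NtN : N < t by apply: le_lt_trans Nt; rewrite /N' (le_trans (ler_norm _))// lerDl.
have h := qV A t NtN SA.
apply: (@le_trans _ _ (expR (- l * t))); last first.
  by rewrite ler_peMl ?expR_ge0// /K le_max lexx.
have -> : `|flow A t 0| = (`|flow A t 0| `^ t^-1) `^ t.
  by rewrite -powRrM mulVf ?gt_eqF// powRr1// normr_ge0.
have -> : expR (- l * t) = q `^ t by rewrite /powR gt_eqF// /l opprK mulrC.
by apply: ge0_ler_powR; rewrite ?nnegrE ?powR_ge0 ?(ltW q0).
Qed.

(* If every flow were small at some common time, submultiplicativity would make
   all of them decay exponentially. *)
Lemma radius1_lower K : 0 < K ->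
  (forall A t, S A -> 0 <= t -> `|flow A t 0| <= K) ->
  (forall A s, S A -> 0 <= s -> exists2 A1, S A1 & forall t, 0 <= t ->
     flow A (s + t) 0 = flow A1 t 0 *m flow A s 0) ->
  gen_spectral_radius S = 1%E ->
  exists2 e, 0 < e & forall t, 0 < t -> exists2 A, S A & e <= `|flow A t 0|.
Proof.
(* [D] is the dimension factor of [mx_normM], plus 1 to be positive; multiplying by a flow of norm
   below 1 / (2 D) at least halves a norm. *)
move=> K0 HK sub r1; pose D := d%:R + 1 : R.
have D0 : 0 < D by rewrite ltr_wpDl.
exists (D^-1 / 2); first by rewrite divr_gt0// invr_gt0.
move=> t0 t00; apply: contrapT => nA.
have small A : S A -> D * `|flow A t0 0| <= 2^-1.
  move=> SA; rewrite mulrC -ler_pdivlMr// mulrC leNgt; apply/negP => h; apply: nA.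
  by exists A => //; exact: ltW.
have iter k A t : S A -> 0 <= t -> `|flow A (k%:R * t0 + t) 0| <= D * K * 2^-1 ^+ k.
  elim: k A => [|k IH] A SA tt.
    rewrite mul0r add0r expr0 mulr1 (le_trans (HK _ _ SA tt))//.
    by rewrite ler_peMl ?(ltW K0)// /D lerDr.
  have -> : k.+1%:R * t0 + t = t0 + (k%:R * t0 + t) by rewrite -[k.+1]addn1 natrD; ring.
  have [A1 SA1 ->] := sub A t0 SA (ltW t00); last first.
    by rewrite addr_ge0// mulr_ge0// ltW.
  have h1 := IH A1 SA1 tt; have h2 := small A SA.
  rewrite (le_trans (mx_normM _ _))//; set x := `|_| in h1 *; set y := `|_| in h2 *.
  have x0 : 0 <= x := normr_ge0 _; have y0 : 0 <= y := normr_ge0 _.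
  rewrite exprSr mulrA.
  apply: (@le_trans _ _ (x * (D * y))).
    rewrite mulrAC mulrC ler_wpM2l// ler_wpM2r// /D lerDl//.
  by apply: ler_pM => //; rewrite mulr_ge0// ltW.
pose l := ln 2 / t0.
have l0 : 0 < l by rewrite divr_gt0// ln_gt0// ltr1n.
have : (gen_spectral_radius S <= (expR (- l))%:E)%E.
  (* Halving once every [t0] is decay at the rate ln 2 / t0; the factor 2 covers the incomplete last
     period. *)
  apply: (@radius_le (2 * (D * K))); first by rewrite !mulr_gt0.
  move=> A t SA tt; pose k := Num.truncn (t / t0).
  have kt : 0 <= t / t0 by rewrite divr_ge0// ltW.
  have /andP[k1 k2] := truncn_itv kt; rewrite -/k in k1 k2.
  have kt0 : k%:R * t0 <= t by rewrite -ler_pdivlMr.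
  have := iter k A (t - k%:R * t0) SA; rewrite subr_ge0 addrC subrK => /(_ kt0) h.
  apply: le_trans h _.
  rewrite -(mulrA 2) (mulrCA 2 (D * K)) ler_wpM2l ?mulr_ge0 ?(ltW D0) ?(ltW K0)//.
  have -> : 2^-1 ^+ k = expR (- (k%:R * ln 2)) :> R.
    by rewrite expRN expRM_natl lnK ?posrE// exprVn.
  apply: (@le_trans _ _ (expR (ln 2) * expR (- l * t))); last by rewrite lnK ?posrE.
  rewrite -expRD ler_expR.
  have -> : - l * t = - (t / t0 * ln 2) by rewrite /l; ring.
  have : t / t0 * ln 2 <= k.+1%:R * ln 2 :> R.
    by rewrite ler_wpM2r ?(ltW k2)// ln_ge0// ler1n.
  by rewrite -[k.+1]addn1 natrD; lra.
rewrite r1 lee_fin leNgt => /negP; apply.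
by rewrite expR_lt1 oppr_lt0.
Qed.

End SpectralRadius.

(** * Bounded flows and the critical radius *)

Section Dichotomy.
Variable R : realType.

(** A canonical vector works, as the norm is the largest entry; the loss of a factor 2 leaves a
    strict inequality to contradict. *)
Lemma norm_col_ge k l (A : 'M[R]_(k, l)) e : 0 < e -> e <= `|A| ->
  exists x, sqn x = 1 /\ e / 2 <= `|A *m x|.
Proof.
move=> e0 eA; apply: contrapT => H.
have : `|A| <= e / 2.
  apply: mx_norm_le => [|i j]; first by rewrite divr_ge0// ltW.
  rewrite leNgt; apply/negP => h; apply: H; exists (delta_mx j 0); split.
    rewrite /sqn (bigD1 j)//= big1 ?addr0 => [|q qj]; first by rewrite mxE !eqxx expr1n.
    by rewrite mxE (negbTE qj) expr0n.
  apply: le_trans (ltW h) _.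
  have <- : (A *m (delta_mx j 0 : 'cV[R]_l)) i 0 = A i j by rewrite -colE mxE.
  exact: mx_norm_lb.
by lra.
Qed.

Variables (n m p r n' : nat) (M : set (triple R n m p)) (c : R).
Hypothesis c0 : 0 <= c.
Hypothesis Mc : forall s, M s -> [/\ `|mxA s| <= c, `|mxB s| <= c & `|mxC s| <= c].
Variables (T : set (R -> triple R n m p)) (G : R -> set (R -> triple R n m p)).
Hypothesis TM : T `<=` Linfty_triple (@halfline R) M.
Hypothesis GM : forall t : R, 0 <= t -> G t `<=` Linfty_triple (segment0 t) M.
Hypothesis GT : concat_infty G `<=` T.
Variables (P : 'M[R]_n) (Q : 'M[R]_r).
Hypothesis PQ : minimal_realization n' M P Q.
Let Tmin : set (R -> triple R n' m p) := class_image (@halfline R) (min_map n' P Q) T.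
Let Gmin : R -> set (R -> triple R n' m p) :=
  fun t => class_image (segment0 t) (min_map n' P Q) (G t).
Hypothesis A0 : assumption_A0 (classA Tmin).
Notation msig := (msig n' P Q).

Lemma classA_growth : exists2 w, 0 <= w & forall A t, classA Tmin A -> 0 <= t ->
  `|flow A t 0| <= 2 * expR (w * t).
Proof.
have [c1 bm1] := @tsig_min R n m p r n' P Q c.
pose c' := Num.max 0 c1; have c'0 : 0 <= c' by rewrite le_max lexx.
exists (rate n' c'); first exact: ltW (rate_gt0 _ c'0).
move=> A t /(classA_msig c0 Mc TM)[a Ta aE] t0.
rewrite (aE t t0).
have [bA _ _] := bm1 _ (rsig_tsig c0 Mc TM Ta).
by apply: sol_growth t0; apply: bsig_le bA; rewrite le_max lexx orbT.
Qed.

Lemma classA_cat A s : classA Tmin A -> 0 <= s -> exists2 A1, classA Tmin A1 &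
  forall t, 0 <= t -> flow A (s + t) 0 = flow A1 t 0 *m flow A s 0.
Proof.
move=> /(classA_msig c0 Mc TM)[a Ta aE] s0.
have [A1 SA1 A1E] := msig_shift_flow c0 Mc TM A0 Ta s0.
exists A1 => // t t0; rewrite !aE ?addr_ge0// A1E//.
have [c' bm] := @tsig_min R n m p r n' P Q c.
have [bA _ _] := bm _ (rsig_tsig c0 Mc TM Ta).
exact: (sol_shift bA s0 t0).
Qed.

Lemma classA_bsig A : classA Tmin A ->
  exists c A', bsig c A' /\ forall s, 0 <= s -> A s = A' s.
Proof.
move=> [b [a Ta bE] AE]; have [c' bm] := @tsig_min R n m p r n' P Q c.
have [bA _ _] := bm _ (rsig_tsig c0 Mc TM Ta).
exists c'; eexists; split; first exact: bA.
move=> s s0; have sh : s \in @halfline R by rewrite inE/= /halfline/= in_itv/= s0.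
by rewrite AE// bE// rsigE.
Qed.

Lemma familyA_bsig t A : 0 <= t -> familyA Gmin t A ->
  exists c A', bsig c A' /\ forall s, 0 <= s <= t -> A s = A' s.
Proof.
move=> t0 [b [f Gf bE] AE]; have [c' bm] := @tsig_min R n m p r n' P Q c.
have [bA _ _] := fsig_tsig c0 Mc GM bm t0 Gf.
exists c'; eexists; split; first exact: bA.
move=> s st; have sh : s \in segment0 t by rewrite inE.
by rewrite AE// bE// /fsig restrict_sigE// -inE.
Qed.

(** Read backwards: a state of a given size at time [th] cannot have been too small at an earlier
    time [s]. *)
Lemma state_bound B a tc th s (x : 'cV[R]_n') :
  (forall A t, classA Tmin A -> 0 <= t -> `|flow A t 0| <= B) ->
  T a -> 0 <= tc -> 0 <= s <= th ->
  `|sol (Defs.shift tc (fun q => mxA (msig a q))) th *m x| <=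
  n'%:R * B * `|sol (Defs.shift tc (fun q => mxA (msig a q))) s *m x|.
Proof.
move=> BP Ta tc0 /andP[s0 sth]; set Z := sol _.
have [c' bm] := @tsig_min R n m p r n' P Q c.
have [bA _ _] := tsig_shift tc (bm _ (rsig_tsig c0 Mc TM Ta)).
have {}bA : bsig c' (Defs.shift tc (fun q => mxA (msig a q))) := bA.
have ths : 0 <= th - s by rewrite subr_ge0.
have ss : 0 <= tc + s by rewrite addr_ge0.
have [A1 SA1 A1E] := msig_shift_flow c0 Mc TM A0 Ta ss.
have -> : Z th = flow A1 (th - s) 0 *m Z s.
  have := sol_shift bA s0 ths; rewrite addrC subrK => e.
  by rewrite shift_shift in e; rewrite (A1E _ ths); exact: e.
rewrite -mulmxA; apply: le_trans (mx_normM _ _) _.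
by rewrite ler_wpM2r ?normr_ge0// ler_wpM2l// BP.
Qed.

Hypothesis A3 : compressions_A3 (classA Tmin) (familyA Gmin).
Hypothesis T2 : assumption_T2 (min_map n' P Q @` M) Gmin.
Hypothesis M0 : M !=set0.
Variable g : R.
Hypothesis g0 : 0 <= g.
Hypothesis gP : forall a u x, T a -> L2 u -> ~ ae_zero u -> trajectory a u x ->
    (energy (output a x) <= g%:E * energy u)%E.

Lemma classA_bounded : exists2 K, 0 < K &
  forall A t, classA Tmin A -> 0 <= t -> `|flow A t 0| <= K.
Proof.
have [k k0 kP] := A3_compare classA_bsig familyA_bsig A3.
have [K K0 KP] := family_bound c0 Mc M0 TM GM GT PQ T2 g0 gP.
exists (k * K + 1); first by rewrite ltr_wpDl// mulr_ge0.
move=> A t SA t0; have [th [A' [tth FA' h]]] := kP t A t0 SA.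
apply: le_trans h _; apply: (@le_trans _ _ (k * K)); last by rewrite lerDl.
by rewrite ler_wpM2l// (KP th)// (le_trans t0).
Qed.

(** Gramians add up over the [N] consecutive windows of length [t0], each observed from the state at
    its beginning. *)
Lemma og_repeat (a : R -> triple R n' m p) c1 s t0 al (x : 'cV[R]_n') N : tsig c1 a ->
  0 <= s -> 0 <= t0 ->
  (forall j, (j < N)%N -> al <= qf (ogt (Defs.shift (s + j%:R * t0) a) t0)
     (sol (Defs.shift s (fun q => mxA (a q))) (j%:R * t0) *m x)) ->
  N%:R * al <= qf (ogt (Defs.shift s a) (N%:R * t0)) x.
Proof.
move=> ta s0 t00; have [bA bB bC] := tsig_shift s ta.
elim: N => [|N IH] H; first by rewrite !mul0r; exact: (qf_og_ge0 bA bC).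
have Nt : 0 <= N%:R * t0 by rewrite mulr_ge0.
have E : N.+1%:R * t0 = N%:R * t0 + t0 by rewrite -[N.+1]addn1 natrD mulrDl mul1r.
rewrite E /ogt (og_cat bA bC Nt t00) qfD qfE -[N.+1]addn1 natrD mulrDl mul1r.
apply: lerD; first by apply: IH => j jN; apply: H; exact: ltnW.
have := H N (ltnSn N); rewrite -(shift_shift s); exact.
Qed.

Lemma classA_not_observable : gen_spectral_radius (classA Tmin) = 1%E ->
  ~ uniformly_observable Tmin.
Proof.
move=> r1 [t0 [ga [t00 ga0 UO]]].
have [B B0 BP] := classA_bounded.
have [e e0 eP] := radius1_lower B0 BP classA_cat r1.
have [k k0 kP] := A3_compare classA_bsig familyA_bsig A3.
have [tc [gc [K [tc0 Gc K0 KP]]]] := steered_output c0 Mc M0 TM GM PQ T2 g0 gP.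
have [c' bm] := @tsig_min R n m p r n' P Q c.
(* What remains of [e] after the A3 comparison; the 1 avoids a division by 0. *)
pose e1 := e / (k + 1).
have k10 : 0 < k + 1 by rewrite ltr_wpDl.
have e10 : 0 < e1 by rewrite divr_gt0.
pose D := n'%:R * B + 1.
have D0 : 0 < D by rewrite ltr_wpDl// mulr_ge0// ltW.
(* The output energy guaranteed by each window of length [t0]: by [norm_col_ge] and [state_bound],
   the state there is at least e1 / 2 / D. *)
pose e2 := ga * (e1 / 2 / D) ^+ 2.
have e20 : 0 < e2 by rewrite mulr_gt0// exprn_gt0// !divr_gt0.
(* So many windows of energy [e2] exceed [K], the energy that the gain allows. *)
pose N := (Num.truncn (K / e2)).+1.
have Nt : 0 < N%:R * t0 by rewrite mulr_gt0// ltr0n.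
have [A SA Ae] := eP _ Nt.
have [th [A' [tth FA' Ak]]] := kP _ _ (ltW Nt) SA.
have th0 : 0 < th by exact: lt_le_trans tth.
have [f Gf fE] := familyA_sol c0 Mc GM bm (ltW th0) FA'.
have A'e : e1 <= `|flow A' th 0|.
  rewrite ler_pdivrMr// mulrC; apply: le_trans Ae _; apply: le_trans Ak _.
  by rewrite ler_wpM2r// lerDl.
have tt : 0 <= th <= th by rewrite (ltW th0) lexx.
rewrite (fE th tt) in A'e.
(* Further copies of [f] fill the tail of the infinite concatenation. *)
have [a [aG a1 a2 _]] := three_blocks (ltW tc0) (ltW th0) th0 Gc Gf Gf.
have Ta := GT aG.
have ta : tsig c' (msig a) := bm _ (rsig_tsig c0 Mc TM Ta).
have [bA _ _] := tsig_shift tc ta.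
have [bf _ _] := fsig_tsig c0 Mc GM bm (ltW th0) Gf.
pose Z := sol (Defs.shift tc (fun s => mxA (msig a s))).
have ZE : sol (fun s => mxA (fsig n' P Q th f s)) th = Z th.
  apply/esym; apply: (sol_ext bA bf (T := th)); last by rewrite (ltW th0) lexx.
  move=> s sth; have s0 : 0 <= s by case/andP: sth => /ltW.
  have tcs : 0 <= tc + s by rewrite addr_ge0// ltW.
  rewrite /Defs.shift /msig rsigE// a2// /fsig restrict_sigE//.
  by rewrite /segment0 /= in_itv/= s0; case/andP: sth.
rewrite ZE in A'e; have [x [x1 xe]] := norm_col_ge e10 A'e.
have low s : 0 <= s <= th -> e1 / 2 / D <= `|Z s *m x|.
  move=> sth; rewrite (ler_pdivrMr _ _ D0) [leRHS]mulrC; apply: le_trans xe _.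
  have h := state_bound x BP Ta (ltW tc0) sth.
  apply: le_trans h _.
  by apply: ler_wpM2r; [exact: normr_ge0|rewrite /D lerDl].
have sum : N%:R * e2 <= qf (ogt (Defs.shift tc (msig a)) (N%:R * t0)) x.
  apply: (og_repeat ta (ltW tc0) (ltW t00)) => j jN.
  have jt : 0 <= j%:R * t0 := mulr_ge0 (ler0n _ _) (ltW t00).
  have js : 0 <= tc + j%:R * t0 := addr_ge0 (ltW tc0) jt.
  have := UO (msig a) (tc + j%:R * t0) (msig_Tmin n' P Q Ta) js (Z (j%:R * t0) *m x).
  have [bAj _ _] := tsig_shift (tc + j%:R * t0) ta.
  rewrite (obs_gramian_ogt bAj (ltW t00) (fun s _ => erefl)) sqnE; apply: le_trans.
  apply: (ler_wpM2l (ltW ga0)); apply: le_trans (sqn_norm _).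
  have l0 : 0 <= e1 / 2 / D := divr_ge0 (divr_ge0 (ltW e10) (ler0n _ 2)) (ltW D0).
  (* Each window starts before N t0 <= th, where the lower bound on the state holds. *)
  have := low (j%:R * t0); rewrite jt; set z := `|_| => lz.
  have {}lz : e1 / 2 / D <= z.
    apply/lz/(le_trans _ tth)/(ler_wpM2r (ltW t00)).
    by rewrite ler_nat; exact: ltnW.
  exact: (ler_pM l0 l0 lz lz).
have := KP a Ta a1 0 (N%:R * t0) x (lexx 0) (ltW Nt).
have Z0 : sol (Defs.shift tc (fun s => mxA (msig a s))) 0 = 1%:M := sol0 bA.
rewrite addr0 Z0 mul1mx x1 mulr1 => /(le_trans sum).
rewrite -(ler_pdivlMr _ _ e20) leNgt => /negP; apply; exact: truncnS_gt.
Qed.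

End Dichotomy.

(** * Assembly of the upper and lower estimates *)

Theorem theorem25 (R : realType) (n m p : nat)
  (n_gt0 : (0 < n)%N) (m_gt0 : (0 < m)%N) (p_gt0 : (0 < p)%N)
  (M : set (triple R n m p)) (M_bounded : bounded_triples M)
  (T : set (R -> triple R n m p))
  (T_ext : class_ext (@halfline R) T)
  (T_sub : T `<=` Linfty_triple (@halfline R) M)
  (G : R -> set (R -> triple R n m p))
  (G_ext : forall t : R, 0 <= t -> class_ext (segment0 t) (G t))
  (G_sub : forall t : R, 0 <= t -> G t `<=` Linfty_triple (segment0 t) M)
  (GT : concat_infty G `<=` T)
  (r n' : nat) (P : 'M[R]_n) (Q : 'M[R]_r)
  (PQ : minimal_realization n' M P Q) :
  let Pi := min_map n' P Q in
  let Mmin : set (triple R n' m p) := Pi @` M in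
  let Tmin : set (R -> triple R n' m p) := class_image (@halfline R) Pi T in
  let Gmin : R -> set (R -> triple R n' m p) :=
    fun t => class_image (segment0 t) Pi (G t) in
  assumption_T1 Tmin Gmin ->
  assumption_T2 Mmin Gmin ->
  compressions_A3 (classA Tmin) (familyA Gmin) ->
  ((gen_spectral_radius (classA Tmin) < 1)%E -> L2gain T \is a fin_num) /\
  ((1 < gen_spectral_radius (classA Tmin))%E \/
   (gen_spectral_radius (classA Tmin) = 1%E /\ uniformly_observable Tmin) ->
   L2gain T = +oo%E).
Proof.
move=> Pi Mmin Tmin Gmin T1 T2 A3.
have [A0 _] := T1.
have [c1 Mc1] := M_bounded.
(* The bound in [bounded_triples] may be negative when [M] is empty. *)
pose c := Num.max 0 c1; have c0 : 0 <= c by rewrite le_max lexx.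
have Mc s : M s -> [/\ `|mxA s| <= c, `|mxB s| <= c & `|mxC s| <= c].
  by move=> /Mc1[h1 h2 h3]; split; rewrite le_max ?h1 ?h2 ?h3 orbT.
split=> [r1|rho].
  have [w w0 wP] := classA_growth n' c0 Mc T_sub P Q.
  have [K [l [l0 K0 KP]]] := radius_lt1 w0 wP r1.
  have [g g0 gP] := gain_upper c0 Mc T_sub PQ A0 l0 K0 KP.
  exact: finite_L2gain g0 gP.
apply: contrapT => /L2gain_bound[g g0 gP].
have rle : (gen_spectral_radius (classA Tmin) <= 1)%E.
  have [[a Ta]|T0] := pselect (T !=set0); last first.
    (* Over an empty class every exponential rate is a valid bound, so the radius is below 1. *)
    apply: le_trans (@radius_le _ _ _ 1 (-1) ltr01 _) _; last first.
      by rewrite lee_fin ltW// expR_lt1.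
    by move=> A t [b [a Ta _] _]; exfalso; apply: T0; exists a.
  have M0 : M !=set0.
    by exists (a 0); have [+ _ _] := T_sub _ Ta; apply; rewrite inE/= /halfline/= in_itv/= lexx.
  have [B B0 BP] := classA_bounded c0 Mc T_sub G_sub GT PQ A3 T2 M0 g0 gP.
  apply: le_trans (@radius_le _ _ _ B 0 B0 _) _; last by rewrite expR0.
  move=> A t SA t0.
  by rewrite mul0r expR0 mulr1; exact: BP.
case: rho => [|[r1 uo]]; first by rewrite ltNge rle.
(* A radius equal to 1 excludes the empty class, so [M] has a point from which piecewise constant
   signals can be built. *)
have M0 : M !=set0.
  have [[a Ta]|T0] := pselect (T !=set0).
    by exists (a 0); have [+ _ _] := T_sub _ Ta; apply; rewrite inE/= /halfline/= in_itv/= lexx.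
  have : (gen_spectral_radius (classA Tmin) <= (expR (-1))%:E)%E.
    apply: (@radius_le _ _ _ 1 (-1) ltr01).
    by move=> A t [b [a Ta _] _]; exfalso; apply: T0; exists a.
  by rewrite r1 lee_fin leNgt expR_lt1 oppr_lt0 ltr01.
have no := classA_not_observable c0 Mc T_sub G_sub GT PQ A0 A3 T2 M0 g0 gP.
exact: no r1 uo.
Qed.
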